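(* Let $e_1,e_2,e_3$ be nonzero integers with $e_1+e_2+e_3=0$, $2\,\|\,e_1$, $2\,\|\,e_2$, $4\mid e_3$. Let $n=p_1\cdots p_k$ be an odd positive square-free integer coprime with $e_1e_2e_3$, whose prime factors are quadratic residues modulo each odd prime factor of $e_1e_2e_3$. Assume that - neither $E$ nor $E^{(n)}$ has a rational point of order $4$; - $e_3>0$ and $e_1<0$; - $\left(\frac{p^*}{q}\right)=1$ for all odd primes $p\mid n$, $q\mid e_1e_3$. If $\mathrm{Sel}_2(E/\mathbb{Q})\cong(\mathbb{Z}/2\mathbb{Z})^2$, then every class of $\mathrm{Sel}_2'(E^{(n)})$ has a unique representative $(d_1,d_2,d_3)$ with $d_i$ (possibly negative) divisors of $n$, $d_2>0$ and $d_3\equiv1\pmod 4$, and the map $(d_1,d_2,d_3)\mapsto\begin{pmatrix}\mathbf{y}\\ \mathbf{z}\end{pmatrix}$, where $\mathbf{y}=(v_{p_i}(d_2))_i^{\mathrm T}$, $\mathbf{z}=(v_{p_i}(d_3))_i^{\mathrm T}\in\mathbb{F}_2^k$, induces an isomorphism $$\mathrm{Sel}_2'(E^{(n)})\xrightarrow{\sim}\ker\begin{pmatrix}\mathbf{A}+\mathbf{D}_{-e_1}&\mathbf{D}_{-e_1e_3}\\ \mathbf{D}_{-e_1e_2}&\mathbf{A}^{\mathrm T}+\mathbf{D}_{-e_1}\end{pmatrix}.$$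
   Context: For a nonzero integer $m$, $E^{(m)}$ is $y^2=x(x-e_1m)(x+e_2m)$, $E=E^{(1)}$. For $\Lambda=(d_1,d_2,d_3)$ of nonzero square-free integers with $d_1d_2d_3$ a square, $D^{(m)}_\Lambda\subset\mathbb{P}^3$ is defined by $e_1mt^2+d_2u_2^2-d_3u_3^2=0$, $e_2mt^2+d_3u_3^2-d_1u_1^2=0$, $e_3mt^2+d_1u_1^2-d_2u_2^2=0$. $\mathrm{Sel}_2(E^{(m)}/\mathbb{Q})$ is identified with the group (componentwise multiplication) of $\Lambda\in(\mathbb{Q}^\times/\mathbb{Q}^{\times2})^3$ with $d_1d_2d_3\in\mathbb{Q}^{\times2}$ and $D^{(m)}_\Lambda(\mathbb{A}_{\mathbb{Q}})\ne\emptyset$; rational 2-torsion points correspond to $(1,1,1)$, $(-e_3m,-e_1e_3,e_1m)$, $(-e_2e_3,e_3m,-e_2m)$, $(e_2m,-e_1m,-e_1e_2)$. $\mathrm{Sel}_2'(E^{(m)})=\mathrm{Sel}_2(E^{(m)}/\mathbb{Q})/(E^{(m)}(\mathbb{Q})_{\rm tors}/2E^{(m)}(\mathbb{Q})_{\rm tors})$. $[\alpha,\beta]_v$ is the additive Hilbert symbol, $(\alpha,\beta)_v=(-1)^{[\alpha,\beta]_v}$. $\mathbf{A}=([p_j,-n]_{p_i})_{i,j}\in M_k(\mathbb{F}_2)$. For $u$ coprime to $n$, $\mathbf{D}_u=\mathrm{diag}([u/p_1],\dots,[u/p_k])$, with $[u/p]\in\mathbb{F}_2$ equal to $0$ if $u$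 is a quadratic residue mod $p$ and $1$ otherwise. For an odd integer $m$, $m^*=(-1)^{(m-1)/2}m\equiv1\pmod 4$. $2\,\|\,m$ means $2\mid m$, $4\nmid m$. *)

(* Defs.v *)
From HB Require Import structures.
From mathcomp Require Import all_boot all_order all_algebra.
From mathcomp Require Import boolp Rstruct.
Set Implicit Arguments. Unset Strict Implicit. Unset Printing Implicit Defensive.
Import Order.TTheory GRing.Theory Num.Theory.
Local Open Scope ring_scope.

Definition triple := (int * int * int)%type.
Definition t1 (s : triple) : int := s.1.1.
Definition t2 (s : triple) : int := s.1.2.
Definition t3 (s : triple) : int := s.2.
Definition mul3 (s r : triple) : triple := (t1 s * t1 r, t2 s * t2 r, t3 s * t3 r).

(* square-free nonzero integer (canonical representative of a class of Q^x/Q^x2) *)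
Definition sqfree (z : int) : Prop :=
  z != 0 /\ forall d : nat, (d ^ 2 %| absz z)%N -> d = 1%N.

(* z is a square (of an integer; for integers this is the same as being a rational square) *)
Definition is_sq (z : int) : Prop := exists c : int, z = c * c.

(* componentwise equality in (Q^x/Q^x2)^3 *)
Definition sqeq3 (s r : triple) : Prop :=
  is_sq (t1 s * t1 r) /\ is_sq (t2 s * t2 r) /\ is_sq (t3 s * t3 r).

Definition diagq (R : pzRingType) (N : nat) (c : N.-tuple int) (x : 'I_N -> R) : R :=
  \sum_(i < N) (tnth c i)%:~R * x i ^+ 2.

Definition real_solvable (N : nat) (cs : seq (N.-tuple int)) : Prop :=
  exists x : 'I_N -> Rdefinitions.R,
    (exists i, x i != 0) /\ forall c, c \in cs -> diagq c x = 0.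

(* Q_p-point of the projective variety {forms in cs = 0}: a primitive vector of
   Z_p^N (Z_p = inverse limit of Z/p^k) on which all forms vanish; x k is its
   reduction modulo p^k, the system (x k)_k being compatible. *)
Definition Qp_solvable (p N : nat) (cs : seq (N.-tuple int)) : Prop :=
  exists x : nat -> 'I_N -> int,
    (forall k, exists i, ~~ ((p%:Z) %| x k i)%Z) /\
    (forall k c, c \in cs -> (((p ^ k)%N%:Z) %| diagq c (x k))%Z) /\
    (forall k i, (x k.+1 i == x k i %[mod ((p ^ k)%N%:Z)])%Z).

Definition loc_solvable (N : nat) (cs : seq (N.-tuple int)) : Prop :=
  real_solvable cs /\ forall p : nat, prime p -> Qp_solvable p cs.

(* D^(m)_Lambda in variables (t,u1,u2,u3):
   e1 m t^2 + d2 u2^2 - d3 u3^2 = 0, e2 m t^2 + d3 u3^2 - d1 u1^2 = 0,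
   e3 m t^2 + d1 u1^2 - d2 u2^2 = 0 *)
Definition D_eqs (e1 e2 e3 m : int) (s : triple) : seq (4.-tuple int) :=
  [:: [tuple e1 * m; 0; t2 s; - t3 s];
      [tuple e2 * m; - t1 s; 0; t3 s];
      [tuple e3 * m; t1 s; - t2 s; 0]].

(* Sel_2(E^(m)/Q), with classes represented by square-free integer triples *)
Definition Sel2 (e1 e2 e3 m : int) (s : triple) : Prop :=
  sqfree (t1 s) /\ sqfree (t2 s) /\ sqfree (t3 s) /\
  is_sq (t1 s * t2 s * t3 s) /\ loc_solvable (D_eqs e1 e2 e3 m s).

(* images of the rational 2-torsion points *)
Definition tors (e1 e2 e3 m : int) : seq triple :=
  [:: (1, 1, 1); (- e3 * m, - e1 * e3, e1 * m); (- e2 * e3, e3 * m, - e2 * m);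
      (e2 * m, - e1 * m, - e1 * e2)].

(* s and r define the same class in Sel_2'(E^(m)) = Sel_2 / torsion image *)
Definition equivT (e1 e2 e3 m : int) (s r : triple) : Prop :=
  exists2 t, t \in tors e1 e2 e3 m & sqeq3 (mul3 s r) t.

Definition Sel2_iso_Z2sq (e1 e2 e3 m : int) : Prop :=
  exists f : triple -> 'rV['F_2]_2,
    (forall s r u, Sel2 e1 e2 e3 m s -> Sel2 e1 e2 e3 m r -> Sel2 e1 e2 e3 m u ->
        sqeq3 u (mul3 s r) -> f u = f s + f r) /\
    (forall s r, Sel2 e1 e2 e3 m s -> Sel2 e1 e2 e3 m r -> f s = f r -> s = r) /\
    (forall v, exists2 s, Sel2 e1 e2 e3 m s & f s = v).

(* E^(m) : y^2 = x(x - e1 m)(x + e2 m) = x^3 + a x^2 + b x has a rational point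
   P = (x,y) of order 4, i.e. P, 2P nonzero and 2P of order 2 (y(2P) = 0);
   2P computed with the doubling formula of the group law. *)
Definition has_pt4 (e1 e2 m : int) : Prop :=
  exists x y : rat,
    let a : rat := ((e2 - e1) * m)%:~R in
    let b : rat := (- (e1 * m) * (e2 * m))%:~R in
    let lam := (3 * x ^+ 2 + 2 * a * x + b) / (2 * y) in
    let x2 := lam ^+ 2 - a - 2 * x in
    let y2 := lam * (x - x2) - y in
    [/\ y ^+ 2 = x * (x - (e1 * m)%:~R) * (x + (e2 * m)%:~R), y != 0 & y2 = 0].

Definition two_exact (e : int) : Prop := (2 %| e)%Z /\ ~~ (4 %| e)%Z.

Definition nqr (u : int) (p : nat) : 'F_2 :=
  if [exists x : 'I_p, ((p%:Z) %| (nat_of_ord x)%:Z ^+ 2 - u)%Z] then 0 else 1.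

Definition hilb (p : nat) (a b : int) : 'F_2 :=
  if `[< Qp_solvable p [:: [tuple a; b; -1]] >] then 0 else 1.

(* m^* = (-1)^((m-1)/2) m for odd m *)
Definition pstar (q : nat) : int := if (q %% 4 == 1)%N then q%:Z else - q%:Z.

Definition Amat (k : nat) (p : 'I_k -> nat) (n : nat) : 'M['F_2]_k :=
  \matrix_(i, j) hilb (p i) (p j)%:Z (- n%:Z).

Definition Dmat (k : nat) (p : 'I_k -> nat) (u : int) : 'M['F_2]_k :=
  diag_mx (\row_i nqr u (p i)).

Definition Mmat (e1 e2 e3 : int) (k : nat) (p : 'I_k -> nat) (n : nat) : 'M['F_2]_(k + k) :=
  block_mx (Amat p n + Dmat p (- e1)) (Dmat p (- e1 * e3))
           (Dmat p (- e1 * e2)) ((Amat p n)^T + Dmat p (- e1)).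

Definition yz (k : nat) (p : 'I_k -> nat) (r : triple) : 'cV['F_2]_(k + k) :=
  col_mx (\col_i (odd (logn (p i) (absz (t2 r))))%:R)
         (\col_i (odd (logn (p i) (absz (t3 r))))%:R).

Definition normrep (e1 e2 e3 : int) (n : nat) (r : triple) : Prop :=
  Sel2 e1 e2 e3 n%:Z r /\
  [/\ (t1 r %| n%:Z)%Z, (t2 r %| n%:Z)%Z, (t3 r %| n%:Z)%Z,
      0 < t2 r & (t3 r == 1 %[mod 4])%Z].

(* Main.v *)
(** Write [X_i = d_i u_i^2] and [E_i = e_i m]. A Q_q-point of [D] is a solution of
    [X3 - X2 = E1 t^2], [X1 - X3 = E2 t^2], [X2 - X1 = E3 t^2] with [X_i] in the square class of
    [d_i]; comparing valuations determines the admissible classes. At an odd prime of good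
    reduction all unit classes occur (a character sum), at [p | n] exactly the four torsion
    classes, and at infinity the condition is [d2 > 0]. At 2, once [d2] and [d3] have even
    valuation (which translation by torsion achieves), solubility forces [d3 = 1 mod 4];
    conversely, for [d2 > 0] and [d3 = 1 mod 4] solubility at 2 follows from solubility at all odd
    primes by the product formula for the Hilbert symbols of the conics covered by [D].

    For a normalised Selmer element of [E^(n)], split off the part of [(d2, d3)] supported on [n],
    taking [d2] positive and [d3] a product of [p*]. At [q | e1 e3] that part is a square, and at
    the other odd [q | e2] it changes at most the signs of [d1] and [d3], which preserves
    solubility. Hence the complementary part lies in [Sel_2(E)], whose four elements are the
    torsion classes (these are told apart by 2-adic parities), so it is trivial. What remains
    is solubility at the [p_i]: by quadratic reciprocity it is the linear system of the matrix. *)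

Require Import Defs.
From mathcomp Require Import all_boot all_order all_algebra.
From mathcomp Require Import boolp Rstruct.
From mathcomp Require Import zify ring lra.
Set Implicit Arguments. Unset Strict Implicit. Unset Printing Implicit Defensive.
Import Order.TTheory GRing.Theory Num.Theory.
Local Open Scope ring_scope.

(** * Valuations and unit parts *)

(** The obstacle is that a point over Q_q is given only as a compatible system of residues, so no
    field operations are at hand. Square classes are open in Q_q; this turns local solubility into
    exact equations between integers whose classes are recorded by the finite invariant [sg], and
    Hensel's lemma with a compactness argument leads back. Hilbert symbols become explicit formulas
    in the same invariants, and their product formula follows from bilinearity, the two
    supplementary laws and quadratic reciprocity, all derived here from Gauss's lemma. Two effects
    shape the rest. Since [e1] and [e2] have 2-adic valuation exactly 1 and [n] is odd, the pair of
    parities of the valuations of d2 and d3 at 2 takes each of its four values on exactly one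
    torsion class; this gives both existence and uniqueness of the normalised representative. And a
    prime dividing only [e2] sees [pstar p] as a square merely up to sign; there X1 - X3 = E2 t^2 is
    small, and a case analysis on valuations shows that d1 and d3 may change sign together. *)

Definition vv (q : nat) (a : int) : nat := logn q `|a|%N.
Definition up (q : nat) (a : int) : int := (a %/ (q ^ vv q a)%N%:Z)%Z.
Definition vo (q : nat) (a : int) : bool := odd (vv q a).

Lemma Euclid_dvdzM (q : nat) (a b : int) : prime q ->
  (q%:Z %| a * b)%Z = (q%:Z %| a)%Z || (q%:Z %| b)%Z.
Proof. by move=> pq; rewrite !dvdzE abszM /= Euclid_dvdM. Qed.

Lemma Euclid_dvdzX (q : nat) (a : int) k : prime q ->
  (q%:Z %| a ^+ k)%Z = (q%:Z %| a)%Z && (0 < k)%N.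
Proof. by move=> pq; rewrite !dvdzE abszX /= Euclid_dvdX. Qed.

Lemma upE q a : a = (q ^ vv q a)%N%:Z * up q a.
Proof. by rewrite mulrC divzK // dvdzE /= pfactor_dvdnn. Qed.

Lemma vv_up_uniq q k u : prime q -> ~~ (q%:Z %| u)%Z ->
  vv q ((q ^ k)%N%:Z * u) = k /\ up q ((q ^ k)%N%:Z * u) = u.
Proof.
move=> pq nu.
have u0 : (0 < `|u|)%N by rewrite absz_gt0; apply: contraNneq nu => ->; rewrite dvdz0.
have E : vv q ((q ^ k)%N%:Z * u) = k.
  rewrite /vv abszM /= lognM ?expn_gt0 ?(prime_gt0 pq) //.
  rewrite pfactorK // logn_coprime ?addn0 //.
  by rewrite (prime_coprime _ pq); move: nu; rewrite dvdzE.
split=> //; rewrite /up E mulKz //.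
by rewrite eqz_nat -lt0n expn_gt0 (prime_gt0 pq).
Qed.

Lemma up_ndvd q a : prime q -> a != 0 -> ~~ (q%:Z %| up q a)%Z.
Proof.
move=> pq a0; apply/negP => /dvdzP [c hc].
have : (q ^ (vv q a).+1 %| `|a|)%N.
  have H := upE q a; rewrite {}hc in H.
  rewrite {2}H !abszM /= expnSr; apply/dvdnP; exists `|c|%N; lia.
by rewrite pfactor_dvdn // ?ltnn // absz_gt0.
Qed.

Lemma vvM q a b : prime q -> a != 0 -> b != 0 -> vv q (a * b) = (vv q a + vv q b)%N.
Proof. by move=> pq a0 b0; rewrite /vv abszM lognM ?absz_gt0. Qed.

Lemma upM q a b : prime q -> a != 0 -> b != 0 -> up q (a * b) = up q a * up q b.
Proof.
move=> pq a0 b0.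
have [] := @vv_up_uniq q (vv q a + vv q b) (up q a * up q b) pq; first by rewrite Euclid_dvdzM // negb_or !up_ndvd.
move=> _ <-; congr up; rewrite {1}(upE q a) {1}(upE q b) expnD PoszM; ring.
Qed.

Lemma voM q a b : prime q -> a != 0 -> b != 0 -> vo q (a * b) = vo q a (+) vo q b.
Proof. by move=> pq a0 b0; rewrite /vo vvM // oddD. Qed.

Lemma vv_unit q a : ~~ (q%:Z %| a)%Z -> vv q a = 0%N.
Proof.
rewrite dvdzE /= => h; rewrite /vv lognE; case: ifP => // /and3P [_ _ h'].
by rewrite h' in h.
Qed.

Lemma up_unit q a : ~~ (q%:Z %| a)%Z -> up q a = a.
Proof. by move=> h; rewrite /up vv_unit // expn0 divz1. Qed.

Lemma vv_ge q a k : prime q -> a != 0 -> (k <= vv q a)%N = ((q ^ k)%N%:Z %| a)%Z.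
Proof. by move=> pq a0; rewrite dvdzE /= pfactor_dvdn // absz_gt0. Qed.

(** * Quadratic residues *)

(* Also [true] when [q] divides [u]. *)
Definition nr (q : nat) (u : int) : bool := (u%:~R : 'F_q) ^+ q./2 != 1.

Section Residues.
Variable q : nat.
Hypotheses (pq : prime q) (oq : odd q).

Lemma intrF_eq0 (a : int) : (a%:~R == 0 :> 'F_q) = (q%:Z %| a)%Z.
Proof.
have H := dvdn_pcharf (pchar_Fp pq).
by case: a => m; rewrite ?NegzE ?mulrNz ?oppr_eq0 dvdzE /= H.
Qed.

Lemma intrF_eq (a b : int) : (a%:~R == b%:~R :> 'F_q) = (q%:Z %| a - b)%Z.
Proof. by rewrite -subr_eq0 -mulrzBr intrF_eq0. Qed.

Lemma q_half : q = (q./2 + q./2).+1.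
Proof. by rewrite -{1}(odd_double_half q) oq -addnn. Qed.

Lemma q_ge3 : (2 < q)%N.
Proof. by have := prime_gt1 pq; move: oq; case: (q) => [|[|[|]]]. Qed.

Lemma Fq_two_neq0 : 2 != 0 :> 'F_q.
Proof.
have := intrF_eq0 2; rewrite -[2%:~R]/(2%:R) => ->; rewrite dvdzE /=.
by apply/negP => /dvdn_leq -/(_ isT); have := q_ge3; lia.
Qed.

Lemma Fq_m1_neq1 : -1 != 1 :> 'F_q.
Proof. by rewrite eq_sym -subr_eq0 opprK Fq_two_neq0. Qed.

Lemma Fq_expq (x : 'F_q) : x ^+ q = x.
Proof.
have ch := pchar_Fp pq; rewrite -(pFrobenius_autE ch) -[x]natr_Zp.
exact: pFrobenius_aut_nat.
Qed.

Lemma euler_pm1 (x : 'F_q) : x != 0 -> (x ^+ q./2 == 1) || (x ^+ q./2 == -1).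
Proof.
move=> x0; have : x ^+ (q./2 + q./2).+1 = x by rewrite -q_half Fq_expq.
rewrite exprS => /(canRL (mulKf x0)); rewrite mulVf // exprD => /eqP.
by rewrite -expr2 sqrf_eq1.
Qed.

(** The squares of 1, ..., (q-1)/2 are already (q-1)/2 distinct roots of X^((q-1)/2) - 1; a
    non-square root would be one too many. *)
Lemma euler_criterion (x : 'F_q) : x != 0 -> x ^+ q./2 = 1 -> exists y, x = y ^+ 2.
Proof.
move=> x0 hx.
case: (pickP (fun y : 'F_q => x == y ^+ 2)) => [y /eqP ->|nsq]; first by exists y.
have q2 : (0 < q./2)%N by have := q_half; have := q_ge3; lia.
pose rs := x :: [seq (i.+1%:R : 'F_q) ^+ 2 | i <- iota 0 q./2].
pose P : {poly 'F_q} := 'X^(q./2) - 1%:P.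
have sP : size P = q./2.+1 by rewrite size_XnsubC.
have n0 i : (i < q./2)%N -> (i.+1%:R : 'F_q) != 0.
  move=> hi; rewrite -(dvdn_pcharf (pchar_Fp pq)); apply/negP => /dvdn_leq -/(_ isT).
  by have := q_half; lia.
have : (size rs < size P)%N.
  apply: max_poly_roots.
  - by rewrite -size_poly_eq0 sP.
  - apply/allP => y; rewrite inE => /predU1P [->|/mapP [i]]; first by rewrite rootE !hornerE hx subrr.
    rewrite mem_iota => /n0 i0 ->; rewrite rootE !hornerE -exprM mulnC exprM.
    have /(canRL (mulKf i0)) : i.+1%:R * (i.+1%:R : 'F_q) ^+ (q./2 + q./2) = i.+1%:R by rewrite -exprS -q_half Fq_expq.
    rewrite mulVf // addnn -muln2 exprM => ->; by rewrite subrr.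
  - rewrite /rs /= map_inj_in_uniq ?iota_uniq ?andbT.
      by apply/mapP => -[i _ E]; have := nsq i.+1%:R; rewrite E eqxx.
    move=> i j; rewrite !mem_iota !add0n => /= hi hj /eqP; rewrite eqf_sqr => /orP [].
      rewrite -subr_eq0; wlog le : i j hi hj / (j <= i)%N.
        move=> W; case: (leqP j i) => [|/ltnW] le h; first exact: W.
        by apply/esym; apply: W => //; rewrite -oppr_eq0 opprB.
      rewrite -natrB // -(dvdn_pcharf (pchar_Fp pq)) subSS => h.
      case: (posnP (i - j)%N) => [|pos]; first by lia.
      by have := dvdn_leq pos h; have := q_half; lia.
    rewrite -addr_eq0 -natrD -(dvdn_pcharf (pchar_Fp pq)) => /dvdn_leq -/(_ isT).
    by have := q_half; lia.
by rewrite /= size_map size_iota sP ltnn.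
Qed.

Lemma nr_sqr_ex (u : int) : ~~ (q%:Z %| u)%Z -> ~~ nr q u ->
  exists y : int, ~~ (q%:Z %| y)%Z /\ (q%:Z %| y ^+ 2 - u)%Z.
Proof.
move=> nu; rewrite negbK => /eqP h.
have [|y hy] := euler_criterion _ h; first by rewrite intrF_eq0.
have hd : (q%:Z %| (y : nat)%:Z ^+ 2 - u)%Z.
  by rewrite -intrF_eq rmorphXn /= -pmulrn natr_Zp -hy.
exists (y : nat)%:Z; split=> //.
apply: contra nu => hy'; have : (q%:Z %| (y : nat)%:Z ^+ 2)%Z by rewrite Euclid_dvdzX // hy'.
by move=> h2; have := rpredB h2 hd; rewrite opprB addrC subrK.
Qed.

Lemma nr_eqmod (a b : int) : (q%:Z %| a - b)%Z -> nr q a = nr q b.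
Proof. by rewrite -intrF_eq /nr => /eqP ->. Qed.

Lemma nrM (a b : int) : ~~ (q%:Z %| a)%Z -> ~~ (q%:Z %| b)%Z ->
  nr q (a * b) = nr q a (+) nr q b.
Proof.
rewrite -!intrF_eq0 => /euler_pm1 ha /euler_pm1 hb.
rewrite /nr rmorphM /= exprMn.
by case/orP: ha => /eqP ->; case/orP: hb => /eqP ->;
  rewrite ?mul1r ?mulr1 ?mulrNN ?eqxx ?Fq_m1_neq1.
Qed.

Lemma nr1 : nr q 1 = false.
Proof. by rewrite /nr expr1n eqxx. Qed.

Lemma nr_sqr (y : int) : ~~ (q%:Z %| y)%Z -> nr q (y ^+ 2) = false.
Proof. by move=> ny; rewrite expr2 nrM // addbb. Qed.

Lemma nrN1 : nr q (-1) = odd q./2.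
Proof.
rewrite /nr rmorphN1 -signr_odd; case: odd; first by rewrite Fq_m1_neq1.
by rewrite eqxx.
Qed.

Lemma nr_sign_eq (u : int) b : (u%:~R : 'F_q) ^+ q./2 = (-1) ^+ b -> nr q u = odd b.
Proof. by rewrite /nr -(signr_odd _ b) => ->; case: odd; rewrite ?Fq_m1_neq1 ?eqxx. Qed.

End Residues.

(** * Gauss's lemma and quadratic reciprocity *)

Section GaussLemma.
Variables (q a : nat).
Hypotheses (pq : prime q) (oq : odd q) (na : ~~ (q %| a)%N).
Let h := q./2.

Let rm (x : 'I_h) : nat := (a * x.+1 %% q)%N.
Let mu (x : 'I_h) : bool := (h < rm x)%N.
Let ab (x : 'I_h) : nat := if mu x then (q - rm x)%N else rm x.

Let hq : q = (h + h).+1. Proof. exact: q_half. Qed.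

Let rm_gt0 x : (0 < rm x)%N.
Proof.
rewrite lt0n; apply/negP => H; have : (q %| a * x.+1)%N by [].
rewrite Euclid_dvdM // (negbTE na) /= => /dvdn_leq -/(_ isT).
by have := ltn_ord x; lia.
Qed.

Let rm_lt x : (rm x < q)%N. Proof. by rewrite ltn_mod prime_gt0. Qed.

Let ab_bound x : (0 < ab x <= h)%N.
Proof. by rewrite /ab; have := rm_gt0 x; have := rm_lt x; case: ifP; rewrite /mu; lia. Qed.

Let ab1_lt x : ((ab x).-1 < h)%N. Proof. have := ab_bound x; lia. Qed.
Let f (x : 'I_h) : 'I_h := Ordinal (ab1_lt x).

Let f_inj : injective f.
Proof.
move=> x y /(congr1 val) /= E.
have {}E : ab x = ab y by have := ab_bound x; have := ab_bound y; lia.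
have hx := divn_eq (a * x.+1) q; have hy := divn_eq (a * y.+1) q.
rewrite -/(rm x) -/(rm y) in hx hy.
have lx := ltn_ord x; have ly := ltn_ord y.
have S : rm x = rm y \/ (rm x + rm y)%N = q.
  by move: E; rewrite /ab /mu; have := rm_lt x; have := rm_lt y; do 2 case: ifP => _; lia.
case: S => S.
  have : (q %| a * x.+1 - a * y.+1)%N /\ (q %| a * y.+1 - a * x.+1)%N.
    by rewrite hx hy S !subnDr -!mulnBl !dvdn_mull.
  rewrite -!mulnBr !Euclid_dvdM // (negbTE na) /= => -[/dvdn_leq h1 /dvdn_leq h2].
  by apply: val_inj => /=; move: h1 h2; lia.
have : (q %| a * (x.+1 + y.+1))%N.
  rewrite mulnDr hx hy addnACA S -mulnDl -[X in (_ + X)%N]mul1n -mulnDl.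
  by rewrite dvdn_mull.
rewrite Euclid_dvdM // (negbTE na) /= => /dvdn_leq -/(_ isT); lia.
Qed.

Let abE x : ab x = (f x).+1. Proof. by have := ab_bound x; rewrite /f /=; lia. Qed.

(** The product of a, 2a, ..., ha is a^h h!, and also h! times one sign for each [mu x]; h! is a
    unit mod q and a^h is the Euler symbol. *)
Lemma gauss_lemma : nr q a%:Z = odd (\sum_(x < h) (h < a * x.+1 %% q))%N.
Proof.
apply: (nr_sign_eq pq oq).
have P0 : \prod_(x < h) (x.+1%:R : 'F_q) != 0.
  rewrite prodf_seq_neq0; apply/allP => x _ /=.
  rewrite -(dvdn_pcharf (pchar_Fp pq)); apply/negP => /dvdn_leq -/(_ isT).
  by have := ltn_ord x; lia.
apply: (mulIf P0).
rewrite -pmulrn -[q./2]card_ord -prodr_const -big_split /=.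
rewrite expr_sum.
rewrite [X in _ = _ * X](reindex_inj f_inj) /= -big_split /=.
apply: eq_big => // x _; rewrite -abE -natrM /ab.
rewrite {1}(divn_eq (a * x.+1) q) natrD natrM (pchar_Fp_0 pq) mulr0 add0r -/(rm x).
rewrite -/(mu x); case: (mu x); last first.
  by rewrite mul1r.
by rewrite expr1 natrB ?(ltnW (rm_lt x)) // (pchar_Fp_0 pq) sub0r mulN1r opprK.
Qed.

Let sum_ab : (\sum_(x < h) ab x = \sum_(x < h) x.+1)%N.
Proof. by rewrite [RHS](reindex_inj f_inj); apply: eq_bigr => x _; exact: abE. Qed.

(** Division with remainder, summed over x: as q is odd, passing from the remainder to [ab x]
    changes the parity exactly when [mu x] holds. The parity of [a] is left open, so the formula
    serves both for 2 and for odd primes. *)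
Lemma eisenstein_parity : nr q a%:Z =
  odd (a * \sum_(x < h) x.+1) (+) odd (\sum_(x < h) (a * x.+1) %/ q) (+) odd (\sum_(x < h) x.+1).
Proof.
rewrite gauss_lemma -{2}sum_ab big_distrr /= -!oddD -!big_split /=.
elim/big_ind2: _ => // [b c d e|x _]; first by rewrite !oddD => -> ->.
rewrite {2}(divn_eq (a * x.+1) q) -/(rm x) /ab /mu !oddD !oddM oq andbT.
case: ifP => _; last by case: (odd (rm x)); case: (odd (_ %/ _)).
by rewrite oddB ?(ltnW (rm_lt x)) // oq; case: (odd (rm x)); case: (odd (_ %/ _)).
Qed.

End GaussLemma.

Lemma nr2 q : prime q -> odd q -> nr q 2 = (q %% 8 == 3)%N || (q %% 8 == 5)%N.
Proof.
move=> pq oq; rewrite (@eisenstein_parity q 2) //; last first.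
  by apply/negP => /dvdn_leq -/(_ isT); have := q_ge3 pq oq; lia.
(* 2 (x+1) < q, so all quotients vanish and only the triangular number h (h+1) / 2 remains; its
   parity depends on h mod 4. *)
rewrite oddM /= big1 => [|x _]; last first.
  by apply: divn_small; have := q_half oq; have := ltn_ord x; lia.
rewrite /=; have := q_half oq; move: q./2 => h ->.
have -> : odd (\sum_(x < h) x.+1) = (h %% 4 == 1)%N || (h %% 4 == 2)%N.
  elim: h => [|h IH]; first by rewrite big_ord0.
  by rewrite big_ord_recr /= -[(_.+1)%N]addn1 oddD {}IH oddD; lia.
lia.
Qed.

(** A quotient read as a number of lattice points on a segment. *)
Lemma sum_leq_mul (d k m : nat) : (0 < d)%N ->
  (\sum_(y < k) (d * y.+1 <= m) = minn k (m %/ d))%N.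
Proof.
move=> d0; elim: k => [|k IH]; first by rewrite big_ord0 min0n.
rewrite big_ord_recr /= IH mulnC -leq_divRL //; lia.
Qed.

Lemma quadratic_reciprocity q r : prime q -> prime r -> odd q -> odd r -> q != r ->
  nr q r%:Z (+) nr r q%:Z = odd q./2 && odd r./2.
Proof.
(* Each symbol is the parity of the number of lattice points on one side of the diagonal of a
   rectangle with sides [a./2] and [b./2]; the two sides together fill it, as no point lies on the
   diagonal. *)
have P a b : prime a -> prime b -> odd a -> odd b -> a != b ->
    nr a b%:Z = odd (\sum_(x < a./2) \sum_(y < b./2) (a * y.+1 < b * x.+1))%N.
  move=> pa pb oa ob ab.
  have nab : ~~ (a %| b)%N by rewrite dvdn_prime2.
  rewrite eisenstein_parity // oddM ob /= addbC addbA addbb addFb; congr odd.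
  apply: eq_bigr => x _.
  have -> : (b * x.+1 %/ a = minn b./2 (b * x.+1 %/ a))%N.
    have : (b * x.+1 %/ a < b./2.+1)%N.
      rewrite ltn_divLR ?prime_gt0 //.
      have := q_half oa; have := q_half ob; have := ltn_ord x.
      move: (a./2) (b./2) (nat_of_ord x) => u v w ? -> ->; nia.
    lia.
  rewrite -sum_leq_mul ?prime_gt0 //; apply: eq_bigr => y _.
  rewrite ltn_neqAle; case: eqP => //= E.
  have : (a %| b * x.+1)%N by rewrite -E dvdn_mulr.
  rewrite Euclid_dvdM // (negbTE nab) /= => /dvdn_leq -/(_ isT).
  by have := ltn_ord x; have := q_half oa; lia.
move=> pq pr oq or qr.
rewrite (P q r) // (P r q) //; last by rewrite eq_sym.
rewrite exchange_big -oddD -big_split -oddM /=; congr odd.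
rewrite -[(q./2 * _)%N]mulnC.
rewrite (eq_bigr (fun=> q./2)) ?sum_nat_const ?card_ord // => y _.
rewrite -big_split /= (eq_bigr (fun=> 1%N)) ?sum_nat_const ?card_ord ?muln1 // => x _.
case: ltngtP => //= E.
have : (q %| r * x.+1)%N by rewrite -E dvdn_mulr.
rewrite Euclid_dvdM // dvdn_prime2 // (negbTE qr) /= => /dvdn_leq -/(_ isT).
by have := ltn_ord x; have := q_half oq; lia.
Qed.

(** * Local square classes *)

Definition lg (q : nat) (a : int) : bool := nr q (up q a).
(* The characters (-1)^((u-1)/2) and (-1)^((u^2-1)/8) of the odd part [u] of [a]. *)
Definition ep (a : int) : bool := (up 2 a %% 4)%Z == 3.
Definition om (a : int) : bool := ((up 2 a %% 8)%Z == 3) || ((up 2 a %% 8)%Z == 5).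

(* A complete invariant of the class of a nonzero integer in Q_q^x / Q_q^x2. *)
Definition sg (q : nat) (a : int) : bool * bool * bool :=
  (vo q a, if q == 2 then ep a else lg q a, (q == 2) && om a).

Definition xor3 (s r : bool * bool * bool) : bool * bool * bool :=
  (s.1.1 (+) r.1.1, s.1.2 (+) r.1.2, s.2 (+) r.2).

Lemma sg_oddE q (a b : int) : q != 2 -> (sg q a = sg q b) <-> (vo q a = vo q b /\ lg q a = lg q b).
Proof. by move=> /negbTE q2; rewrite /sg q2; split=> [[-> ->]|[-> ->]]. Qed.

Lemma sg2E (a b : int) : (sg 2 a = sg 2 b) <-> [/\ vo 2 a = vo 2 b, ep a = ep b & om a = om b].
Proof. by rewrite /sg /=; split=> [[-> -> ->]|[-> -> ->]]. Qed.

Lemma odd_prime_neq2 q : odd q -> q != 2.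
Proof. by apply: contraTneq => ->. Qed.

Lemma odd_prime2 p : prime p -> p != 2 -> odd p.
Proof. by case/even_prime=> [->|]. Qed.

Lemma lgM q (a b : int) : prime q -> odd q -> a != 0 -> b != 0 -> lg q (a * b) = lg q a (+) lg q b.
Proof. by move=> pq oq a0 b0; rewrite /lg upM // nrM // up_ndvd. Qed.

Lemma odd_mod8 (u : int) : ~~ (2 %| u)%Z ->
  [\/ (u %% 8)%Z = 1, (u %% 8)%Z = 3, (u %% 8)%Z = 5 | (u %% 8)%Z = 7].
Proof.
move=> h; have : [|| (u %% 8)%Z == 1, (u %% 8)%Z == 3, (u %% 8)%Z == 5 | (u %% 8)%Z == 7] by lia.
by case/or4P => /eqP; [constructor 1|constructor 2|constructor 3|constructor 4].
Qed.

Lemma mod4_mod8 (u : int) : (u %% 4)%Z = ((u %% 8)%Z %% 4)%Z.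
Proof. lia. Qed.

Lemma up2_odd (a : int) : a != 0 -> ~~ (2 %| up 2 a)%Z.
Proof. by move=> a0; have := @up_ndvd 2 a isT a0. Qed.

Lemma epM (a b : int) : a != 0 -> b != 0 -> ep (a * b) = ep a (+) ep b.
Proof.
move=> a0 b0; rewrite /ep upM // !(mod4_mod8 (up _ _ * _)) !(mod4_mod8 (up _ _)) -modzMm.
by case: (odd_mod8 (up2_odd a0)) => ->; case: (odd_mod8 (up2_odd b0)) => ->.
Qed.

Lemma omM (a b : int) : a != 0 -> b != 0 -> om (a * b) = om a (+) om b.
Proof.
move=> a0 b0; rewrite /om upM // -modzMm.
by case: (odd_mod8 (up2_odd a0)) => ->; case: (odd_mod8 (up2_odd b0)) => ->.
Qed.

Lemma sgM q (a b : int) : prime q -> a != 0 -> b != 0 -> sg q (a * b) = xor3 (sg q a) (sg q b).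
Proof.
move=> pq a0 b0; rewrite /sg /xor3 /= voM //; case: eqP => [->|/eqP q2].
  by rewrite epM // omM.
by rewrite lgM // odd_prime2.
Qed.

Lemma xor3ss s : xor3 s s = (false, false, false).
Proof. by rewrite /xor3 !addbb. Qed.

Lemma xor3A : associative xor3.
Proof. by move=> a b c; rewrite /xor3 /= !addbA. Qed.
Lemma xor3C : commutative xor3.
Proof. by move=> a b; rewrite /xor3 (addbC a.2) (addbC a.1.1) (addbC a.1.2). Qed.
Lemma xor3f s : xor3 s (false, false, false) = s.
Proof. by case: s => [[a b] c]; rewrite /xor3 /= !addbF. Qed.

Lemma sg1 q : prime q -> sg q 1 = (false, false, false).
Proof. by move=> pq; have := @sgM q 1 1 pq isT isT; rewrite mul1r => E; have := xor3ss (sg q 1); rewrite -E. Qed.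

Lemma sgMsqr q (a c : int) : prime q -> a != 0 -> c != 0 -> sg q (a * c ^+ 2) = sg q a.
Proof.
move=> pq a0 c0; rewrite expr2 mulrA !sgM // ?mulf_neq0 //.
by rewrite -xor3A xor3ss xor3f.
Qed.

Lemma sg_sqr q (c : int) : prime q -> c != 0 -> sg q (c ^+ 2) = sg q 1.
Proof. by move=> pq c0; rewrite -[c ^+ 2]mul1r sgMsqr. Qed.

Lemma up_add q (a b : int) j : prime q -> a != 0 -> (0 < j)%N -> ((q ^ (vv q a + j))%N%:Z %| b)%Z ->
  [/\ a + b != 0, vv q (a + b) = vv q a & ((q ^ j)%N%:Z %| up q (a + b) - up q a)%Z].
Proof.
move=> pq a0 j0 /dvdzP [s hs].
have E : a + b = (q ^ vv q a)%N%:Z * (up q a + (q ^ j)%N%:Z * s).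
  by rewrite {1}(upE q a) hs expnD PoszM; ring.
have nd : ~~ (q%:Z %| up q a + (q ^ j)%N%:Z * s)%Z.
  rewrite rpredDr ?up_ndvd // dvdz_mulr // -(prednK j0) expnS PoszM dvdz_mulr //.
have [Ev Eu] := vv_up_uniq (vv q a) pq nd; rewrite -E in Ev Eu.
split=> //; last by rewrite Eu addrC addKr dvdz_mulr.
rewrite E mulf_neq0 //; last by apply: contraNneq nd => ->; rewrite dvdz0.
by rewrite eqz_nat -lt0n expn_gt0 prime_gt0.
Qed.

Lemma sg_add_odd q (a b : int) : prime q -> odd q -> a != 0 -> ((q ^ (vv q a).+1)%N%:Z %| b)%Z ->
  [/\ a + b != 0, vv q (a + b) = vv q a & sg q (a + b) = sg q a].
Proof.
move=> pq oq a0; rewrite -addn1 => /(up_add (j := 1) pq a0 isT) [h1 h2 h3]; split=> //.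
apply/sg_oddE; first exact: odd_prime_neq2.
by rewrite /vo h2; split=> //; rewrite /lg; apply: nr_eqmod; rewrite ?expn1 in h3.
Qed.

(** Square classes are open. The margin 3 is dictated by q = 2, where the class of a unit is its
    residue mod 8; it is kept for all q so that later estimates are uniform. *)
Lemma sg_add q (a b : int) : prime q -> a != 0 -> ((q ^ (vv q a + 3))%N%:Z %| b)%Z ->
  [/\ a + b != 0, vv q (a + b) = vv q a & sg q (a + b) = sg q a].
Proof.
move=> pq a0 hb; case: (up_add (j := 3) pq a0 isT hb) => [h1 h2 h3].
case: (altP (q =P 2)) => [q2|q2]; last first.
  apply: sg_add_odd => //; first exact: odd_prime2.
  by apply: dvdz_trans hb; rewrite dvdzE /= dvdn_exp2l // addn3 !ltnS leqW.
split=> //; subst q; apply/sg2E; rewrite /vo h2; move: h3 => /= h3.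
have {}h3 : (8 %| up 2 (a + b) - up 2 a)%Z by [].
have E : (up 2 (a + b) %% 8)%Z = (up 2 a %% 8)%Z by lia.
by rewrite /ep /om !(mod4_mod8 (up _ _)) E.
Qed.

(** * Hilbert symbols and the product formula *)

(** The classical closed formulas for the Hilbert symbol at an odd prime, at 2 and at infinity,
    written additively; bilinearity is then a boolean identity. *)
Definition hs (q : nat) (a b : int) : bool :=
  (vo q a && vo q b && lg q (-1)) (+) (vo q a && lg q b) (+) (vo q b && lg q a).
Definition h2 (a b : int) : bool := (ep a && ep b) (+) (vo 2 a && om b) (+) (vo 2 b && om a).
Definition hoo (a b : int) : bool := (a < 0) && (b < 0).

(** The sum over all places, with the odd primes cut off at [N]: an odd prime dividing neither entry
    contributes nothing, so for nonzero entries [N] only has to exceed both absolute values. *)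
Definition hsum (N : nat) (a b : int) : bool :=
  (\big[addb/false]_(q <- iota 0 N | prime q && odd q) hs q a b) (+) h2 a b (+) hoo a b.

Lemma hsC q (a b : int) : hs q a b = hs q b a.
Proof. by rewrite /hs; case: (lg q (-1)); case: (vo q a); case: (vo q b); case: (lg q a); case: (lg q b). Qed.
Lemma h2C (a b : int) : h2 a b = h2 b a.
Proof. by rewrite /h2 [ep a && _]andbC -!addbA; congr addb; exact: addbC. Qed.
Lemma hsumC N (a b : int) : hsum N a b = hsum N b a.
Proof. by rewrite /hsum h2C /hoo andbC; congr (_ (+) _ (+) _); apply: eq_bigr => q _; exact: hsC. Qed.

Lemma hsM q (a a' b : int) : prime q -> odd q -> a != 0 -> a' != 0 ->
  hs q (a * a') b = hs q a b (+) hs q a' b.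
Proof.
move=> pq oq a0 a'0; rewrite /hs voM // lgM //.
by case: (vo q a); case: (vo q a'); case: (vo q b); case: (lg q a); case: (lg q a'); case: (lg q b); case: (lg q _).
Qed.

Lemma h2M (a a' b : int) : a != 0 -> a' != 0 -> h2 (a * a') b = h2 a b (+) h2 a' b.
Proof.
move=> a0 a'0; rewrite /h2 voM // epM // omM //.
by case: (vo 2 a); case: (vo 2 a'); case: (vo 2 b); case: (om a); case: (om a'); case: (om b); case: (ep a); case: (ep a'); case: (ep b).
Qed.

Lemma hooM (a a' b : int) : a != 0 -> a' != 0 -> hoo (a * a') b = hoo a b (+) hoo a' b.
Proof.
move=> a0 a'0; rewrite /hoo.
have -> : (a * a' < 0) = (a < 0) (+) (a' < 0).
  by case: (ltrgt0P a) a0 => // ? _; case: (ltrgt0P a') a'0 => // ? _; nia.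
by case: (b < 0); case: (a < 0); case: (a' < 0).
Qed.

Lemma hsumM N (a a' b : int) : a != 0 -> a' != 0 -> hsum N (a * a') b = hsum N a b (+) hsum N a' b.
Proof.
move=> a0 a'0; rewrite /hsum h2M // hooM //.
have -> : \big[addb/false]_(q <- iota 0 N | prime q && odd q) hs q (a * a') b =
  (\big[addb/false]_(q <- iota 0 N | prime q && odd q) hs q a b) (+)
  (\big[addb/false]_(q <- iota 0 N | prime q && odd q) hs q a' b).
  by rewrite -big_split /=; apply: eq_bigr => q /andP [pq oq]; exact: hsM.
by do 2 case: (bigop _ _ _); do 2 case: (h2 _ _); do 2 case: (hoo _ _).
Qed.

(** Reduces a multiplicative statement to the generators -1 and primes; the bound keeps all primes
    involved within the range of [hsum]. *)
Lemma int_prime_ind (P : int -> Prop) (N : nat) : P 1 -> P (-1) ->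
  (forall r : nat, prime r -> (r < N)%N -> P r%:Z) ->
  (forall a b, a != 0 -> b != 0 -> P a -> P b -> P (a * b)) ->
  forall a : int, a != 0 -> (`|a| < N)%N -> P a.
Proof.
move=> P1 PN Pp PM.
have H (m : nat) : (0 < m)%N -> (m < N)%N -> P m%:Z.
  elim/ltn_ind: m => m IH m0 mN.
  case: (ltngtP m 1) => [|m1|->//]; first by lia.
  have E : m = (pdiv m * (m %/ pdiv m))%N by rewrite mulnC divnK // pdiv_dvd.
  have pm := pdiv_prime m1; have p1 := prime_gt1 pm.
  have lm : (pdiv m <= m)%N by rewrite pdiv_leq.
  have h0 : (0 < m %/ pdiv m)%N by rewrite divn_gt0 // prime_gt0.
  have h1 : (m %/ pdiv m < m)%N by rewrite ltn_Pdiv.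
  rewrite {1}E PoszM; apply: PM; rewrite ?eqz_nat -?lt0n ?(prime_gt0 pm) //.
    by apply: Pp => //; exact: leq_ltn_trans lm mN.
  by apply: IH => //; exact: ltn_trans h1 mN.
case=> m a0 aN; first by apply: H; lia.
rewrite NegzE -mulN1r; apply: PM => //; apply: H => //; lia.
Qed.

Lemma big_addb_supp1 (N p : nat) (P : pred nat) (F : nat -> bool) : (p < N)%N -> P p ->
  (forall q, P q -> q != p -> F q = false) -> \big[addb/false]_(q <- iota 0 N | P q) F q = F p.
Proof.
move=> pN Pp H; rewrite -big_filter (bigD1_seq p) ?filter_uniq ?iota_uniq //=; last first.
  by rewrite mem_filter Pp mem_iota.
rewrite big_seq_cond big1 ?addbF // => q; rewrite mem_filter => /andP [/andP [Pq _]].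
exact: H.
Qed.

Lemma vo_prime q p : prime q -> prime p -> vo q p%:Z = (q == p).
Proof.
move=> pq pp; rewrite /vo /vv /= logn_prime //.
by case: eqP => //= ->.
Qed.

Lemma prime_ndvdz q p : prime q -> prime p -> q != p -> ~~ (q%:Z %| p%:Z)%Z.
Proof. by move=> pq pp qp; rewrite dvdzE /= dvdn_prime2. Qed.

Lemma lg_prime q p : prime q -> prime p -> q != p -> lg q p%:Z = nr q p%:Z.
Proof. by move=> pq pp qp; rewrite /lg up_unit // prime_ndvdz. Qed.

Lemma vo_N1 q : prime q -> vo q (-1) = false.
Proof. by move=> pq; rewrite /vo /vv logn1. Qed.

Lemma lg_N1 q : prime q -> lg q (-1) = nr q (-1).
Proof. by move=> pq; rewrite /lg up_unit // dvdzE /= dvdn1 neq_ltn prime_gt1 ?orbT. Qed.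

Lemma up2_oddprime p : odd p -> up 2 p%:Z = p%:Z.
Proof. by move=> op; rewrite up_unit //; lia. Qed.

Lemma ltz_nat0 (m : nat) : (m%:Z < 0) = false.
Proof. by []. Qed.

(** For odd p only the places p and 2 contribute, and both give the parity of (p-1)/2; for p = 2
    every term vanishes. *)
Lemma hsum_N1 N p : prime p -> (p < N)%N -> hsum N (-1) p%:Z = false.
Proof.
move=> pp pN; rewrite /hsum /hoo ltz_nat0 andbF addbF.
case: (altP (p =P 2)) => [->|p2].
  rewrite big1 ?addFb // => q /andP [pq oq].
  by rewrite /hs vo_N1 // vo_prime // (negbTE (odd_prime_neq2 oq)).
have op := odd_prime2 pp p2.
rewrite (@big_addb_supp1 N p) ?pp //; last first.
  by move=> q /andP [pq oq] qp; rewrite /hs vo_N1 // vo_prime // (negbTE qp).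
rewrite /hs vo_N1 // vo_prime // eqxx lg_N1 // nrN1 // /h2 vo_N1 // vo_prime // eq_sym (negbTE p2) /=.
rewrite /ep up2_oddprime //=.
by have := q_half op; lia.
Qed.

(** Equal primes reduce to the pair (-1, p); a pair with 2 is the second supplementary law; distinct
    odd primes are quadratic reciprocity. *)
Lemma hsum_prime N p r : prime p -> prime r -> (p < N)%N -> (r < N)%N -> hsum N p%:Z r%:Z = false.
Proof.
move=> pp pr pN rN.
case: (altP (p =P r)) => [<-|pr'].
  have <- : hsum N (-1) p%:Z = hsum N p%:Z p%:Z; last exact: hsum_N1.
  rewrite /hsum; congr (_ (+) _ (+) _).
  - apply: eq_bigr => q /andP [pq oq]; rewrite /hs vo_N1 //.
    by case: (vo q p); case: (lg q p); case: (lg q (-1)).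
  - rewrite /h2; have -> : ep (-1) = true by [].
    have -> : om (-1) = false by [].
    by rewrite andbF addbF vo_N1 //; case: (vo 2 p); case: (ep p); case: (om p).
wlog p2 : p r pp pr pN rN pr' / p != 2.
  move=> W; case: (altP (p =P 2)) => [p2|p2]; last exact: W.
  by rewrite hsumC; apply: W; rewrite // -?p2 eq_sym.
have op := odd_prime2 pp p2.
rewrite /hsum /hoo ltz_nat0 /= addbF.
case: (altP (r =P 2)) => [r2|r2].
  rewrite (@big_addb_supp1 N p) ?pp //; last first.
    move=> q /andP [pq oq] qp; rewrite /hs !vo_prime // (negbTE qp) r2.
    by rewrite (negbTE (odd_prime_neq2 oq)).
  rewrite /hs !vo_prime // eqxx (negbTE pr') /= addbF lg_prime // r2 nr2 //.
  rewrite /h2 !vo_prime // [2 == p]eq_sym (negbTE p2) /=.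
  by rewrite /om /ep up2_oddprime // [up 2 2](_ : _ = 1) //= andbF; lia.
have or := odd_prime2 pr r2.
rewrite -big_filter (bigD1_seq p) ?filter_uniq ?iota_uniq //=; last first.
  by rewrite mem_filter pp op mem_iota.
rewrite -big_filter (bigD1_seq r) ?filter_uniq ?iota_uniq //=; last first.
  by rewrite !mem_filter pr or mem_iota eq_sym pr'.
rewrite big_seq_cond big1 => [|q]; last first.
  rewrite !mem_filter -!andbA => /and5P [qp pq oq _ qr].
  by rewrite /hs !vo_prime // (negbTE qp) (negbTE qr).
rewrite /hs !vo_prime // !eqxx (negbTE pr') [r == p]eq_sym (negbTE pr') /= !addbF.
rewrite !lg_prime // 1?eq_sym // quadratic_reciprocity //.
rewrite /h2 !vo_prime // ![2 == _]eq_sym (negbTE p2) (negbTE r2) /= !addbF /ep !up2_oddprime //.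
by have := q_half op; have := q_half or; lia.
Qed.

Theorem hilbert_product N (a b : int) : a != 0 -> b != 0 -> (`|a| < N)%N -> (`|b| < N)%N ->
  hsum N a b = false.
Proof.
have H1 c : hsum N 1 c = false.
  by have := @hsumM N 1 1 c isT isT; rewrite mul1r; case: hsum.
move=> a0 b0 aN bN; move: a a0 aN; apply: int_prime_ind => //.
- move: b b0 bN; apply: int_prime_ind => //; first by rewrite hsumC.
  + rewrite /hsum big1 // => q /andP [pq _]; by rewrite /hs vo_N1.
  + by move=> r *; exact: hsum_N1.
  + by move=> a b a0 b0; rewrite !(hsumC N (-1)) hsumM // => -> ->.
- move=> r pr rN; move: b b0 bN; apply: int_prime_ind => //; first by rewrite hsumC.
  + by rewrite hsumC; exact: hsum_N1.
  + by move=> s *; exact: hsum_prime.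
  + by move=> a b a0 b0; rewrite !(hsumC N r) hsumM // => -> ->.
- by move=> a a' a0 a'0; rewrite hsumM // => -> ->.
Qed.

(** The conic ac x^2 + bc y^2 = z^2 has the point (1, 1, c). For the explicit symbol: if valuations
    differ, c has the class of the dominant summand; if they agree and the unit parts cancel mod q,
    then b has the class of -a; if they agree without cancellation, ac and bc have even
    valuation. *)
Lemma hs_conic q (a b c : int) : prime q -> odd q -> a != 0 -> b != 0 -> c != 0 -> a + b = c ->
  hs q (a * c) (b * c) = false.
Proof.
have sub q' (x y : int) : prime q' -> odd q' -> x != 0 -> y != 0 -> x + y != 0 -> (vv q' x < vv q' y)%N ->
    hs q' (x * (x + y)) (y * (x + y)) = false.
  move=> pq oq x0 y0 xy0 xy.
  have hd : ((q' ^ (vv q' x).+1)%N%:Z %| y)%Z by rewrite -vv_ge.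
  have [_ _ /(sg_oddE _ _ (odd_prime_neq2 oq)) [Ev El]] := sg_add_odd pq oq x0 hd.
  by rewrite /hs !voM // !lgM // Ev El !addbb /= andbF.
move=> pq oq a0 b0 c0 E; subst c.
case: (ltngtP (vv q a) (vv q b)) => [ab|ab|ab]; first exact: sub.
  by rewrite hsC addrC; apply: sub; rewrite // addrC.
have Ec : a + b = (q ^ vv q a)%N%:Z * (up q a + up q b).
  by rewrite {1}(upE q a) {1}(upE q b) -ab; ring.
case: (boolP (q%:Z %| up q a + up q b)%Z) => [dv|ndv].
  have El : lg q b = lg q a (+) lg q (-1).
    rewrite -lgM // mulrN1 /lg -mulrN1 upM // (up_unit (a := -1)); last first.
      by rewrite dvdzE /= dvdn1 neq_ltn prime_gt1 ?orbT.
    by apply: nr_eqmod => //; rewrite mulrN1 opprK addrC.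
  rewrite /hs !voM // !lgM // El /vo ab.
  by case: (odd _); case: (odd _); case: (lg q a); case: (lg q (-1)); case: (lg q _).
have [Ev _] := vv_up_uniq (vv q a) pq ndv; rewrite -Ec in Ev.
by rewrite /hs !voM // /vo Ev -ab addbb.
Qed.

(** * Hensel's lemma and compactness *)

Lemma modz_inv (q : nat) (b : int) : prime q -> ~~ (q%:Z %| b)%Z -> exists a, (q%:Z %| a * b - 1)%Z.
Proof.
move=> pq nb.
have : coprimez b q%:Z by rewrite /coprimez /gcdz eqz_nat -/(coprime _ _) coprime_sym prime_coprime.
case/coprimezP => -[u v] /= E; exists u.
by rewrite -E opprD addrA addrN add0r -mulNr dvdz_mull.
Qed.

(** Newton's step: x is corrected by (x^2 - u) / (2x), with an inverse of 2x mod q in place of the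
    division. *)
Lemma hensel_odd q (u : int) k : prime q -> odd q -> ~~ (q%:Z %| u)%Z -> nr q u = false ->
  exists x : int, ~~ (q%:Z %| x)%Z /\ ((q ^ k.+1)%N%:Z %| x ^+ 2 - u)%Z.
Proof.
move=> pq oq nu hu; elim: k => [|k [x [nx /dvdzP [s hs]]]].
  by rewrite expn1; apply: nr_sqr_ex; rewrite ?hu.
have n2x : ~~ (q%:Z %| 2 * x)%Z.
  rewrite Euclid_dvdzM // negb_or nx andbT dvdzE /=.
  by apply/negP => /dvdn_leq -/(_ isT); have := q_ge3 pq oq; lia.
have [a /dvdzP [b hb]] := modz_inv pq n2x.
exists (x - (q ^ k.+1)%N%:Z * (s * a)); split.
  rewrite rpredBr // expnS PoszM -mulrA dvdz_mulr //.
have -> : (x - (q ^ k.+1)%N%:Z * (s * a)) ^+ 2 - u =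
   (x ^+ 2 - u) - (q ^ k.+1)%N%:Z * s * (a * (2 * x)) + ((q ^ k.+1)%N%:Z * (s * a)) ^+ 2 by ring.
have -> : a * (2 * x) = b * q%:Z + 1 by rewrite -hb subrK.
apply/dvdzP; exists (- s * b + (q ^ k)%N%:Z * (s * a) ^+ 2).
by rewrite hs !expnS !PoszM; ring.
Qed.

(** One binary digit at a time: adding 2^(k+2) to the odd number x changes x^2 by an odd multiple of
    2^(k+3), which cancels an odd error term. *)
Lemma hensel_two (u : int) k : (u %% 8)%Z = 1 ->
  exists x : int, ~~ (2 %| x)%Z /\ ((2 ^ k.+3)%N%:Z %| x ^+ 2 - u)%Z.
Proof.
move=> hu; elim: k => [|k [x [nx /dvdzP [s hs]]]].
  by exists 1; split=> //; rewrite expr1n; lia.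
case: (boolP (2 %| s)%Z) => [/dvdzP [s' Es]|ns].
  by exists x; split=> //; apply/dvdzP; exists s'; rewrite hs Es [in RHS]expnS PoszM; ring.
exists (x + (2 ^ k.+2)%N%:Z); split; first by rewrite expnS PoszM; lia.
have /dvdzP [r hr] : (2 %| s + x)%Z by lia.
apply/dvdzP; exists (r + (2 ^ k)%N%:Z).
have -> : (x + (2 ^ k.+2)%N%:Z) ^+ 2 - u = (x ^+ 2 - u) + 2 * x * (2 ^ k.+2)%N%:Z + (2 ^ k.+2)%N%:Z ^+ 2 by ring.
have -> : 2 * x = 2 * (r * 2 - s) by rewrite -hr addrC addKr.
by rewrite hs !expnS !PoszM; ring.
Qed.

Lemma sg_sqr_approx q (c : int) K : prime q -> c != 0 -> sg q c = sg q 1 ->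
  exists x : int, ((q ^ K)%N%:Z %| x ^+ 2 - c)%Z.
Proof.
move=> pq c0 hc.
have [x [_ hx]] : exists x, ~~ (q%:Z %| x)%Z /\ ((q ^ K.+3)%N%:Z %| x ^+ 2 - up q c)%Z.
  case: (altP (q =P 2)) => [q2|q2].
    move: hc; rewrite q2 sg1 // /sg /= => -[_ he ho]; apply: hensel_two.
    move: he ho; rewrite /ep /om mod4_mod8.
    by case: (odd_mod8 (up2_odd c0)) => ->.
  apply: hensel_odd; rewrite ?up_ndvd ?odd_prime2 //.
  by move: hc; rewrite sg1 // /sg (negbTE q2) /= => -[].
have ev : ~~ odd (vv q c) by move: hc; rewrite sg1 // /sg => -[]; rewrite /vo => ->.
exists ((q ^ (vv q c)./2)%N%:Z * x).
have -> : ((q ^ (vv q c)./2)%N%:Z * x) ^+ 2 - c = (q ^ (vv q c))%N%:Z * (x ^+ 2 - up q c).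
  have Ev : (vv q c = (vv q c)./2 + (vv q c)./2)%N by rewrite addnn even_halfK.
  have Eq : (q ^ vv q c)%N%:Z = (q ^ (vv q c)./2)%N%:Z ^+ 2 by rewrite {1}Ev expnD PoszM.
  by rewrite [X in _ - X](upE q c) Eq; ring.
rewrite dvdz_mull //; apply: dvdz_trans hx.
by rewrite dvdzE /= dvdn_exp2l // -addn3 leq_addr.
Qed.

Lemma dvdz_powW (q i j : nat) (b : int) : (i <= j)%N -> ((q ^ j)%N%:Z %| b)%Z -> ((q ^ i)%N%:Z %| b)%Z.
Proof. by move=> ij; apply: dvdz_trans; rewrite dvdzE /= dvdn_exp2l. Qed.

Lemma diagq_cong N (c : N.-tuple int) (x y : 'I_N -> int) (m : int) :
  (forall i, (m %| x i - y i)%Z) -> (m %| diagq c x - diagq c y)%Z.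
Proof.
move=> H; rewrite /diagq -sumrB; apply: rpred_sum => i _.
by rewrite -mulrBr subr_sqr; apply: dvdz_mull; apply: dvdz_mulr.
Qed.

Lemma diagqZ N (c : N.-tuple int) (x : 'I_N -> int) (m : int) :
  diagq c (fun i => m * x i) = m ^+ 2 * diagq c x.
Proof. by rewrite /diagq mulr_sumr; apply: eq_bigr => i _; rewrite exprMn mulrCA. Qed.

Section Compactness.
Variables (p N : nat) (cs : seq (N.-tuple int)).
Hypothesis pp : prime p.

Let weak K (x : 'I_N -> int) := (exists i, ~~ (p%:Z %| x i)%Z) /\
  forall c, c \in cs -> ((p ^ K)%N%:Z %| diagq c x)%Z.

(** There are finitely many residue vectors mod p^m. If each of them failed at some precision, a
    solution at the largest of these precisions would have no residue vector left. *)
Let pigeon m (Q : ('I_N -> int) -> Prop) : (forall K, exists2 y, weak K y & Q y) ->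
  exists x : 'I_N -> int, forall K, exists y, [/\ weak K y, Q y & forall i, ((p ^ m)%N%:Z %| y i - x i)%Z].
Proof.
move=> H; apply: contrapT => nE.
have pm0 : (0 < p ^ m)%N by rewrite expn_gt0 prime_gt0.
have F (g : {ffun 'I_N -> 'I_(p ^ m)}) : exists K, forall y, weak K y -> Q y ->
    ~ forall i, ((p ^ m)%N%:Z %| y i - (g i : nat)%:Z)%Z.
  apply: contrapT => nK; apply: nE; exists (fun i => (g i : nat)%:Z) => K.
  apply: contrapT => nY; apply: nK; exists K => y wy Qy Ey.
  by apply: nY; exists y.
have [f hf] := choice F.
have [y [y1 y2] Qy] := H (\max_g f g)%N.
have lt i : (`|(y i %% (p ^ m)%N%:Z)%Z| < p ^ m)%N by lia.
pose g := [ffun i => Ordinal (lt i)].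
apply: (hf g y) => //; last by move=> i; rewrite /g ffunE /= gez0_abs ?modz_ge0 -?eqz_mod_dvd ?modz_mod // eqz_nat -lt0n.
split=> // c cc; apply: dvdz_powW (y2 c cc); exact: leq_bigmax.
Qed.

Lemma Qp_solvable_approx :
  (forall K, exists x : 'I_N -> int, (exists i, ~~ (p%:Z %| x i)%Z) /\
     forall c, c \in cs -> ((p ^ K)%N%:Z %| diagq c x)%Z) -> Qp_solvable p cs.
Proof.
move=> H.
(* The residue of [x] mod p^(k+1) extends to approximate solutions of every precision. The modulus
   is p^(k+1) rather than p^k so that primitivity is already visible at k = 0. *)
pose good k x := forall K, exists y, weak K y /\ forall i, ((p ^ k.+1)%N%:Z %| y i - x i)%Z.
have [x0 g0] : exists x, good 0%N x.
  have [|x hx] := @pigeon 1%N (fun=> True); first by move=> K; have [x hx] := H K; exists x.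
  by exists x => K; have [y [? _ ?]] := hx K; exists y.
have step (kx : nat * ('I_N -> int)) : exists x', good kx.1 kx.2 -> good kx.1.+1 x' /\
    forall i, ((p ^ kx.1.+1)%N%:Z %| x' i - kx.2 i)%Z.
  case: kx => k x /=; case: (pselect (good k x)) => [gk|ng]; last by exists x => /ng.
  have [|x' hx'] := @pigeon k.+2 (fun y => forall i, ((p ^ k.+1)%N%:Z %| y i - x i)%Z).
    by move=> K; have [y [? ?]] := gk K; exists y.
  exists x' => _; split; first by move=> K; have [y [? _ ?]] := hx' K; exists y.
  move=> i; have [y [_ /(_ i) h1 /(_ i) /(dvdz_powW (leqnSn _)) h2]] := hx' 0%N.
  by rewrite -(subrK (y i) (x' i)) -addrA rpredD // -opprB rpredN.
have [nx hnx] := choice step.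
pose s := fix s k := if k is k'.+1 then nx (k', s k') else x0.
have gs k : good k (s k) by elim: k => //= k IH; have [] := hnx (k, s k) IH.
exists s; split=> [k|]; last split.
- have [y [[[i ny] _] hy]] := gs k 0%N; exists i; apply: contra ny => hs.
  have h1 : (p%:Z %| y i - s k i)%Z by have := hy i; rewrite -{2}[p]expn1; apply: dvdz_powW.
  by rewrite -(subrK (s k i) (y i)) rpredD.
- move=> k c cc; have [y [[_ hy] hys]] := gs k k.
  have h1 := diagq_cong c (fun i => dvdz_powW (leqnSn _) (hys i)).
  by have := rpredB (hy c cc) h1; rewrite opprB addrC subrK.
- move=> k i; have [_ /(_ i)] := hnx (k, s k) (gs k).
  by rewrite eqz_mod_dvd; apply: dvdz_powW.
Qed.

(** At most j common factors p can be divided out, and each costs two digits because the forms are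
    quadratic; hence the precision K + 2j. *)
Lemma primitive_solution K j (w : 'I_N -> int) (i0 : 'I_N) :
  ~~ ((p ^ j.+1)%N%:Z %| w i0)%Z ->
  (forall c, c \in cs -> ((p ^ (K + j.*2))%N%:Z %| diagq c w)%Z) ->
  exists x : 'I_N -> int, (exists i, ~~ (p%:Z %| x i)%Z) /\
     forall c, c \in cs -> ((p ^ K)%N%:Z %| diagq c x)%Z.
Proof.
elim: j w => [|j IH] w nw hw.
  by exists w; split=> [|c cc]; [exists i0; rewrite expn1 in nw|have := hw c cc; rewrite addn0].
case: (pselect (exists i, ~~ (p%:Z %| w i)%Z)) => [ex|nex].
  exists w; split=> // c cc; apply: dvdz_powW (hw c cc); exact: leq_addr.
have dw i : exists v, w i = p%:Z * v.
  have /dvdzP [v ->] : (p%:Z %| w i)%Z by apply: contrapT => /negP h; apply: nex; exists i.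
  by exists v; rewrite mulrC.
have [v hv] := choice dw.
have p0 : p%:Z != 0 by rewrite eqz_nat -lt0n prime_gt0.
apply: (IH v).
  apply: contra nw; rewrite hv [(p ^ j.+2)%N]expnS PoszM dvdz_mul2l //.
move=> c cc; have := hw c cc.
rewrite (_ : diagq c w = p%:Z ^+ 2 * diagq c v); last first.
  by rewrite -diagqZ /diagq; apply: eq_bigr => i _; rewrite hv.
by rewrite doubleS !addnS !expnS !PoszM mulrA -expr2 dvdz_mul2l // expf_eq0.
Qed.

End Compactness.

(** * Local solubility through square classes *)

(* [X_i] stands for [d_i u_i^2]: only its square class in Q_q matters, and since
   integers are dense in Z_q the three equations can be solved exactly. *)
Definition LS (q : nat) (E1 E2 E3 d1 d2 d3 : int) : Prop :=
  exists X1 X2 X3 t : int,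
    [/\ X1 != 0, X2 != 0 & X3 != 0] /\
    [/\ X3 = X2 + E1 * t ^+ 2, X1 = X3 + E2 * t ^+ 2 & X2 = X1 + E3 * t ^+ 2] /\
    [/\ sg q X1 = sg q d1, sg q X2 = sg q d2 & sg q X3 = sg q d3].

(** Convertible to [D_eqs] when E_i is [e_i * m]; only the products E_i enter the local theory. *)
Definition forms (E1 E2 E3 d1 d2 d3 : int) : seq (4.-tuple int) :=
  [:: [tuple E1; 0; d2; - d3]; [tuple E2; - d1; 0; d3]; [tuple E3; d1; - d2; 0]].

Lemma LS_cycle q (E1 E2 E3 d1 d2 d3 : int) : LS q E1 E2 E3 d1 d2 d3 -> LS q E2 E3 E1 d2 d3 d1.
Proof.
by move=> [X1 [X2 [X3 [t [[? ? ?] [[? ? ?] [? ? ?]]]]]]]; exists X2, X3, X1, t.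
Qed.

Lemma LS_sg q (E1 E2 E3 d1 d2 d3 d1' d2' d3' : int) :
  sg q d1 = sg q d1' -> sg q d2 = sg q d2' -> sg q d3 = sg q d3' ->
  LS q E1 E2 E3 d1 d2 d3 -> LS q E1 E2 E3 d1' d2' d3'.
Proof.
move=> h1 h2 h3 [X1 [X2 [X3 [t [? [? [? ? ?]]]]]]]; exists X1, X2, X3, t.
by rewrite -h1 -h2 -h3.
Qed.

(* Near the point with [X1 = 0]. *)
Lemma LS_zero1 q (E1 E2 E3 d1 d2 d3 : int) : prime q -> E1 + E2 + E3 = 0 ->
  E2 != 0 -> E3 != 0 -> d1 != 0 ->
  sg q d2 = sg q E3 -> sg q d3 = sg q (- E2) -> LS q E1 E2 E3 d1 d2 d3.
Proof.
move=> pq sE E20 E30 d10 s2 s3.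
(* [LS] asks for nonzero X_i, so X1 = 0 is moved to d1 q^(2B), which has the class of d1 and is too
   small to affect the classes of E3 and -E2. *)
pose B := (vv q E2 + vv q E3 + 3)%N.
have q0 : (q ^ B)%N%:Z != 0 by rewrite eqz_nat -lt0n expn_gt0 prime_gt0.
have hd : ((q ^ B)%N%:Z %| d1 * (q ^ B)%N%:Z ^+ 2)%Z by rewrite expr2 mulrA dvdz_mull.
have nE2 : - E2 != 0 by rewrite oppr_eq0.
have [a2 _ b2] := sg_add pq E30 (dvdz_powW (i := vv q E3 + 3) (leq_trans (leq_addl (vv q E2) _) (eq_leq (addnA _ _ _))) hd).
have [a3 _ b3] : [/\ - E2 + d1 * (q ^ B)%N%:Z ^+ 2 != 0,
    vv q (- E2 + d1 * (q ^ B)%N%:Z ^+ 2) = vv q (- E2) & sg q (- E2 + d1 * (q ^ B)%N%:Z ^+ 2) = sg q (- E2)].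
  apply: sg_add => //; apply: dvdz_powW hd; rewrite /vv abszN /B leq_add2r; exact: leq_addr.
have eE1 : E1 = - E2 - E3 by rewrite -[RHS]addr0 -sE; ring.
exists (d1 * (q ^ B)%N%:Z ^+ 2), (E3 + d1 * (q ^ B)%N%:Z ^+ 2), (- E2 + d1 * (q ^ B)%N%:Z ^+ 2), 1.
split; first by split=> //; rewrite mulf_neq0 // expf_neq0.
split; first by rewrite eE1; split; ring.
by rewrite b2 b3 s2 s3 sgMsqr.
Qed.

Lemma ord4P (i : 'I_4) : [\/ i = @Ordinal 4 0 isT, i = @Ordinal 4 1 isT, i = @Ordinal 4 2 isT | i = @Ordinal 4 3 isT].
Proof.
by case: i => [[|[|[|[|i]]]] Hi] //; [constructor 1|constructor 2|constructor 3|constructor 4]; apply: val_inj.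
Qed.

Lemma diagq4 (R : comNzRingType) (a b c d : int) (x : 'I_4 -> R) :
  diagq [tuple a; b; c; d] x = a%:~R * x (@Ordinal 4 0 isT) ^+ 2 + b%:~R * x (@Ordinal 4 1 isT) ^+ 2
    + c%:~R * x (@Ordinal 4 2 isT) ^+ 2 + d%:~R * x (@Ordinal 4 3 isT) ^+ 2.
Proof.
rewrite /diagq !big_ord_recl big_ord0 !(tnth_nth 0) /= addr0 !addrA.
by congr (_ + _ + _ + _); congr (_ * x _ ^+ 2); apply: val_inj.
Qed.

Lemma forms_int (E1 E2 E3 d1 d2 d3 : int) (x : 'I_4 -> int) (m : int) (t := x (@Ordinal 4 0 isT))
    (u1 := x (@Ordinal 4 1 isT)) (u2 := x (@Ordinal 4 2 isT)) (u3 := x (@Ordinal 4 3 isT)) :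
  (forall c, c \in forms E1 E2 E3 d1 d2 d3 -> (m %| diagq c x)%Z) <->
  [/\ (m %| E1 * t ^+ 2 + d2 * u2 ^+ 2 - d3 * u3 ^+ 2)%Z,
      (m %| E2 * t ^+ 2 + d3 * u3 ^+ 2 - d1 * u1 ^+ 2)%Z &
      (m %| E3 * t ^+ 2 + d1 * u1 ^+ 2 - d2 * u2 ^+ 2)%Z].
Proof.
have F1 : diagq [tuple E1; 0; d2; - d3] x = E1 * t ^+ 2 + d2 * u2 ^+ 2 - d3 * u3 ^+ 2.
  by rewrite diagq4 !intz; rewrite /t /u1 /u2 /u3; ring.
have F2 : diagq [tuple E2; - d1; 0; d3] x = E2 * t ^+ 2 + d3 * u3 ^+ 2 - d1 * u1 ^+ 2.
  by rewrite diagq4 !intz; rewrite /t /u1 /u2 /u3; ring.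
have F3 : diagq [tuple E3; d1; - d2; 0] x = E3 * t ^+ 2 + d1 * u1 ^+ 2 - d2 * u2 ^+ 2.
  by rewrite diagq4 !intz; rewrite /t /u1 /u2 /u3; ring.
split=> [H|[h1 h2 h3] c].
  by rewrite -F1 -F2 -F3; split; apply: H; rewrite /forms !inE eqxx ?orbT.
by rewrite /forms !inE => /or3P [] /eqP ->; rewrite ?F1 ?F2 ?F3.
Qed.

Lemma LS_Qp_solvable q (E1 E2 E3 d1 d2 d3 : int) : prime q -> d1 != 0 -> d2 != 0 -> d3 != 0 ->
  LS q E1 E2 E3 d1 d2 d3 -> Qp_solvable q (forms E1 E2 E3 d1 d2 d3).
Proof.
move=> pq d10 d20 d30 [X1 [X2 [X3 [t [[x1 x2 x3] [[e1 e2 e3] [s1 s2 s3]]]]]]].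
apply: Qp_solvable_approx => // K.
(* [D] is, to precision q^L, the square of the coordinate c1 d2 d3 below; its valuation [j] bounds
   how often q divides that coordinate, hence the loss in making the vector primitive. *)
pose D := d1 * X1 * (d2 * d3) ^+ 2.
have D0 : D != 0 by rewrite !mulf_neq0 // expf_neq0 // mulf_neq0.
pose j := vv q D; pose L := (K + j.*2 + j.+1)%N.
have sq (d X : int) : d != 0 -> X != 0 -> sg q X = sg q d ->
    exists c : int, ((q ^ L)%N%:Z %| c ^+ 2 - d * X)%Z.
  by move=> ? ? sX; apply: sg_sqr_approx; rewrite ?mulf_neq0 // sgM // sX xor3ss sg1.
have [c1 h1] := sq _ _ d10 x1 s1; have [c2 h2] := sq _ _ d20 x2 s2; have [c3 h3] := sq _ _ d30 x3 s3.
(* The values u_i = c_i / d_i, with c_i^2 close to d_i X_i, cleared of denominators by d1 d2 d3. *)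
pose w (i : 'I_4) := tnth [tuple t * (d1 * d2 * d3); c1 * (d2 * d3); c2 * (d1 * d3); c3 * (d1 * d2)] i.
apply: (@primitive_solution q 4 _ pq K j w (@Ordinal 4 1 isT)).
  rewrite /w (tnth_nth 0) /=; apply/negP => h.
  have h4 : ((q ^ j.+1)%N%:Z %| (c1 * (d2 * d3)) ^+ 2)%Z by rewrite expr2 dvdz_mulr.
  have h5 : ((q ^ j.+1)%N%:Z %| (c1 ^+ 2 - d1 * X1) * (d2 * d3) ^+ 2)%Z.
    by apply: dvdz_mulr; apply: dvdz_powW h1; exact: leq_addl.
  have := rpredB h4 h5; rewrite (_ : _ - _ = D); last by rewrite /D; ring.
  by rewrite -vv_ge // ltnn.
have LE (b : int) : ((q ^ L)%N%:Z %| b)%Z -> ((q ^ (K + j.*2))%N%:Z %| b)%Z.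
  by apply: dvdz_powW; exact: leq_addr.
have {h1}/dvdzP [a1 h1] := LE _ h1; have {h2}/dvdzP [a2 h2] := LE _ h2; have {h3}/dvdzP [a3 h3] := LE _ h3.
have {}h1 : c1 ^+ 2 = a1 * (q ^ (K + j.*2))%N%:Z + d1 * X1 by rewrite -h1 subrK.
have {}h2 : c2 ^+ 2 = a2 * (q ^ (K + j.*2))%N%:Z + d2 * X2 by rewrite -h2 subrK.
have {}h3 : c3 ^+ 2 = a3 * (q ^ (K + j.*2))%N%:Z + d3 * X3 by rewrite -h3 subrK.
move: (q ^ (K + j.*2))%N%:Z h1 h2 h3 => Q h1 h2 h3.
apply/forms_int; rewrite /w !(tnth_nth 0) /= !exprMn h1 h2 h3; split; apply/dvdzP.
- exists (d2 * (d1 * d3) ^+ 2 * a2 - d3 * (d1 * d2) ^+ 2 * a3); rewrite e1; ring.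
- exists (d3 * (d1 * d2) ^+ 2 * a3 - d1 * (d2 * d3) ^+ 2 * a1); rewrite e2; ring.
- exists (d1 * (d2 * d3) ^+ 2 * a1 - d2 * (d1 * d3) ^+ 2 * a2); rewrite e3; ring.
Qed.

Lemma vv_lt_dvd q k (a : int) : prime q -> ~~ ((q ^ k)%N%:Z %| a)%Z -> a != 0 /\ (vv q a < k)%N.
Proof.
move=> pq h; have a0 : a != 0 by apply: contraNneq h => ->; rewrite dvdz0.
by split=> //; rewrite ltnNge vv_ge.
Qed.

(* If [d1 u1^2] is q-adically tiny in a primitive approximate solution, then [t] is not,
   and the solution is close to the point with [X1 = 0]. *)
Lemma LS_of_tiny1 q (E1 E2 E3 d1 d2 d3 t u1 u2 u3 : int) M : prime q -> E1 + E2 + E3 = 0 ->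
  E2 != 0 -> E3 != 0 -> d1 != 0 -> d2 != 0 -> d3 != 0 ->
  [/\ (vv q E2 <= M)%N, (vv q E3 <= M)%N, (vv q d1 <= M)%N, (vv q d2 <= M)%N & (vv q d3 <= M)%N] ->
  ~ [/\ (q%:Z %| t)%Z, (q%:Z %| u1)%Z, (q%:Z %| u2)%Z & (q%:Z %| u3)%Z] ->
  ((q ^ (M * 4 + 6))%N%:Z %| d1 * u1 ^+ 2)%Z ->
  ((q ^ (M * 4 + 6))%N%:Z %| E2 * t ^+ 2 + d3 * u3 ^+ 2 - d1 * u1 ^+ 2)%Z ->
  ((q ^ (M * 4 + 6))%N%:Z %| E3 * t ^+ 2 + d1 * u1 ^+ 2 - d2 * u2 ^+ 2)%Z ->
  LS q E1 E2 E3 d1 d2 d3.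
Proof.
move=> pq sE E20 E30 d10 d20 d30 [m2 m3 k1 k2 k3] prim h1 h2 h3.
have qdvd (d u : int) : d != 0 -> (vv q d <= M)%N -> ((q ^ M.+1)%N%:Z %| d * u ^+ 2)%Z -> (q%:Z %| u)%Z.
  move=> d0 kd; apply: contraLR => nu; have u0 : u != 0 by apply: contraNneq nu => ->; rewrite dvdz0.
  by rewrite -vv_ge ?mulf_neq0 ?expf_neq0 // expr2 !vvM ?mulf_neq0 // (vv_unit nu) !addn0 -leqNgt.
have leM : (M.+1 <= M * 4 + 6)%N by clear; lia.
(* If q^(M+1) divided t, it would divide every d_i u_i^2; as each d_i has valuation at most M, q
   would then divide all coordinates. *)
have [t0 vt] : t != 0 /\ (vv q t < M.+1)%N.
  apply: vv_lt_dvd => //; apply/negP => ht; apply: prim.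
  have ht2 E : ((q ^ M.+1)%N%:Z %| E * t ^+ 2)%Z by rewrite dvdz_mull // expr2 dvdz_mulr.
  have h1' := dvdz_powW leM h1; split.
  - by apply: dvdz_trans ht; rewrite expnS PoszM dvdz_mulr.
  - exact: qdvd h1'.
  - apply: (qdvd d2) => //.
    by have := rpredB (rpredD (ht2 E3) h1') (dvdz_powW leM h3); rewrite opprB addrC subrK.
  - apply: (qdvd d3) => //.
    have := rpredB (rpredD (dvdz_powW leM h2) h1') (ht2 E2).
    by rewrite subrK addrC addKr.
(* The valuation of E t^2 is at most 3M, which leaves the margin of 3 that [sg_add] asks for. *)
have vE E : E != 0 -> (vv q E <= M)%N -> (vv q (E * t ^+ 2) + 3 <= M * 4 + 6)%N.
  by move=> E0 kE; rewrite expr2 !vvM ?mulf_neq0 //; clear -kE vt; lia.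
have Et0 E : E != 0 -> E * t ^+ 2 != 0 by move=> ?; rewrite mulf_neq0 ?expf_neq0.
have [a2 _ b2] := sg_add pq (Et0 _ E30) (dvdz_powW (vE _ E30 m3) (rpredB h1 h3)).
have nE2 : - E2 != 0 by rewrite oppr_eq0.
have vn : (vv q (- E2) <= M)%N by rewrite /vv abszN.
have [a3 _ b3] := sg_add pq (Et0 _ nE2) (dvdz_powW (vE _ nE2 vn) (rpredD h1 h2)).
apply: LS_zero1 => //.
  rewrite -(sgMsqr pq E30 t0) -b2.
  have E : E3 * t ^+ 2 + (d1 * u1 ^+ 2 - (E3 * t ^+ 2 + d1 * u1 ^+ 2 - d2 * u2 ^+ 2)) = d2 * u2 ^+ 2 by ring.
  rewrite E sgMsqr //; apply: contraNneq a2 => u20; by rewrite E u20 expr0n mulr0.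
rewrite -(sgMsqr pq nE2 t0) -b3.
have E : - E2 * t ^+ 2 + (d1 * u1 ^+ 2 + (E2 * t ^+ 2 + d3 * u3 ^+ 2 - d1 * u1 ^+ 2)) = d3 * u3 ^+ 2 by ring.
rewrite E sgMsqr //; apply: contraNneq a3 => u30; by rewrite E u30 expr0n mulr0.
Qed.

(** If some d_i u_i^2 is divisible by q^(4M+6), [LS_of_tiny1] applies after a cyclic shift.
    Otherwise d1 u1^2, d1 u1^2 + E3 t^2 and d1 u1^2 - E2 t^2 solve the equations exactly, and
    precision 4M+9 is 3 digits beyond the valuations, so the classes of d2 u2^2 and d3 u3^2 are
    kept. *)
Lemma Qp_solvable_LS q (E1 E2 E3 d1 d2 d3 : int) : prime q -> E1 + E2 + E3 = 0 ->
  E1 != 0 -> E2 != 0 -> E3 != 0 -> d1 != 0 -> d2 != 0 -> d3 != 0 ->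
  Qp_solvable q (forms E1 E2 E3 d1 d2 d3) -> LS q E1 E2 E3 d1 d2 d3.
Proof.
move=> pq sE E10 E20 E30 d10 d20 d30 [x [prim [eqs _]]].
pose M := (vv q E1 + vv q E2 + vv q E3 + vv q d1 + vv q d2 + vv q d3)%N.
have [M1 M2 M3] : [/\ (vv q E1 <= M)%N, (vv q E2 <= M)%N & (vv q E3 <= M)%N] by rewrite /M; clear; split; lia.
have [M4 M5 M6] : [/\ (vv q d1 <= M)%N, (vv q d2 <= M)%N & (vv q d3 <= M)%N] by rewrite /M; clear; split; lia.
move: M M1 M2 M3 M4 M5 M6 => M M1 M2 M3 M4 M5 M6.
pose K := (M * 4 + 9)%N.
have {eqs}/forms_int := eqs K; have {prim} := prim K; move: (x K) => {}x prim.
set t := x _; set u2 := x _; set u3 := x _; set u1 := x _ => -[h1 h2 h3].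
have {}prim : ~ [/\ (q%:Z %| t)%Z, (q%:Z %| u1)%Z, (q%:Z %| u2)%Z & (q%:Z %| u3)%Z].
  by move=> [? ? ? ?]; have [i] := prim; case: (ord4P i) => ->; apply/negP; rewrite negbK.
have K6 (b : int) : ((q ^ K)%N%:Z %| b)%Z -> ((q ^ (M * 4 + 6))%N%:Z %| b)%Z.
  by apply: dvdz_powW; rewrite /K leq_add2l.
have [g1 g2 g3] := And3 (K6 _ h1) (K6 _ h2) (K6 _ h3).
case: (boolP ((q ^ (M * 4 + 6))%N%:Z %| d1 * u1 ^+ 2)%Z) => [hi|lo1].
  by apply: (LS_of_tiny1 (M := M) pq sE _ _ _ _ _ _ prim) => //; split.
case: (boolP ((q ^ (M * 4 + 6))%N%:Z %| d2 * u2 ^+ 2)%Z) => [hi|lo2].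
  do 2 apply: LS_cycle; apply: (@LS_of_tiny1 q E2 E3 E1 d2 d3 d1 t u2 u3 u1 M) => //.
  - by rewrite -sE; ring.
  - by case=> *; apply: prim.
case: (boolP ((q ^ (M * 4 + 6))%N%:Z %| d3 * u3 ^+ 2)%Z) => [hi|lo3].
  apply: LS_cycle; apply: (@LS_of_tiny1 q E3 E1 E2 d3 d1 d2 t u3 u1 u2 M) => //.
  - by rewrite -sE; ring.
  - by case=> *; apply: prim.
have [z1 _] := vv_lt_dvd pq lo1; have [z2 v2] := vv_lt_dvd pq lo2; have [z3 v3] := vv_lt_dvd pq lo3.
have un0 d u : d * u ^+ 2 != 0 -> u != 0 by apply: contraNneq => ->; rewrite expr0n mulr0.
have vK k : (k < M * 4 + 6)%N -> (k + 3 <= K)%N by rewrite /K; clear; lia.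
have [a2 _ b2] := sg_add pq z2 (dvdz_powW (vK _ v2) h3).
have nh2 := rpredNr h2.
have [a3 _ b3] := sg_add pq z3 (dvdz_powW (vK _ v3) nh2).
have eE1 : E1 = - E2 - E3 by rewrite -[RHS]addr0 -sE; ring.
have F2 : d2 * u2 ^+ 2 + (E3 * t ^+ 2 + d1 * u1 ^+ 2 - d2 * u2 ^+ 2) = d1 * u1 ^+ 2 + E3 * t ^+ 2 by ring.
have F3 : d3 * u3 ^+ 2 - (E2 * t ^+ 2 + d3 * u3 ^+ 2 - d1 * u1 ^+ 2) = d1 * u1 ^+ 2 - E2 * t ^+ 2 by ring.
rewrite F2 in a2 b2; rewrite F3 in a3 b3.
exists (d1 * u1 ^+ 2), (d1 * u1 ^+ 2 + E3 * t ^+ 2), (d1 * u1 ^+ 2 - E2 * t ^+ 2), t.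
split=> //; split; first by rewrite eE1; split; ring.
have [y1 y2 y3] := And3 (un0 _ _ _ z1) (un0 _ _ _ z2) (un0 _ _ _ z3).
by rewrite b2 b3 !sgMsqr.
Qed.

Lemma LS_zero2 q (E1 E2 E3 d1 d2 d3 : int) : prime q -> E1 + E2 + E3 = 0 ->
  E1 != 0 -> E3 != 0 -> d2 != 0 ->
  sg q d3 = sg q E1 -> sg q d1 = sg q (- E3) -> LS q E1 E2 E3 d1 d2 d3.
Proof.
move=> pq sE *; do 2 apply: LS_cycle; apply: LS_zero1 => //.
by rewrite -sE; ring.
Qed.

Lemma LS_zero3 q (E1 E2 E3 d1 d2 d3 : int) : prime q -> E1 + E2 + E3 = 0 ->
  E1 != 0 -> E2 != 0 -> d3 != 0 ->
  sg q d1 = sg q E2 -> sg q d2 = sg q (- E1) -> LS q E1 E2 E3 d1 d2 d3.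
Proof.
move=> pq sE *; apply: LS_cycle; apply: LS_zero1 => //.
by rewrite -sE; ring.
Qed.

Lemma LS_const q (E1 E2 E3 d1 d2 d3 : int) : d1 != 0 -> sg q d1 = sg q d2 -> sg q d1 = sg q d3 ->
  LS q E1 E2 E3 d1 d2 d3.
Proof.
move=> d10 h2 h3; exists d1, d1, d1, 0; split=> //; split; last by [].
by rewrite !expr0n !mulr0 !addr0.
Qed.

(** * Translation by 2-torsion and the local images at odd primes *)

Lemma xor3_rot a b c : a = xor3 b c -> b = xor3 c a.
Proof. by move=> ->; rewrite (xor3C b) xor3A xor3ss xor3C xor3f. Qed.

Lemma xor3_const a b c : a = xor3 b c -> a = b -> a = c -> a = (false, false, false).
Proof. by move=> h hb hc; rewrite h -hb -hc xor3ss. Qed.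

Lemma LS_prod q (E1 E2 E3 d1 d2 d3 : int) : LS q E1 E2 E3 d1 d2 d3 ->
  sg q d1 = xor3 (sg q d2) (sg q d3) ->
  exists X1 X2 X3 t : int,
    [/\ [/\ X1 != 0, X2 != 0 & X3 != 0],
     [/\ X3 = X2 + E1 * t ^+ 2, X1 = X3 + E2 * t ^+ 2 & X2 = X1 + E3 * t ^+ 2],
     [/\ sg q X1 = sg q d1, sg q X2 = sg q d2 & sg q X3 = sg q d3] &
     sg q X1 = xor3 (sg q X2) (sg q X3)].
Proof.
move=> [X1 [X2 [X3 [t [? [? [s1 s2 s3]]]]]]] h; exists X1, X2, X3, t; split=> //.
by rewrite s1 s2 s3.
Qed.

(** With x = X1 / t^2, the other two quantities are x + E3 and x - E2, and translation by the
    2-torsion point x = 0 is x -> -E2 E3 / x. Clearing denominators by X1^2 gives the witness, with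
    X1 as the new t. If t = 0, all classes are trivial and the image is the point with X1 = 0. *)
Lemma LS_translate1 q (E1 E2 E3 d1 d2 d3 : int) : prime q -> E1 + E2 + E3 = 0 ->
  E1 != 0 -> E2 != 0 -> E3 != 0 -> d1 != 0 -> d2 != 0 -> d3 != 0 ->
  sg q d1 = xor3 (sg q d2) (sg q d3) ->
  LS q E1 E2 E3 d1 d2 d3 -> LS q E1 E2 E3 (- E2 * E3 * d1) (E3 * d2) (- E2 * d3).
Proof.
move=> pq sE E10 E20 E30 d10 d20 d30 hp hL.
have nE2 : - E2 != 0 by rewrite oppr_eq0.
have [X1 [X2 [X3 [t [[x1 x2 x3] [e1 e2 e3] [s1 s2 s3] hX]]]]] := LS_prod hL hp.
case: (eqVneq t 0) => [t0|t0].
  move: e1 e2; rewrite t0 expr0n !mulr0 !addr0 => e1 e2.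
  have z := xor3_const hX (congr1 _ (etrans e2 e1)) (congr1 _ e2).
  apply: LS_zero1; rewrite ?mulf_neq0 //.
    by rewrite sgM // -s2 -e1 -e2 z xor3f.
  by rewrite sgM // -s3 -e2 z xor3f.
have eE1 : E1 = - E2 - E3 by rewrite -[RHS]addr0 -sE; ring.
exists (- E2 * E3 * X1 * t ^+ 2), (E3 * (X3 * X1)), (- E2 * (X2 * X1)), X1.
split; first by rewrite !mulf_neq0 // expf_neq0.
have f2 : X3 = X1 - E2 * t ^+ 2 by rewrite e2; ring.
split; first by split; rewrite ?e3 ?f2 ?eE1; ring.
have hX2 := xor3_rot hX; have hX3 := xor3_rot hX2.
split.
- by rewrite sgMsqr ?mulf_neq0 // sgM ?mulf_neq0 // s1 -sgM ?mulf_neq0.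
- by rewrite sgM ?mulf_neq0 // (sgM pq x3 x1) -hX2 s2 -sgM.
- by rewrite sgM ?mulf_neq0 // (sgM pq x2 x1) (xor3C (sg q X2)) -hX3 s3 -sgM.
Qed.

(** All three E_i t^2 have the same valuation [tau]. An X_i of valuation below [tau] (or t = 0)
    forces one common class, one above [tau] is q-adically near X_i = 0, and otherwise every X_i has
    valuation [tau]. *)
Lemma LS_trichotomy q r (E1 E2 E3 d1 d2 d3 : int) : prime q -> odd q -> E1 + E2 + E3 = 0 ->
  E1 != 0 -> E2 != 0 -> E3 != 0 -> vv q E1 = r -> vv q E2 = r -> vv q E3 = r ->
  LS q E1 E2 E3 d1 d2 d3 ->
  [\/ sg q d1 = sg q d2 /\ sg q d1 = sg q d3,
      sg q d2 = sg q E3 /\ sg q d3 = sg q (- E2),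
      sg q d3 = sg q E1 /\ sg q d1 = sg q (- E3) |
      sg q d1 = sg q E2 /\ sg q d2 = sg q (- E1)] \/
  [/\ vo q d1 = odd r, vo q d2 = odd r & vo q d3 = odd r].
Proof.
move=> pq oq sE E10 E20 E30 r1 r2 r3 [X1 [X2 [X3 [t [[x1 x2 x3] [[e1 e2 e3] [s1 s2 s3]]]]]]].
rewrite -s1 -s2 -s3.
have -> : [/\ vo q d1 = odd r, vo q d2 = odd r & vo q d3 = odd r] <->
          [/\ vo q X1 = odd r, vo q X2 = odd r & vo q X3 = odd r].
  by case: s1 => -> _ _; case: s2 => -> _ _; case: s3 => -> _ _.
case: (eqVneq t 0) => [t0|t0].
  left; constructor 1; move: e1 e2; rewrite t0 expr0n !mulr0 !addr0 => e1 e2.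
  by rewrite e2 e1.
pose tau := (r + (vv q t).*2)%N.
have vE (E : int) : E != 0 -> vv q E = r -> vv q (E * t ^+ 2) = tau.
  by move=> E0 hE; rewrite expr2 !vvM ?mulf_neq0 // hE addnn.
have Et0 (E : int) : E != 0 -> E * t ^+ 2 != 0 by move=> ?; rewrite mulf_neq0 ?expf_neq0.
have N0 (E : int) : E != 0 -> - E != 0 by rewrite oppr_eq0.
have vN (E : int) : vv q (- E) = vv q E by rewrite /vv abszN.
have lt (E X Y : int) : Y = X + E * t ^+ 2 -> E != 0 -> vv q E = r -> X != 0 -> (vv q X < tau)%N ->
    sg q Y = sg q X.
  move=> -> E0 hE X0 hX; have [//|_ _ //] := @sg_add_odd q X (E * t ^+ 2) pq oq X0 _.
  by rewrite -vv_ge ?Et0 // vE.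
have gt (E X Y : int) : Y = X + E * t ^+ 2 -> E != 0 -> vv q E = r -> X != 0 -> (tau < vv q X)%N ->
    sg q Y = sg q E.
  move=> -> E0 hE X0 hX; rewrite addrC -(sgMsqr pq E0 t0).
  have [|_ _ //] := @sg_add_odd q (E * t ^+ 2) X pq oq (Et0 _ E0) _.
  by rewrite vE // -vv_ge.
have f1 : X2 = X3 + - E1 * t ^+ 2 by rewrite e1; ring.
have f2 : X3 = X1 + - E2 * t ^+ 2 by rewrite e2; ring.
have f3 : X1 = X2 + - E3 * t ^+ 2 by rewrite e3; ring.
case: (ltngtP (vv q X1) tau) => [l1|g1|q1].
- by left; constructor 1; rewrite (lt _ _ _ e3) ?(lt _ _ _ f2) ?N0 ?vN.
- by left; constructor 2; rewrite (gt _ _ _ e3) ?(gt _ _ _ f2) ?N0 ?vN.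
case: (ltngtP (vv q X2) tau) => [l2|g2|q2].
- by left; constructor 1; rewrite (lt _ _ _ f3) ?(lt _ _ _ e1) ?N0 ?vN.
- by left; constructor 3; rewrite (gt _ _ _ e1) ?(gt _ _ _ f3) ?N0 ?vN.
case: (ltngtP (vv q X3) tau) => [l3|g3|q3].
- by left; constructor 1; rewrite (lt _ _ _ e2) ?(lt _ _ _ f1) ?N0 ?vN.
- by left; constructor 4; rewrite (gt _ _ _ e2) ?(gt _ _ _ f1) ?N0 ?vN.
by right; rewrite /vo q1 q2 q3 /tau oddD odd_double addbF.
Qed.

Lemma LS_ramified q (E1 E2 E3 d1 d2 d3 : int) : prime q -> odd q -> E1 + E2 + E3 = 0 ->
  E1 != 0 -> E2 != 0 -> E3 != 0 -> vv q E1 = 1%N -> vv q E2 = 1%N -> vv q E3 = 1%N ->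
  d1 != 0 -> d2 != 0 -> d3 != 0 -> sg q d1 = xor3 (sg q d2) (sg q d3) ->
  LS q E1 E2 E3 d1 d2 d3 <->
  [\/ sg q d2 = sg q 1 /\ sg q d3 = sg q 1,
      sg q d2 = sg q E3 /\ sg q d3 = sg q (- E2),
      sg q d2 = sg q (- E1 * E3) /\ sg q d3 = sg q E1 |
      sg q d2 = sg q (- E1) /\ sg q d3 = sg q (- E1 * E2)].
Proof.
move=> pq oq sE E10 E20 E30 v1 v2 v3 d10 d20 d30 hp.
have nE1 : - E1 != 0 by rewrite oppr_eq0.
have nE3 : - E3 != 0 by rewrite oppr_eq0.
have sM : sg q (- E1 * E3) = xor3 (sg q E1) (sg q (- E3)) by rewrite mulNr -mulrN sgM.
split.
  case/(LS_trichotomy pq oq sE E10 E20 E30 v1 v2 v3) => [[[h2 h3]|[h2 h3]|[h3 h1]|[h1 h2]]|[h1 h2 h3]].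
  - have z := xor3_const hp h2 h3; constructor 1; by rewrite sg1 // -h2 -h3.
  - by constructor 2.
  - by constructor 3; rewrite sM -h3 -h1 (xor3_rot hp).
  - constructor 4; rewrite sgM // -h2 -h1 xor3C; split=> //; exact: xor3_rot (xor3_rot hp).
  (* Three odd valuations cannot have an even sum, while the product of the classes is trivial. *)
  - by move: hp => [] hp _ _; rewrite h1 h2 h3 in hp.
case=> [[h2 h3]|[h2 h3]|[h2 h3]|[h2 h3]].
- have z : sg q d1 = sg q 1 by rewrite hp h2 h3 xor3ss sg1.
  by apply: LS_const; rewrite // z.
- exact: LS_zero1.
- by apply: LS_zero2; rewrite // hp h2 h3 sM xor3C xor3A xor3ss xor3C xor3f.
- by apply: LS_zero3; rewrite // hp h2 h3 sgM // xor3A xor3ss xor3C xor3f.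
Qed.

Lemma LS_unramified q (E1 E2 E3 d1 d2 d3 : int) : prime q -> odd q -> E1 + E2 + E3 = 0 ->
  E1 != 0 -> E2 != 0 -> E3 != 0 -> vv q E1 = 0%N -> vv q E2 = 0%N -> vv q E3 = 0%N ->
  sg q d1 = xor3 (sg q d2) (sg q d3) ->
  LS q E1 E2 E3 d1 d2 d3 -> vo q d2 = false /\ vo q d3 = false.
Proof.
move=> pq oq sE E10 E20 E30 v1 v2 v3 hp.
have voN (E : int) : vo q (- E) = vo q E by rewrite /vo /vv abszN.
have V (E : int) : vv q E = 0%N -> vo q E = false by rewrite /vo => ->.
case/(LS_trichotomy pq oq sE E10 E20 E30 v1 v2 v3) => [[[h2 h3]|[h2 h3]|[h3 h1]|[h1 h2]]|[h1 h2 h3] //].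
- have z := xor3_const hp h2 h3.
  by have [z2 _ _] := etrans (esym h2) z; have [z3 _ _] := etrans (esym h3) z.
- by case: h2 => -> _ _; case: h3 => -> _ _; rewrite voN !V.
- by have h2 := xor3_rot hp; rewrite h3 h1 in h2; case: h2 => -> _ _; case: h3 => -> _ _; rewrite voN !V.
- by have h3 := xor3_rot (xor3_rot hp); rewrite h1 h2 in h3; case: h3 => -> _ _; case: h2 => -> _ _; rewrite voN !V.
Qed.

(** * Solubility at primes of good reduction *)

Section CharacterSums.
Variable q : nat.
Hypotheses (pq : prime q) (oq : odd q).
Implicit Types x y a b : 'F_q.

Definition qchi (x : 'F_q) : int := if x == 0 then 0 else if x ^+ q./2 == 1 then 1 else -1.

Lemma qchiM x y : qchi (x * y) = qchi x * qchi y.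
Proof.
rewrite /qchi mulf_eq0; case: (eqVneq x 0) => [_|x0] /=; first by rewrite mul0r.
case: (eqVneq y 0) => [_|y0] /=; first by rewrite mulr0.
have mn := Fq_m1_neq1 pq oq.
rewrite exprMn; case/orP: (euler_pm1 pq oq x0) => /eqP ->;
  case/orP: (euler_pm1 pq oq y0) => /eqP ->;
  by rewrite ?mul1r ?mulr1 ?mulrNN ?mulr1 ?eqxx ?(negbTE mn).
Qed.

Lemma qchi1 : qchi 1 = 1.
Proof. by rewrite /qchi oner_eq0 expr1n eqxx. Qed.

Lemma qchi_sqr x : x != 0 -> qchi x * qchi x = 1.
Proof. by rewrite /qchi => /negbTE ->; case: ifP. Qed.

Lemma qchi_ge x : -1 <= qchi x <= 1.
Proof. by rewrite /qchi; case: ifP => // _; case: ifP. Qed.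

Lemma qchi_nonresidue : exists x, qchi x = -1.
Proof.
apply: contrapT => H.
have sq x : exists y, y ^+ 2 = x.
  case: (eqVneq x 0) => [->|x0]; first by exists 0; rewrite expr0n.
  case: (eqVneq (x ^+ q./2) 1) => [h|h]; first by have [y ->] := euler_criterion pq oq x0 h; exists y.
  by case: H; exists x; rewrite /qchi (negbTE x0) (negbTE h).
have [g hg] := choice sq.
have gi : injective g by move=> x y h; rewrite -(hg x) -(hg y) h.
have [f _ fK] := injF_bij gi.
have E : f 1 = f (-1) by rewrite -(hg (f 1)) -(hg (f (-1))) !fK sqrrN.
by have := Fq_m1_neq1 pq oq; rewrite -(can_eq fK) E eqxx.
Qed.

Lemma sum_qchi : \sum_(x : 'F_q) qchi x = 0.
Proof.
have [g hg] := qchi_nonresidue.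
have g0 : g != 0 by apply: contra_eq_neq hg => ->; rewrite /qchi eqxx.
have : \sum_(x : 'F_q) qchi x = - \sum_(x : 'F_q) qchi x; last by lia.
rewrite {1}(reindex_inj (mulfI g0)) /= -sumrN.
by apply: eq_bigr => x _; rewrite qchiM hg mulN1r.
Qed.

Lemma sum_qchi_shift a : \sum_(x : 'F_q) qchi (x + a) = 0.
Proof. by have H := sum_qchi; rewrite (reindex_inj (addIr a)) in H. Qed.

(** For x nonzero the term is the character of 1 + a / x, and x -> 1 + a / x maps the nonzero
    elements bijectively onto those different from 1; the full character sum is 0. *)
Lemma sum_qchi2 a : a != 0 -> \sum_(x : 'F_q) qchi x * qchi (x + a) = -1.
Proof.
move=> a0; rewrite (bigD1 0) //= {1}/qchi eqxx mul0r add0r.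
rewrite (eq_bigr (fun x => qchi (1 + a / x))) => [|x x0]; last first.
  rewrite (_ : x + a = x * (1 + a / x)); last by rewrite mulrDr mulr1 mulrCA divff // mulr1.
  by rewrite qchiM mulrA qchi_sqr // mul1r.
have S := sum_qchi; rewrite (bigD1 1) //= qchi1 in S.
rewrite (_ : \sum_(i | i != 0) _ = \sum_(i : 'F_q | i != 1) qchi i); last first.
  rewrite [RHS](reindex_onto (fun x => 1 + a / x) (fun y => a / (y - 1))) /=; last first.
    move=> y y1; have y10 : y - 1 != 0 by rewrite subr_eq0.
    by rewrite invfM invrK mulrA divff // mul1r addrC subrK.
  apply: eq_bigl => x; case: (eqVneq x 0) => [->|x0]; first by rewrite invr0 mulr0 addr0 eqxx.
  rewrite [1 + _]addrC addrK invfM invrK mulrA divff // mul1r eqxx andbT.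
  by rewrite -subr_eq0 addrK mulf_neq0 // invr_eq0.
by apply: (addrI 1); rewrite S subrr.
Qed.

Lemma sum_qchi2_shift a b : a != b -> \sum_(x : 'F_q) qchi (x + a) * qchi (x + b) = -1.
Proof.
move=> ab; rewrite -(@sum_qchi2 (b - a)); last by rewrite subr_eq0 eq_sym.
rewrite [RHS](reindex_inj (addIr a)) /=; apply: eq_bigr => x _.
by rewrite -addrA [a + _]addrC subrK.
Qed.

(* After expansion the sum differs by 1 from a sum of the nonnegative terms
   1 + qchi (x (x + a) (x + b)), so no estimate for the elliptic sum is needed. *)
Lemma qchi_count a b : a != 0 -> b != 0 -> a != b ->
  exists x, (1 + qchi x) * (1 - qchi (x + a)) * (1 - qchi (x + b)) != 0.
Proof.
move=> a0 b0 ab; apply: contrapT => H.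
have S0 : \sum_(x : 'F_q) (1 + qchi x) * (1 - qchi (x + a)) * (1 - qchi (x + b)) = 0.
  by apply: big1 => x _; apply/eqP; apply: contrapT => /negP h; apply: H; exists x.
have E : \sum_(x : 'F_q) (1 + qchi x) * (1 - qchi (x + a)) * (1 - qchi (x + b)) =
   \sum_(x : 'F_q) (1 + qchi x * qchi (x + a) * qchi (x + b)) + \sum_(x : 'F_q) qchi x
   - \sum_(x : 'F_q) qchi (x + a) - \sum_(x : 'F_q) qchi (x + b)
   - \sum_(x : 'F_q) qchi x * qchi (x + a) - \sum_(x : 'F_q) qchi x * qchi (x + b)
   + \sum_(x : 'F_q) qchi (x + a) * qchi (x + b).
  by rewrite -!sumrN -!big_split /=; apply: eq_bigr => x _; ring.
have P : 0 <= \sum_(x : 'F_q) (1 + qchi x * qchi (x + a) * qchi (x + b)).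
  by apply: sumr_ge0 => x _; rewrite -!qchiM; have /andP [h _] := qchi_ge (x * (x + a) * (x + b)); rewrite -lerBlDl sub0r.
move: E; rewrite S0 sum_qchi !sum_qchi_shift !sum_qchi2 // sum_qchi2_shift //; lia.
Qed.

Lemma qchi_int (u : int) : ~~ (q%:Z %| u)%Z -> qchi u%:~R = if nr q u then -1 else 1.
Proof. by rewrite -intrF_eq0 // /qchi /nr => /negbTE ->; case: eqP. Qed.

Lemma sg_unit (u d : int) : ~~ (q%:Z %| u)%Z -> vo q d = false -> lg q d = nr q u -> sg q u = sg q d.
Proof.
move=> nu vd ld; apply/sg_oddE; first exact: odd_prime_neq2.
by rewrite vd ld /vo vv_unit // /lg up_unit.
Qed.

(** [qchi_count] provides X1 mod q, zero or a residue, with X2 and X3 zero or non-residues. As the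
    product of the three classes is trivial, the number of non-residue classes is 0 or 2, so this
    pattern, its cyclic shifts and the constant solution cover everything. *)
Let LS_good1 (E1 E2 E3 d1 d2 d3 : int) : E1 + E2 + E3 = 0 ->
  ~~ (q%:Z %| E1)%Z -> ~~ (q%:Z %| E2)%Z -> ~~ (q%:Z %| E3)%Z ->
  d1 != 0 -> d2 != 0 -> d3 != 0 ->
  vo q d1 = false -> vo q d2 = false -> vo q d3 = false ->
  lg q d1 = false -> lg q d2 = true -> lg q d3 = true ->
  LS q E1 E2 E3 d1 d2 d3.
Proof.
move=> sE n1 n2 n3 d10 d20 d30 o1 o2 o3 l1 l2 l3.
have Z (u : int) : ~~ (q%:Z %| u)%Z -> u != 0 by apply: contraNneq => ->; rewrite dvdz0.
have ND (u : int) : ~~ (q%:Z %| u)%Z -> ~~ (q%:Z %| - u)%Z by rewrite rpredN.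
have eE1 : E1 = - E2 - E3 by rewrite -[RHS]addr0 -sE; ring.
have [||| x hx] := @qchi_count E3%:~R (- E2)%:~R.
- by rewrite intrF_eq0.
- by rewrite intrF_eq0 // ND.
- by rewrite intrF_eq // opprK addrC -(rpredN _ (E2 + E3)) opprD -eE1.
pose X1 : int := (x : nat)%:Z; have ex : x = X1%:~R by rewrite /X1 -pmulrn natr_Zp.
rewrite ex -!rmorphD /= in hx.
have neg (u : int) d : ~~ (q%:Z %| u)%Z -> vo q d = false -> lg q d = true ->
    1 - qchi u%:~R != 0 -> sg q u = sg q d.
  by move=> nu vd ld h; apply: sg_unit => //; move: h; rewrite qchi_int // ld; case: nr.
have pos (u : int) d : ~~ (q%:Z %| u)%Z -> vo q d = false -> lg q d = false ->
    1 + qchi u%:~R != 0 -> sg q u = sg q d.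
  by move=> nu vd ld h; apply: sg_unit => //; move: h; rewrite qchi_int // ld; case: nr.
have cong (u v : int) : (q%:Z %| u - v)%Z -> (u%:~R : 'F_q) = v%:~R.
  by rewrite -intrF_eq // => /eqP.
move: hx; rewrite !mulf_eq0 !negb_or => /andP [/andP [h1 h2] h3].
(* [qchi_count] admits zero values; each of them means a point X_i = 0 mod q, where the other two
   classes are the required ones. *)
case: (boolP (q%:Z %| X1)%Z) => [z1|nz1].
  apply: LS_zero1 => //; rewrite ?(Z _ n1) ?(Z _ n2) ?(Z _ n3) //; apply/esym.
    by apply: neg => //; rewrite -(cong (X1 + E3)) // addrK.
  by apply: neg; rewrite ?ND // -(cong (X1 - E2)) // addrK.
case: (boolP (q%:Z %| X1 + E3)%Z) => [z2|nz2].
  apply: LS_zero2 => //; rewrite ?(Z _ n1) ?(Z _ n2) ?(Z _ n3) //; apply/esym.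
    apply: neg => //; rewrite -(cong (X1 - E2)) //.
    by rewrite eE1 (_ : X1 - E2 - (- E2 - E3) = X1 + E3) //; ring.
  by apply: pos; rewrite ?ND // -(cong X1) // opprK.
case: (boolP (q%:Z %| X1 - E2)%Z) => [z3|nz3].
  apply: LS_zero3 => //; rewrite ?(Z _ n1) ?(Z _ n2) ?(Z _ n3) //; apply/esym.
    by apply: pos => //; rewrite -(cong X1).
  apply: neg; rewrite ?ND // -(cong (X1 + E3)) //.
  by rewrite eE1 (_ : X1 + E3 - - (- E2 - E3) = X1 - E2) //; ring.
exists X1, (X1 + E3), (X1 - E2), 1; split; first by rewrite !Z.
split; first by rewrite eE1; split; ring.
by split; [apply: pos|apply: neg|apply: neg].
Qed.

Lemma LS_good (E1 E2 E3 d1 d2 d3 : int) : E1 + E2 + E3 = 0 ->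
  ~~ (q%:Z %| E1)%Z -> ~~ (q%:Z %| E2)%Z -> ~~ (q%:Z %| E3)%Z ->
  d1 != 0 -> d2 != 0 -> d3 != 0 -> sg q d1 = xor3 (sg q d2) (sg q d3) ->
  vo q d2 = false -> vo q d3 = false -> LS q E1 E2 E3 d1 d2 d3.
Proof.
move=> sE n1 n2 n3 d10 d20 d30 hp o2 o3.
have q2 := odd_prime_neq2 oq.
have [o1 l1] : vo q d1 = false /\ lg q d1 = lg q d2 (+) lg q d3.
  by move: hp; rewrite /sg /xor3 (negbTE q2) /= o2 o3 => -[-> ->].
have sE2 : E2 + E3 + E1 = 0 by rewrite -sE; ring.
have sE3 : E3 + E1 + E2 = 0 by rewrite -sE; ring.
case l2 : (lg q d2) in l1; case l3 : (lg q d3) in l1.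
- exact: LS_good1.
- by apply: LS_cycle; apply: LS_good1.
- by do 2 apply: LS_cycle; apply: LS_good1.
- by apply: LS_const; rewrite //; apply/sg_oddE; rewrite // o1 ?o2 ?o3 l1 ?l2 ?l3.
Qed.

End CharacterSums.

(** * Sign changes at odd primes dividing the second coefficient *)

(** The sum of these products over all x is q + 1. *)
Lemma qchi_pair q (a : 'F_q) : prime q -> odd q -> a != 0 ->
  exists x : 'F_q, (1 + qchi x) * (1 - qchi (x + a)) != 0.
Proof.
move=> pq oq a0; apply: contrapT => H.
have S0 : \sum_(x : 'F_q) (1 + qchi x) * (1 - qchi (x + a)) = 0.
  by apply: big1 => x _; apply/eqP; apply: contrapT => /negP h; apply: H; exists x.
have E : \sum_(x : 'F_q) (1 + qchi x) * (1 - qchi (x + a)) =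
   \sum_(x : 'F_q) 1 + \sum_(x : 'F_q) qchi x
   - \sum_(x : 'F_q) qchi (x + a) - \sum_(x : 'F_q) qchi x * qchi (x + a).
  by rewrite -!sumrN -!big_split /=; apply: eq_bigr => x _; ring.
by move: E; rewrite S0 sum_qchi // sum_qchi_shift // sum_qchi2 // sumr_const; lia.
Qed.

(* Equivalently, [-a] is a sum of two nonzero squares mod [q]. *)
Lemma residue_pair q (a : int) : prime q -> odd q -> nr q (-1) -> ~~ (q%:Z %| a)%Z -> nr q a = false ->
  exists x : int, [/\ ~~ (q%:Z %| x)%Z, ~~ (q%:Z %| x + a)%Z, nr q x = false & nr q (x + a)].
Proof.
move=> pq oq nm na ha; have [|x] := @qchi_pair q a%:~R pq oq; first by rewrite intrF_eq0.
pose X : int := (x : nat)%:Z; have ex : x = X%:~R by rewrite /X -pmulrn natr_Zp.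
rewrite ex -rmorphD /= mulf_eq0 negb_or => /andP [h1 h2].
move: X h1 h2 {ex} => X h1 h2.
have cong (u v : int) : (q%:Z %| u - v)%Z -> (u%:~R : 'F_q) = v%:~R by rewrite -intrF_eq // => /eqP.
(* Zeros are excluded: x = 0 would make x + a = a a residue, and x + a = 0 would make x = -a a
   non-residue. *)
have n1 : ~~ (q%:Z %| X)%Z.
  by apply: contraNN h2 => hX; rewrite (cong _ a) ?addrK // qchi_int // ha.
have n2 : ~~ (q%:Z %| X + a)%Z.
  apply: contraNN h1 => hX; rewrite (cong _ (- a)) ?opprK // qchi_int ?rpredN //.
  by rewrite -[- a]mulN1r nrM // ?nm ?ha // dvdzE /= dvdn1 neq_ltn prime_gt1 ?orbT.
exists X; split=> //.
  by move: h1; rewrite qchi_int //; case: nr.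
by move: h2; rewrite qchi_int //; case: nr.
Qed.

Lemma sgN q (a : int) : prime q -> a != 0 -> sg q (- a) = xor3 (sg q (-1)) (sg q a).
Proof. by move=> pq a0; rewrite -[- a]mulN1r sgM. Qed.

Lemma sg_N1_odd q : prime q -> odd q -> sg q (-1) = (false, nr q (-1), false).
Proof. by move=> pq oq; rewrite /sg vo_N1 // (negbTE (odd_prime_neq2 oq)) lg_N1. Qed.

Lemma sg_int_unit q (u : int) : prime q -> odd q -> ~~ (q%:Z %| u)%Z -> sg q u = (false, nr q u, false).
Proof. by move=> pq oq nu; rewrite /sg (negbTE (odd_prime_neq2 oq)) /vo vv_unit // /lg up_unit. Qed.

Lemma ndvdzW q (u : int) : ~~ (q%:Z %| u)%Z -> u != 0.
Proof. by apply: contraNneq => ->; rewrite dvdz0. Qed.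

Lemma sg_add_unit q (u b : int) : prime q -> odd q -> ~~ (q%:Z %| u)%Z -> (q%:Z %| b)%Z ->
  u + b != 0 /\ sg q (u + b) = sg q u.
Proof.
move=> pq oq nu hb; have [||? _ ?] := @sg_add_odd q u b pq oq; rewrite ?(ndvdzW nu) //.
by rewrite (vv_unit nu) expn1.
Qed.

Section Twist.
Variables (q : nat) (E1 E2 E3 : int).
Hypotheses (pq : prime q) (oq : odd q) (sE : E1 + E2 + E3 = 0) (E20 : E2 != 0).
Hypotheses (n1 : ~~ (q%:Z %| E1)%Z) (hE2 : (q%:Z %| E2)%Z) (n3 : ~~ (q%:Z %| E3)%Z).

Let eE1 : E1 = - E2 - E3. Proof. by rewrite -[RHS]addr0 -sE; ring. Qed.

(** The sign change of the trivial class. Let -1 be a non-residue. If E3 is a residue, the point X2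
    = 0 serves, since E1 is congruent to -E3; otherwise -E3 is a residue and [residue_pair] gives
    the point X1 = -x, X2 = E3 - x. *)
Lemma LS_minus (d1 d2 d3 : int) : d1 != 0 -> d2 != 0 -> d3 != 0 ->
  sg q d1 = sg q (-1) -> sg q d2 = sg q 1 -> sg q d3 = sg q (-1) -> LS q E1 E2 E3 d1 d2 d3.
Proof.
move=> d10 d20 d30 s1 s2 s3.
case: (boolP (nr q (-1))) => [nm|/negbTE nm]; last first.
  by apply: LS_const; rewrite // s1 ?s2 ?s3 // sg_N1_odd // nm sg1.
have nN3 : ~~ (q%:Z %| - E3)%Z by rewrite rpredN.
have hN2 : (q%:Z %| - E2)%Z by rewrite rpredN.
case: (boolP (nr q E3)) => [h3|/negbTE h3]; last first.
  have sN3 : sg q (- E3) = sg q (-1).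
    by rewrite (sgN pq (ndvdzW n3)) (sg_int_unit pq oq n3) h3 xor3f.
  apply: LS_zero2; rewrite // ?(ndvdzW n1) ?(ndvdzW n3) ?sN3 //.
  by rewrite s3 -sN3 eE1 addrC; have [_ ->] := sg_add_unit pq oq nN3 hN2.
have hN3 : nr q (- E3) = false.
  have := sgN pq (ndvdzW n3); rewrite (sg_int_unit pq oq nN3) (sg_int_unit pq oq n3).
  by rewrite sg_N1_odd // nm h3 => -[].
have [x [nx nxa hx hxa]] := residue_pair pq oq nm nN3 hN3.
have nNx : ~~ (q%:Z %| - x)%Z by rewrite rpredN.
have [z3 t3] := sg_add_unit pq oq nNx hN2.
have eX2 : E3 - x = - (x - E3) by rewrite opprB.
have sx : sg q (- x) = sg q (-1).
  by rewrite (sgN pq (ndvdzW nx)) (sg_int_unit pq oq nx) hx xor3f.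
exists (- x), (E3 - x), (- x - E2), 1; split.
  by split; rewrite // ?(ndvdzW nNx) // eX2 oppr_eq0 (ndvdzW nxa).
split; first by rewrite eE1; split; ring.
rewrite t3 sx s1 s2 s3 eX2 (sgN pq (ndvdzW nxa)) (sg_int_unit pq oq nxa) hxa.
by rewrite sg_N1_odd // nm sg1.
Qed.

(** Only the case of -1 a non-residue has content. If v(X1) <= v(t^2), then X1 and X3 share a class,
    d2 is trivial, and the new triple is (-1, 1, -1) or trivial. Otherwise X2 has the class of E3,
    and the argument depends on whether E3 is a residue. *)
Lemma LS_twist (d1 d2 d3 : int) : d1 != 0 -> d2 != 0 -> d3 != 0 ->
  sg q d1 = xor3 (sg q d2) (sg q d3) ->
  LS q E1 E2 E3 d1 d2 d3 -> LS q E1 E2 E3 (- d1) d2 (- d3).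
Proof.
move=> d10 d20 d30 hp hL.
have E30 := ndvdzW n3.
have [m10 m30] : - d1 != 0 /\ - d3 != 0 by rewrite !oppr_eq0.
have q2 := odd_prime_neq2 oq.
case: (boolP (nr q (-1))) => [nm|/negbTE nm]; last first.
  have sm : sg q (-1) = (false, false, false) by rewrite sg_N1_odd // nm.
  by apply: LS_sg hL; rewrite // sgN // sm xor3C xor3f.
have sm : sg q (-1) = (false, true, false) by rewrite sg_N1_odd // nm.
have triv : sg q d1 = sg q 1 -> sg q d2 = sg q 1 -> sg q d3 = sg q 1 -> LS q E1 E2 E3 (- d1) d2 (- d3).
  by move=> h1 h2 h3; apply: LS_minus => //; rewrite sgN // ?h1 ?h3 sg1 // xor3f.
have [X1 [X2 [X3 [t [[x1 x2 x3] [e1 e2 e3] [s1 s2 s3] hX]]]]] := LS_prod hL hp.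
have hX2 := xor3_rot hX.
case: (eqVneq t 0) => [t0|t0].
  move: e1 e2; rewrite t0 expr0n !mulr0 !addr0 => e1 e2.
  have z := xor3_const hX (congr1 _ (etrans e2 e1)) (congr1 _ e2).
  by apply: triv; rewrite sg1 // -?s1 -?s2 -?s3 -?e1 -?e2.
have t20 : t ^+ 2 != 0 by rewrite expf_neq0.
pose s := vv q (t ^+ 2).
have os : odd s = false by rewrite /s expr2 vvM // addnn odd_double.
have Et0 : E3 * t ^+ 2 != 0 by rewrite mulf_neq0.
have vE3 : vv q (E3 * t ^+ 2) = s by rewrite vvM // (vv_unit n3).
have dE2 : ((q ^ s.+1)%N%:Z %| E2 * t ^+ 2)%Z.
  by rewrite expnS PoszM dvdz_mul // -vv_ge.
have f2 : X3 = X1 - E2 * t ^+ 2 by rewrite e2 addrK.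
case: (leqP (vv q X1) s) => [le|gt].
  have hd : ((q ^ (vv q X1).+1)%N%:Z %| - (E2 * t ^+ 2))%Z by rewrite rpredN; apply: dvdz_powW dE2.
  have [_ _ s31] := sg_add_odd pq oq x1 hd; rewrite -f2 in s31.
  rewrite s31 xor3ss in hX2.
  have v1 : vo q X1 = false.
    move: le; rewrite leq_eqVlt => /orP [/eqP h|lt]; first by rewrite /vo h.
    have hd3 : ((q ^ (vv q X1).+1)%N%:Z %| E3 * t ^+ 2)%Z by rewrite -vv_ge // vE3.
    have [_ _] := sg_add_odd pq oq x1 hd3; rewrite -e3 hX2 => /esym.
    by case.
  have h1 : sg q X1 = (false, lg q X1, false) by rewrite /sg (negbTE q2) v1.
  case l1 : (lg q X1) in h1; last first.
    by apply: triv; rewrite sg1 // -?s1 -?s2 -?s3 ?s31.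
  by apply: LS_const; rewrite // (sgN pq d10) ?(sgN pq d30) -s1 -?s2 -?s3 ?s31 h1 sm ?hX2.
have dX1 : ((q ^ s.+1)%N%:Z %| X1)%Z by rewrite -vv_ge.
have dX3 : ((q ^ s.+1)%N%:Z %| - X3)%Z by rewrite rpredN f2 rpredB.
have vE3' : ((q ^ (vv q (E3 * t ^+ 2)).+1)%N%:Z %| X1)%Z by rewrite vE3.
have [_ _ s2E] := sg_add_odd pq oq Et0 vE3'; rewrite addrC -e3 sgMsqr // in s2E.
rewrite (sg_int_unit pq oq n3) in s2E.
case h3 : (nr q E3) in s2E; last first.
  have sX13 : sg q X1 = sg q X3 by rewrite hX s2E xor3C xor3f.
  have vE3'' : ((q ^ (vv q (E3 * t ^+ 2)).+1)%N%:Z %| - X3)%Z by rewrite vE3.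
  have [z2 _ s2'] := sg_add_odd pq oq Et0 vE3''.
  (* E3 is a residue: d1 and d3 have the same class, and replacing (X1, X3) by (-X3, -X1) keeps the
     difference X1 - X3. *)
  exists (- X3), (E3 * t ^+ 2 - X3), (- X1), t; split; first by rewrite !oppr_eq0.
  split; first by rewrite e2 eE1; split; ring.
  split.
  - by rewrite (sgN pq x3) (sgN pq d10) -s1 sX13.
  - by rewrite s2' sgMsqr // -s2 s2E (sg_int_unit pq oq n3) h3.
  - by rewrite (sgN pq x1) (sgN pq d30) -s3 sX13.
have v13 : vo q X1 = vo q X3 by move: hX; rewrite s2E => -[-> _ _].
have l13 : lg q X1 = ~~ lg q X3.
  by move: hX; rewrite s2E /sg (negbTE q2) => -[_ ->].
have Et20 : E2 * t ^+ 2 != 0 by rewrite mulf_neq0.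
have oE2 : vo q (E2 * t ^+ 2) = vo q E2 by have [] := sgMsqr pq E20 t0.
have fE : E2 * t ^+ 2 = X1 - X3 by rewrite {1}e2 addrC addKr.
have nX3 : - X3 != 0 by rewrite oppr_eq0.
have vN (E : int) : vv q (- E) = vv q E by rewrite /vv abszN.
(* E3 is a non-residue: the unit parts of X1 and X3 have different symbols, so nothing cancels in X1
   - X3 = E2 t^2, whose valuation is therefore the smaller of the two. *)
have v1 : vo q d1 = vo q E2.
  have <- : vo q X1 = vo q d1 by case: s1.
  rewrite -oE2 fE; case: (ltngtP (vv q X1) (vv q X3)) => [lt|lt|eq].
  - have [||_ v _] := @sg_add_odd q X1 (- X3) pq oq; rewrite // -?vv_ge ?vN //.
    by rewrite /vo v.
  - have [||_ v _] := @sg_add_odd q (- X3) X1 pq oq; rewrite // -?vv_ge ?vN //.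
    by rewrite v13 /vo addrC v vN.
  have nd : ~~ (q%:Z %| up q X1 - up q X3)%Z.
    apply/negP => /(nr_eqmod pq); rewrite -/(lg q X1) -/(lg q X3) l13.
    by case: lg.
  have -> : X1 - X3 = (q ^ vv q X1)%N%:Z * (up q X1 - up q X3).
    by rewrite {1}(upE q X1) {1}(upE q X3) -eq; ring.
  by rewrite /vo; have [-> _] := vv_up_uniq (vv q X1) pq nd.
have sE3 : sg q E3 = (false, true, false) by rewrite (sg_int_unit pq oq n3) h3.
have sd2 : sg q d2 = sg q E3 by rewrite -s2 s2E sE3.
have sd3 : sg q (- d3) = sg q d1 by rewrite sgN // sm hp sd2 sE3.
have nE2 : - E2 != 0 by rewrite oppr_eq0.
(* Now d1 has the class of E2 or of -E2. In the first case X1 = -x E2 and X3 = -(x+1) E2, with x a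
   residue and x + 1 a non-residue; in the second the point X1 = 0 serves. *)
case: (boolP (lg q d1 == lg q E2)) => [/eqP l1|l1].
  have sd1 : sg q d1 = sg q E2 by apply/sg_oddE.
  have n11 : ~~ (q%:Z %| 1)%Z by rewrite dvdzE /= dvdn1 neq_ltn prime_gt1 ?orbT.
  have [x [nx nxa hx hxa]] := residue_pair pq oq nm n11 (nr1 _).
  have x0 := ndvdzW nx; have xa0 := ndvdzW nxa.
  have dx : (q%:Z %| - (x * E2))%Z by rewrite rpredN dvdz_mull.
  have [z2 t2] := sg_add_unit pq oq n3 dx.
  exists (- (x * E2)), (E3 - x * E2), (- ((x + 1) * E2)), 1.
  split; first by rewrite !oppr_eq0 !mulf_neq0.
  split; first by rewrite eE1; split; ring.
  rewrite t2 sd2 sd3 sd1; split=> //.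
    by rewrite (sgN pq d10) (sgN pq (mulf_neq0 x0 E20)) sgM // (sg_int_unit pq oq nx) hx sd1 (xor3C (_, _, _)) xor3f.
  by rewrite (sgN pq (mulf_neq0 xa0 E20)) sgM // (sg_int_unit pq oq nxa) hxa sm xor3A xor3ss xor3C xor3f.
have sd1 : sg q d1 = sg q (- E2).
  apply/sg_oddE => //; split; first by rewrite v1 /vo vN.
  rewrite -[- E2]mulN1r lgM // lg_N1 // nm; move: l1.
  by case: (lg q d1); case: (lg q E2).
by apply: LS_zero1; rewrite // sd3.
Qed.

End Twist.

(** * The places 2 and infinity *)

Lemma pow2E : ((2 ^ 1)%N%:Z = 2 :> int) * ((2 ^ 2)%N%:Z = 4 :> int) * ((2 ^ 3)%N%:Z = 8 :> int).
Proof. by []. Qed.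

Lemma vv2_two_exact (E : int) : (2 %| E)%Z -> ~~ (4 %| E)%Z -> vv 2 E = 1%N.
Proof.
move=> h2 h4; have E0 : E != 0 by apply: contraNneq h4 => ->.
by apply/eqP; rewrite eqn_leq (@vv_ge 2 E 1) // pow2E h2 andbT leqNgt (@vv_ge 2 E 2) // pow2E.
Qed.

(** X1 and X3 have even valuations and their difference E2 t^2 has odd valuation 2c+1, which forces
    v(X1) <= 2c. As 4 divides E3, adding E3 t^2 keeps the unit part of X1 mod 4; so d1 and d2 agree
    under [ep], and d3 is their product. *)
Lemma LS2_ep (E1 E2 E3 d1 d2 d3 : int) : E1 + E2 + E3 = 0 -> E2 != 0 -> E3 != 0 ->
  (2 %| E2)%Z -> ~~ (4 %| E2)%Z -> (4 %| E3)%Z ->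
  sg 2 d1 = xor3 (sg 2 d2) (sg 2 d3) -> vo 2 d2 = false -> vo 2 d3 = false ->
  LS 2 E1 E2 E3 d1 d2 d3 -> ep d3 = false.
Proof.
move=> sE E20 E30 h2 h4 h3 hp o2 o3 hL.
have [X1 [X2 [X3 [t [[x1 x2 x3] [e1 e2 e3] [s1 s2 s3] hX]]]]] := LS_prod hL hp.
have <- : ep X3 = ep d3 by case: s3.
case: (eqVneq t 0) => [t0|t0].
  move: e1 e2; rewrite t0 expr0n !mulr0 !addr0 => e1 e2.
  by have := xor3_const hX (congr1 _ (etrans e2 e1)) (congr1 _ e2); rewrite e2 => -[].
have v3 : ~~ odd (vv 2 X3) by move: s3 => [] s3 _ _; rewrite -/(vo 2 X3) s3 o3.
have v1 : ~~ odd (vv 2 X1).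
  move: s1 => [] s1 _ _; rewrite -/(vo 2 X1) s1; move: hp => [] -> _ _.
  by rewrite o2 o3.
have t20 : t ^+ 2 != 0 by rewrite expf_neq0.
pose c := vv 2 t; have vt : vv 2 (t ^+ 2) = c.*2 by rewrite expr2 vvM // addnn.
have vE2 : vv 2 (E2 * t ^+ 2) = c.*2.+1 by rewrite vvM // vv2_two_exact // vt.
have Et0 : E2 * t ^+ 2 != 0 by rewrite mulf_neq0.
have fE : E2 * t ^+ 2 = X1 - X3 by rewrite {1}e2 addrC addKr.
have nX3 : - X3 != 0 by rewrite oppr_eq0.
have vN (E : int) : vv 2 (- E) = vv 2 E by rewrite /vv abszN.
have le : (vv 2 X1 <= c.*2)%N.
  case: (ltngtP (vv 2 X1) (vv 2 X3)) => [lt|lt|eq].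
  - have [|_ + _] := @up_add 2 X1 (- X3) 1 isT x1 isT; first by rewrite addn1 -vv_ge ?vN.
    by rewrite -fE vE2 => h; move: v1; rewrite -h /= odd_double.
  - have [|_ + _] := @up_add 2 (- X3) X1 1 isT nX3 isT; first by rewrite addn1 -vv_ge ?vN.
    by rewrite addrC -fE vE2 vN => h; move: v3; rewrite -h /= odd_double.
  - have : (vv 2 X1 <= vv 2 (E2 * t ^+ 2))%N.
      by rewrite vv_ge // fE rpredB // -vv_ge // eq.
    rewrite vE2 leq_eqVlt ltnS => /orP [/eqP h|//].
    by move: v1; rewrite h /= odd_double.
have hd : ((2 ^ (vv 2 X1 + 2))%N%:Z %| E3 * t ^+ 2)%Z.
  by rewrite expnD PoszM mulrC pow2E dvdz_mul // -vv_ge // vt.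
have [_ _] := @up_add 2 X1 (E3 * t ^+ 2) 2 isT x1 isT hd; rewrite -e3 pow2E => h.
have ee : ep X2 = ep X1 by rewrite /ep (_ : (up 2 X2 %% 4)%Z = (up 2 X1 %% 4)%Z) //; move: h; clear;
  move: (up 2 X1) (up 2 X2) => a b; lia.
have := xor3_rot (xor3_rot hX); rewrite /sg /xor3 /= => -[_ -> _].
by rewrite ee addbb.
Qed.

Lemma hs_sg q (a b a' b' : int) : prime q -> odd q -> sg q a = sg q a' -> sg q b = sg q b' ->
  hs q a b = hs q a' b'.
Proof.
move=> pq oq /(sg_oddE _ _ (odd_prime_neq2 oq)) [va la] /(sg_oddE _ _ (odd_prime_neq2 oq)) [vb lb].
by rewrite /hs va la vb lb.
Qed.

(** The equation X3 + E2 t^2 = X1, multiplied by X1, is a point on a conic whose coefficients have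
    the classes of d2 and E2 d1. *)
Lemma LS_hs q (E1 E2 E3 d1 d2 d3 : int) : prime q -> odd q -> E2 != 0 -> d1 != 0 -> d2 != 0 -> d3 != 0 ->
  sg q d1 = xor3 (sg q d2) (sg q d3) ->
  LS q E1 E2 E3 d1 d2 d3 -> hs q d2 (E2 * d1) = false.
Proof.
move=> pq oq E20 d10 d20 d30 hp hL.
have [X1 [X2 [X3 [t [[x1 x2 x3] [e1 e2 e3] [s1 s2 s3] hX]]]]] := LS_prod hL hp.
case: (eqVneq t 0) => [t0|t0].
  move: e1 e2; rewrite t0 expr0n !mulr0 !addr0 => e1 e2.
  have z := xor3_const hX (congr1 _ (etrans e2 e1)) (congr1 _ e2).
  have -> : hs q d2 (E2 * d1) = hs q 1 (E2 * d1).
    by apply: hs_sg; rewrite // sg1 // -s2 -e1 -e2.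
  have [v1 l1] : vo q 1 = false /\ lg q 1 = false.
    by have := sg1 pq; rewrite /sg (negbTE (odd_prime_neq2 oq)) => -[].
  by rewrite /hs v1 l1 andbF.
have Et0 : E2 * t ^+ 2 != 0 by rewrite mulf_neq0 // expf_neq0.
have <- : hs q (X3 * X1) (E2 * t ^+ 2 * X1) = hs q d2 (E2 * d1).
  apply: hs_sg => //; first by rewrite sgM // s1 s3 -(xor3_rot hp).
  by rewrite sgM // sgMsqr // s1 -sgM.
exact: hs_conic.
Qed.

Lemma hilbert_two (a b : int) : a != 0 -> b != 0 ->
  (forall q, prime q -> odd q -> hs q a b = false) -> hoo a b = false -> h2 a b = false.
Proof.
move=> a0 b0 H ho; have := @hilbert_product (`|a| + `|b|).+1 a b a0 b0.
rewrite !ltnS leq_addr leq_addl /hsum ho addbF => /(_ isT isT).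
by rewrite big1 // => q /andP [pq oq]; exact: H.
Qed.

Lemma sg2_odd (u : int) : ~~ (2 %| u)%Z ->
  sg 2 u = (false, (u %% 4)%Z == 3, ((u %% 8)%Z == 3) || ((u %% 8)%Z == 5)).
Proof. by move=> nu; rewrite /sg /= /ep /om /vo vv_unit // up_unit. Qed.

Lemma up2_two_exact (E : int) : (2 %| E)%Z -> ~~ (4 %| E)%Z -> E = 2 * up 2 E.
Proof. by move=> h2 h4; rewrite {1}(upE 2 E) vv2_two_exact. Qed.

(* By the product formula the symbols at 2 of two of the conics covered by [D] vanish;
   this leaves only the two classes mod 8 given by the trivial solution and by
   [t = 1], [X = (1 + E2 - E3, 1 + E2, 1 - E3)]. *)
Lemma LS_two (E1 E2 E3 d1 d2 d3 : int) : E1 + E2 + E3 = 0 -> E1 < 0 -> E2 != 0 -> 0 < E3 ->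
  (2 %| E1)%Z -> ~~ (4 %| E1)%Z -> (2 %| E2)%Z -> ~~ (4 %| E2)%Z -> (4 %| E3)%Z ->
  d1 != 0 -> 0 < d2 -> d3 != 0 -> 0 < d1 * d3 ->
  (forall q, prime q -> sg q d1 = xor3 (sg q d2) (sg q d3)) ->
  vo 2 d2 = false -> vo 2 d3 = false -> ep d3 = false ->
  (forall q, prime q -> odd q -> LS q E1 E2 E3 d1 d2 d3) -> LS 2 E1 E2 E3 d1 d2 d3.
Proof.
move=> sE E1n E20 E3p a1 b1 a2 b2 h3 d10 d2p d30 d13 hp o2 o3 p3 hL.
have d20 : d2 != 0 by rewrite gt_eqF.
have E10 : E1 != 0 by rewrite lt_eqF.
have [o1 p1 m1] : [/\ vo 2 d1 = false, ep d1 = ep d2 & om d1 = om d2 (+) om d3].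
  have [-> -> ->] : [/\ vo 2 d1 = vo 2 d2 (+) vo 2 d3, ep d1 = ep d2 (+) ep d3 & om d1 = om d2 (+) om d3].
    by have := hp 2 isT; rewrite /sg /xor3 /= => -[].
  by rewrite o2 o3 p3 !addbF.
(* At infinity both symbols vanish: here d2 > 0, and in [c2] a negative d1 forces d3 < 0, hence E1
   d3 > 0. *)
have c1 : h2 d2 (E2 * d1) = false.
  apply: hilbert_two; rewrite ?mulf_neq0 //; last by rewrite /hoo ltNge ltW.
  by move=> q pq oq; apply: (LS_hs pq oq _ _ _ _ (hp q pq) (hL q pq oq)).
have c2 : h2 d1 (E1 * d3) = false.
  apply: hilbert_two; rewrite ?mulf_neq0 //; last first.
    rewrite /hoo; case: (ltrP d1 0) => //= d1n.
    by apply/negbTE; rewrite -leNgt; nia.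
  move=> q pq oq; have hL' := LS_cycle (LS_cycle (hL q pq oq)).
  by apply: (LS_hs pq oq _ _ _ _ _ hL') => //; apply: xor3_rot (xor3_rot (hp q pq)).
have vE1 : vo 2 E1 = true by rewrite /vo vv2_two_exact.
have vE2 : vo 2 E2 = true by rewrite /vo vv2_two_exact.
move: c1 c2; rewrite /h2 !voM // !epM // !omM // o1 o2 o3 p1 p3 m1 vE1 vE2 /= !addbF.
have u1 := up2_odd E10; have u2 := up2_odd E20.
have f1 := up2_two_exact a1 b1; have f2 := up2_two_exact a2 b2.
(* If [ep d2] vanishes, the two symbols reduce to [om d2] and [om d1], so all three classes are
   trivial. *)
case pd2 : (ep d2); rewrite /= => c1 c2; last first.
  apply: LS_const => //; apply/sg2E; rewrite o1 p1 m1 ?o2 ?o3 ?p3 ?pd2 c1 //.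
  by move: c2; rewrite c1 => /= ->.
have nX2 : ~~ (2 %| 1 + E2)%Z by move: a2; clear; lia.
have nX3 : ~~ (2 %| 1 - E3)%Z by move: h3; clear; lia.
have nP : ~~ (2 %| (1 + E2) * (1 - E3))%Z by rewrite (@Euclid_dvdzM 2) // negb_or nX2.
have P0 : (1 + E2) * (1 - E3) != 0 by apply: contraNneq nP => ->.
(* 8 divides E2 E3, so 1 + E2 - E3 = (1 + E2)(1 - E3) + E2 E3 has the class of the product of the
   other two; only those remain to be compared with d2 and d3. *)
have hd : ((2 ^ (vv 2 ((1 + E2) * (1 - E3))%R + 3))%N%:Z %| E2 * E3)%Z.
  rewrite vv_unit // add0n pow2E; have -> : 8 = 2 * 4 :> int by [].
  exact: dvdz_mul.
have := sg_add (isT : prime 2) P0 hd.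
rewrite (_ : (1 + E2) * (1 - E3) + E2 * E3 = 1 + E2 - E3); last by ring.
case=> X10 _ sX1.
have [X20 X30] := (ndvdzW (q := 2) nX2, ndvdzW (q := 2) nX3).
have m2 : om d2 = ~~ ep E2 by move: c1; case: (ep E2); case: (om d2).
have m3 : om d3 = ep E1 (+) ~~ ep E2.
  by move: c2; rewrite m2; case: (ep E1); case: (ep E2); case: (om d3).
have s2 : sg 2 (1 + E2) = sg 2 d2.
  rewrite sg2_odd // /sg /= o2 pd2 m2 /ep; move: u2 f2; clear; move: (up 2 E2) => u h f.
  have -> : ((1 + E2) %% 4)%Z == 3 by lia.
  by congr (_, _, _); lia.
have s3 : sg 2 (1 - E3) = sg 2 d3.
  rewrite sg2_odd // /sg /= o3 p3 m3 /ep; move: u1 u2 f1 f2 sE h3; clear.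
  move: (up 2 E1) (up 2 E2) => u v k l f g sE h3.
  have -> : (((1 - E3) %% 4)%Z == 3) = false by lia.
  by congr (_, _, _); lia.
have eE1 : E1 = - E2 - E3 by rewrite -[RHS]addr0 -sE; ring.
exists (1 + E2 - E3), (1 + E2), (1 - E3), 1; split=> //.
split; first by rewrite eE1; split; ring.
by split=> //; rewrite sX1 sgM // s2 s3 hp.
Qed.

(** * Solubility at the real place *)

Lemma forms_realP (R : comNzRingType) (E1 E2 E3 d1 d2 d3 : int) (x : 'I_4 -> R)
    (t := x (@Ordinal 4 0 isT)) (u1 := x (@Ordinal 4 1 isT)) (u2 := x (@Ordinal 4 2 isT)) (u3 := x (@Ordinal 4 3 isT)) :
  (forall c, c \in forms E1 E2 E3 d1 d2 d3 -> diagq c x = 0) <->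
  [/\ E1%:~R * t ^+ 2 + d2%:~R * u2 ^+ 2 - d3%:~R * u3 ^+ 2 = 0,
      E2%:~R * t ^+ 2 + d3%:~R * u3 ^+ 2 - d1%:~R * u1 ^+ 2 = 0 &
      E3%:~R * t ^+ 2 + d1%:~R * u1 ^+ 2 - d2%:~R * u2 ^+ 2 = 0].
Proof.
have F1 : diagq [tuple E1; 0; d2; - d3] x = E1%:~R * t ^+ 2 + d2%:~R * u2 ^+ 2 - d3%:~R * u3 ^+ 2.
  by rewrite diagq4 !rmorphN /= mulr0z /t /u1 /u2 /u3; ring.
have F2 : diagq [tuple E2; - d1; 0; d3] x = E2%:~R * t ^+ 2 + d3%:~R * u3 ^+ 2 - d1%:~R * u1 ^+ 2.
  by rewrite diagq4 !rmorphN /= mulr0z /t /u1 /u2 /u3; ring.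
have F3 : diagq [tuple E3; d1; - d2; 0] x = E3%:~R * t ^+ 2 + d1%:~R * u1 ^+ 2 - d2%:~R * u2 ^+ 2.
  by rewrite diagq4 !rmorphN /= mulr0z /t /u1 /u2 /u3; ring.
split=> [H|[k1 k2 k3] c].
  by rewrite -F1 -F2 -F3; split; apply: H; rewrite /forms !inE eqxx ?orbT.
by rewrite /forms !inE => /or3P [] /eqP ->; rewrite ?F1 ?F2 ?F3.
Qed.

(** With these signs the second of the two forms is positive definite in t, u1, u2. *)
Lemma quad_neg_zero (R : realFieldType) (e1 e3 d1 d2 d3 t u1 u2 u3 : R) :
  e1 < 0 -> 0 < e3 -> d2 < 0 -> 0 < d1 ->
  e1 * t ^+ 2 + d2 * u2 ^+ 2 - d3 * u3 ^+ 2 = 0 ->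
  e3 * t ^+ 2 + d1 * u1 ^+ 2 - d2 * u2 ^+ 2 = 0 ->
  [/\ t = 0, u1 = 0, u2 = 0 & d3 * u3 ^+ 2 = 0].
Proof.
move=> h1 h3 k2 k1 f1 f3.
have a := sqr_ge0 t; have b := sqr_ge0 u1; have c := sqr_ge0 u2.
have A : 0 <= e3 * t ^+ 2 by rewrite mulr_ge0 // ltW.
have B : 0 <= d1 * u1 ^+ 2 by rewrite mulr_ge0 // ltW.
have C : 0 <= - d2 * u2 ^+ 2 by rewrite mulr_ge0 // oppr_ge0 ltW.
have Z (d u : R) : d != 0 -> d * u ^+ 2 = 0 -> u = 0.
  by move=> d0 /eqP; rewrite mulf_eq0 (negbTE d0) /= sqrf_eq0 => /eqP.
have t0 : t = 0 by apply: (Z e3); rewrite ?gt_eqF //; lra.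
have u10 : u1 = 0 by apply: (Z d1); rewrite ?gt_eqF //; lra.
have u20 : u2 = 0 by apply: (Z (- d2)); rewrite ?oppr_eq0 ?lt_eqF //; lra.
by split=> //; move: f1; rewrite t0 u20 expr0n /= !mulr0; lra.
Qed.

(** If d2 < 0, exactly one of d1, d3 is positive, and then the third form or the negative of the
    first is definite. If d2 > 0, a point with t = 0 or with X2 = 0 exists, according to the common
    sign of d1 and d3. *)
Lemma rcf_solvable_forms (R : rcfType) (E1 E2 E3 d1 d2 d3 : int) :
  E1 + E2 + E3 = 0 -> E1 < 0 -> 0 < E3 -> d2 != 0 -> 0 < d1 * d2 * d3 ->
  (exists x : 'I_4 -> R, (exists i, x i != 0) /\
     forall c, c \in forms E1 E2 E3 d1 d2 d3 -> diagq c x = 0) <-> 0 < d2.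
Proof.
move=> sE h1 h3 d20 hp.
split=> [[x [[i xi] /forms_realP]]|d2p].
  set t := x _; set u2 := x _; set u3 := x _; set u1 := x _ => -[f1 f2 f3].
  case: (ltrgtP d2 0) d20 => // d2n _; exfalso.
  have : (0 < d1) && (d3 < 0) || (d1 < 0) && (0 < d3).
    move: hp; rewrite -mulrA mulrCA nmulr_rgt0 //.
    by case: (ltrgt0P d1) => [k|k|->]; rewrite ?(pmulr_rlt0 _ k) ?(nmulr_rlt0 _ k) ?mul0r ?ltxx ?orbF.
  have r1 : (E1%:~R : R) < 0 by rewrite ltrz0.
  have r3 : 0 < (E3%:~R : R) by rewrite ltr0z.
  have r2 : (d2%:~R : R) < 0 by rewrite ltrz0.
  have Z (d : int) (u : R) : d != 0 -> d%:~R * u ^+ 2 = 0 -> u = 0.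
    by move=> d0 /eqP; rewrite mulf_eq0 intr_eq0 (negbTE d0) /= sqrf_eq0 => /eqP.
  have fin : [/\ t = 0, u1 = 0, u2 = 0 & u3 = 0] -> False.
    move=> [z0 z1 z2 z3]; move/negP: xi; apply; apply/eqP.
    by case: (ord4P i) => ->.
  case/orP => /andP [k1 k3].
    have k1' : 0 < (d1%:~R : R) by rewrite ltr0z.
    have [z0 z1 z2 /Z z3] := quad_neg_zero r1 r3 r2 k1' f1 f3.
    by apply: fin; split=> //; apply: z3; rewrite lt_eqF.
  have k3' : 0 < (d3%:~R : R) by rewrite ltr0z.
  have r1' : 0 < - (E1%:~R : R) by rewrite oppr_gt0.
  have r3' : - (E3%:~R : R) < 0 by rewrite oppr_lt0.
  (* The symmetry exchanging u1 and u3, with E1 and E3 replaced by -E3 and -E1. *)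
  have [||z0 z3 z2 /Z z1] := @quad_neg_zero R _ _ _ _ d1%:~R t u3 u2 u1 r3' r1' r2 k3'.
  - by move: f3; lra.
  - by move: f1; lra.
  by apply: fin; split=> //; apply: z1; rewrite lt_eqF.
have sd : (0 < d1) && (0 < d3) || (d1 < 0) && (d3 < 0).
  move: hp; rewrite -mulrA mulrCA pmulr_rgt0 //.
  by case: (ltrgt0P d1) => [k|k|->]; rewrite ?(pmulr_rgt0 _ k) ?(nmulr_rgt0 _ k) ?mul0r ?ltxx ?orbF.
have S (a : R) : 0 <= a -> exists u : R, u ^+ 2 = a by move=> a0; exists (Num.sqrt a); rewrite sqr_sqrtr.
have Dv (d : int) (e : R) : d != 0 -> d%:~R * (e / d%:~R) = e.
  by move=> d0; rewrite mulrC divfK // intr_eq0.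
have r2 : 0 < (d2%:~R : R) by rewrite ltr0z.
case/orP: sd => /andP [k1 k3].
  have k1' : 0 < (d1%:~R : R) by rewrite ltr0z.
  have k3' : 0 < (d3%:~R : R) by rewrite ltr0z.
  have [u1 q1] := S (1 / d1%:~R) (divr_ge0 ler01 (ltW k1')).
  have [u2 q2] := S (1 / d2%:~R) (divr_ge0 ler01 (ltW r2)).
  have [u3 q3] := S (1 / d3%:~R) (divr_ge0 ler01 (ltW k3')).
  exists (fun i => tnth [tuple 0; u1; u2; u3] i); split.
    exists (@Ordinal 4 1 isT); rewrite (tnth_nth 0) /=.
    apply/negP => /eqP z; move: q1; rewrite z expr0n /= => /esym /eqP.
    by rewrite mulf_eq0 oner_eq0 /= invr_eq0 gt_eqF.
  apply/forms_realP; rewrite !(tnth_nth 0) /= q1 q2 q3 !Dv ?gt_eqF //.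
  by rewrite expr0n /= !mulr0; split; lra.
have k1' : (d1%:~R : R) < 0 by rewrite ltrz0.
have k3' : (d3%:~R : R) < 0 by rewrite ltrz0.
have g3 : 0 <= (- E3)%:~R / (d1%:~R : R) by rewrite mulr_le0 ?invr_le0 ?(ltW k1') // ltW // ltrz0 oppr_lt0.
have g1 : 0 <= E1%:~R / (d3%:~R : R) by rewrite mulr_le0 ?invr_le0 ?(ltW k3') // ltW // ltrz0.
have [u1 q1] := S _ g3; have [u3 q3] := S _ g1.
(* The point X2 = 0 with t = 1, where X1 = -E3 and X3 = E1 are negative like d1 and d3. *)
exists (fun i => tnth [tuple 1; u1; 0; u3] i); split.
  by exists (@Ordinal 4 0 isT); rewrite (tnth_nth 0) /= oner_eq0.
have e2 : (E2%:~R : R) = - E1%:~R - E3%:~R.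
  by rewrite -rmorphN -rmorphB; congr (_%:~R); rewrite -[RHS]addr0 -sE; ring.
apply/forms_realP; rewrite !(tnth_nth 0) /= q1 q3 !Dv ?lt_eqF // e2 expr0n /= expr1n rmorphN /=.
by rewrite !mulr0 !mulr1; split; lra.
Qed.

Lemma real_solvable_forms (E1 E2 E3 d1 d2 d3 : int) : E1 + E2 + E3 = 0 -> E1 < 0 -> 0 < E3 ->
  d2 != 0 -> 0 < d1 * d2 * d3 ->
  real_solvable (forms E1 E2 E3 d1 d2 d3) <-> 0 < d2.
Proof. exact: rcf_solvable_forms. Qed.

(** * Square-free representatives *)

Lemma sqfree_vv q (a : int) : prime q -> sqfree a -> (vv q a <= 1)%N.
Proof.
move=> pq [a0 h]; rewrite leqNgt vv_ge // dvdzE /=; apply/negP => /h E.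
by rewrite E in pq.
Qed.

Lemma sqfree_rep (a : int) : a != 0 -> exists2 b, sqfree b & is_sq (a * b).
Proof.
have [m] := ubnP `|a|%N; elim: m a => // m IH a am a0.
case: (pselect (sqfree a)) => [sa|nsa]; first by exists a => //; exists a.
have [d] : exists d, (d ^ 2 %| `|a|)%N /\ d <> 1%N.
  apply: contrapT => H; apply: nsa; split=> // d hd.
  by apply: contrapT => d1; apply: H; exists d.
case=> /dvdnP [k hk] d1.
have d0 : (1 < d)%N by case: d d1 hk => [|[]] // _ hk; move: a0; rewrite -absz_eq0 hk muln0.
have [b0 Eb] : exists b : int, a = b * (d%:Z) ^+ 2.
  have /dvdzP [b ->] : ((d ^ 2)%N%:Z %| a)%Z by rewrite dvdzE /= hk dvdn_mull.
  by exists b; rewrite -natrXE.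
have b00 : b0 != 0 by apply: contraNneq a0 => b0E; rewrite Eb b0E mul0r.
have [|//|c sc [e he]] := IH b0.
  rewrite ltnS in am; apply: leq_trans am; rewrite Eb abszM abszX ltn_Pmulr ?absz_gt0 //.
  by rewrite (ltn_exp2l 0 2 d0).
exists c => //; exists (d%:Z * e); rewrite Eb.
have -> : b0 * d%:Z ^+ 2 * c = d%:Z ^+ 2 * (b0 * c) by ring.
by rewrite he; ring.
Qed.

Lemma is_sqM (a b : int) : is_sq a -> is_sq b -> is_sq (a * b).
Proof. by move=> [c ->] [d ->]; exists (c * d); ring. Qed.

Lemma is_sq_cancel (a b : int) : b != 0 -> is_sq b -> is_sq (a * b) -> is_sq a.
Proof.
move=> b0 [e Ee] [c Ec].
have e0 : e != 0 by apply: contraNneq b0 => eE; rewrite Ee eE mul0r.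
have : (e ^+ 2 %| c ^+ 2)%Z by rewrite !expr2 -Ec Ee dvdz_mull.
rewrite dvdzE !abszX dvdn_pexp2r // => h.
have /dvdzP [f Ef] : (e %| c)%Z by rewrite dvdzE.
exists f; apply: (mulIf b0); rewrite Ec Ef Ee; ring.
Qed.

Lemma is_sq_sg q (a b : int) : prime q -> a != 0 -> b != 0 -> is_sq (a * b) -> sg q a = sg q b.
Proof.
move=> pq a0 b0 [c hc].
have c0 : c != 0 by apply: contra_neq (mulf_neq0 a0 b0) => cE; rewrite hc cE mul0r.
have h : xor3 (sg q a) (sg q b) = (false, false, false) by rewrite -sgM // hc -expr2 sg_sqr // sg1.
by rewrite -(xor3f (sg q a)) -h xor3A xor3ss xor3C xor3f.
Qed.

Lemma is_sq_sg3 q (a b c : int) : prime q -> a != 0 -> b != 0 -> c != 0 -> is_sq (a * b * c) ->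
  sg q a = xor3 (sg q b) (sg q c).
Proof.
by move=> pq a0 b0 c0 h; rewrite -sgM //; apply: is_sq_sg; rewrite ?mulf_neq0 // mulrA.
Qed.

Lemma is_sq_ge0 (a : int) : is_sq a -> 0 <= a.
Proof. by move=> [c ->]; rewrite -expr2 sqr_ge0. Qed.

Lemma is_sq_gt0 (a : int) : a != 0 -> is_sq a -> 0 < a.
Proof. by move=> a0 /is_sq_ge0; rewrite le_eqVlt eq_sym (negbTE a0). Qed.

Lemma sqfree_vo_eq (a b : int) : sqfree a -> sqfree b -> (forall q, prime q -> vo q a = vo q b) ->
  `|a|%N = `|b|%N.
Proof.
move=> sa sb h; apply: eqn_from_log; rewrite ?absz_gt0; try by [case: sa|case: sb].
move=> q /=; case pq : (prime q); last by rewrite lognE pq [RHS]lognE pq.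
have := h q pq; have := sqfree_vv pq sa; have := sqfree_vv pq sb.
by rewrite /vo /vv; do 2 case: (logn _ _) => [|[]].
Qed.

Lemma sqfree_eq (a b : int) : sqfree a -> sqfree b -> is_sq (a * b) -> a = b.
Proof.
move=> sa sb hab; have [a0 _] := sa; have [b0 _] := sb.
have E : `|a|%N = `|b|%N.
  by apply: sqfree_vo_eq => // q pq; have [] := is_sq_sg pq a0 b0 hab.
have := is_sq_gt0 (mulf_neq0 a0 b0) hab; move: E a0 b0; clear; nia.
Qed.

Lemma sqfree_dvd (a b : int) : sqfree b -> (a %| b)%Z -> sqfree a.
Proof.
move=> [b0 h] ab; split; first by apply: contraNneq b0 => aE; move: ab; rewrite aE dvd0z.
by move=> d hd; apply: h; apply: dvdn_trans hd _; rewrite dvdzE in ab.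
Qed.

Lemma sqfree_dvd_of_primes (a : int) (n : nat) : (0 < n)%N -> sqfree a ->
  (forall q, prime q -> vo q a -> (q %| n)%N) -> (a %| n%:Z)%Z.
Proof.
move=> n0 sa h; have [a0 _] := sa; rewrite dvdzE /=.
apply/dvdn_partP; rewrite ?absz_gt0 // => q hq.
have pq : prime q by move: hq; rewrite mem_primes => /andP [].
rewrite p_part pfactor_dvdn //; have := sqfree_vv pq sa; rewrite /vv.
case E : (logn q `|a|) => [|[|//]] // _.
rewrite -pfactor_dvdn // expn1; apply: h => //; by rewrite /vo /vv E.
Qed.

(** * Selmer groups through local square classes *)

Section Selmer.
Variables (e1 e2 e3 : int) (m : nat).
Hypotheses (sE : e1 + e2 + e3 = 0) (e1n : e1 < 0) (e20 : e2 != 0) (e3p : 0 < e3).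
Hypotheses (m0 : (0 < m)%N) (odd_m : odd m).
Hypotheses (a1 : two_exact e1) (a2 : two_exact e2).
Let M : int := m%:Z.

Lemma twist_sum : e1 * M + e2 * M + e3 * M = 0.
Proof. by rewrite -!mulrDl sE mul0r. Qed.
Lemma twist_e1 : e1 * M < 0. Proof. by rewrite pmulr_llt0. Qed.
Lemma twist_e3 : 0 < e3 * M. Proof. by rewrite pmulr_lgt0. Qed.
Lemma base_neq0 : [/\ e1 != 0, e2 != 0, e3 != 0 & M != 0].
Proof. by split=> //; [rewrite lt_eqF|rewrite gt_eqF|rewrite eqz_nat -lt0n]. Qed.
Lemma twist_neq0 : [/\ e1 * M != 0, e2 * M != 0 & e3 * M != 0].
Proof. by have [? ? ? ?] := base_neq0; rewrite !mulf_neq0. Qed.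

Lemma Sel2P (s : triple) : Sel2 e1 e2 e3 M s <->
  [/\ sqfree (t1 s) /\ sqfree (t2 s), sqfree (t3 s), is_sq (t1 s * t2 s * t3 s), 0 < t2 s &
      forall q, prime q -> LS q (e1 * M) (e2 * M) (e3 * M) (t1 s) (t2 s) (t3 s)].
Proof.
have [E10 E20 E30] := twist_neq0.
split.
  move=> [s1 [s2 [s3 [sq [hr hq]]]]].
  have [[d1 _] [d2 _] [d3 _]] := And3 s1 s2 s3.
  split=> //.
    apply: (real_solvable_forms twist_sum twist_e1 twist_e3 d2 _).1 hr.
    by apply: is_sq_gt0 => //; rewrite !mulf_neq0.
  by move=> q pq; apply: Qp_solvable_LS; rewrite // ?twist_sum //; exact: hq.
move=> [[s1 s2] s3 sq d2p hL].
have [[d1 _] [d2 _] [d3 _]] := And3 s1 s2 s3.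
do 4 split=> //; split.
  apply: (real_solvable_forms twist_sum twist_e1 twist_e3 d2 _).2 d2p.
  by apply: is_sq_gt0 => //; rewrite !mulf_neq0.
by move=> q pq; apply: LS_Qp_solvable => //; exact: hL.
Qed.

Lemma tors_neq0 t : t \in tors e1 e2 e3 M -> [/\ t1 t != 0, t2 t != 0 & t3 t != 0].
Proof.
have [z1 z2 z3 zM] := base_neq0.
rewrite /tors !inE => /or4P [] /eqP ->; rewrite /t1 /t2 /t3 /=; split=> //;
  by rewrite ?mulf_neq0 ?oppr_eq0.
Qed.

Lemma tors_sq t : t \in tors e1 e2 e3 M -> is_sq (t1 t * t2 t * t3 t).
Proof.
rewrite /tors !inE => /or4P [] /eqP ->; rewrite /t1 /t2 /t3 /=.
- by exists 1.
- by exists (e1 * e3 * M); ring.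
- by exists (e2 * e3 * M); ring.
- by exists (e1 * e2 * M); ring.
Qed.

Lemma tors_t2_gt0 t : t \in tors e1 e2 e3 M -> 0 < t2 t.
Proof.
have Mp : 0 < M by rewrite ltz_nat.
have ne1 : 0 < - e1 by rewrite oppr_gt0.
by rewrite /tors !inE => /or4P [] /eqP ->; rewrite /t2 //= mulr_gt0.
Qed.

(** Each nontrivial torsion class is a cyclic shift of the one in [LS_translate1], up to the square
    M^2. *)
Lemma LS_tors q t (d1 d2 d3 : int) : prime q -> t \in tors e1 e2 e3 M ->
  d1 != 0 -> d2 != 0 -> d3 != 0 -> sg q d1 = xor3 (sg q d2) (sg q d3) ->
  LS q (e1 * M) (e2 * M) (e3 * M) d1 d2 d3 ->
  LS q (e1 * M) (e2 * M) (e3 * M) (t1 t * d1) (t2 t * d2) (t3 t * d3).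
Proof.
move=> pq ht d10 d20 d30 hp hL.
have [E10 E20 E30] := twist_neq0; have [z1 z2 z3 zM] := base_neq0.
have sumE := twist_sum.
have sumE2 : e2 * M + e3 * M + e1 * M = 0 by rewrite -sumE; ring.
have sumE3 : e3 * M + e1 * M + e2 * M = 0 by rewrite -sumE; ring.
have hp2 := xor3_rot hp; have hp3 := xor3_rot hp2.
have S (a b d : int) : a != 0 -> b != 0 -> d != 0 -> sg q (- (a * M) * (b * M) * d) = sg q (- a * b * d).
  move=> *; rewrite (_ : _ * d = - a * b * d * M ^+ 2); last by ring.
  by rewrite sgMsqr // !mulf_neq0 // oppr_eq0.
move: ht; rewrite /tors !inE => /or4P [] /eqP ->; rewrite /t1 /t2 /t3 /=.
- by rewrite !mul1r.
- do 2 apply: LS_cycle; have := LS_translate1 pq sumE2 E20 E30 E10 d20 d30 d10 hp2 (LS_cycle hL).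
  apply: LS_sg => //; last by rewrite -mulNr.
  by rewrite S // (_ : - e3 * e1 = - e1 * e3) //; ring.
- have := LS_translate1 pq sumE E10 E20 E30 d10 d20 d30 hp hL.
  by apply: LS_sg => //; [rewrite S|rewrite -mulNr].
- apply: LS_cycle; have := LS_translate1 pq sumE3 E30 E10 E20 d30 d10 d20 hp3 (LS_cycle (LS_cycle hL)).
  by apply: LS_sg => //; [rewrite S|rewrite -mulNr].
Qed.

Lemma Sel2_translate s t : Sel2 e1 e2 e3 M s -> t \in tors e1 e2 e3 M ->
  exists2 r, Sel2 e1 e2 e3 M r &
    [/\ is_sq (t1 t * t1 s * t1 r), is_sq (t2 t * t2 s * t2 r) & is_sq (t3 t * t3 s * t3 r)].
Proof.
move=> /Sel2P [[s1 s2] s3 sq d2p hL] ht.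
have [[d10 _] [d20 _] [d30 _]] := And3 s1 s2 s3.
have [t10 t20 t30] := tors_neq0 ht.
have [r1 q1 h1] := sqfree_rep (mulf_neq0 t10 d10).
have [r2 q2 h2] := sqfree_rep (mulf_neq0 t20 d20).
have [r3 q3 h3] := sqfree_rep (mulf_neq0 t30 d30).
have [[r10 _] [r20 _] [r30 _]] := And3 q1 q2 q3.
exists (r1, r2, r3); last by [].
apply/Sel2P; rewrite /t1 /t2 /t3 /= -/(t1 _) -/(t2 _) -/(t3 _); split=> //.
- apply: (@is_sq_cancel _ ((t1 t * t2 t * t3 t) * (t1 s * t2 s * t3 s))).
  + by rewrite !mulf_neq0.
  + exact: is_sqM (tors_sq ht) sq.
  + have := is_sqM (is_sqM h1 h2) h3.
    by rewrite (_ : _ * (t3 t * t3 s * r3) = r1 * r2 * r3 * (t1 t * t2 t * t3 t * (t1 s * t2 s * t3 s))) //; ring.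
- have := is_sq_gt0 (mulf_neq0 (mulf_neq0 t20 d20) r20) h2.
  by rewrite pmulr_rgt0 // mulr_gt0 // tors_t2_gt0.
- move=> q pq; have hp := is_sq_sg3 pq d10 d20 d30 sq.
  by apply: LS_sg (LS_tors pq ht d10 d20 d30 hp (hL q pq)); apply: is_sq_sg; rewrite ?mulf_neq0.
Qed.

Lemma vo2_M : vo 2 M = false.
Proof. by rewrite /vo vv_unit // dvdzE /= dvdn2 odd_m. Qed.

Lemma vo2_tors : [/\ vo 2 e1 = true, vo 2 e2 = true & forall a : int, vo 2 (- a) = vo 2 a].
Proof.
have [[? ?] [? ?]] := (a1, a2).
by rewrite /vo !vv2_two_exact //; split=> // a; rewrite /vv abszN.
Qed.

(** With c the parity of the 2-adic valuation of e3, the parities of (d2, d3) along [tors] are (0,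
    0), (1+c, 1), (c, 1), (1, 0) mod 2, which are distinct for either c. *)
Lemma tors_vo2_inj t t' : t \in tors e1 e2 e3 M -> t' \in tors e1 e2 e3 M ->
  vo 2 (t2 t) = vo 2 (t2 t') -> vo 2 (t3 t) = vo 2 (t3 t') -> t = t'.
Proof.
have [z1 z2 z3 zM] := base_neq0; have [v1 v2 vN] := vo2_tors.
have V (x y : int) : x != 0 -> y != 0 -> vo 2 (x * y) = vo 2 x (+) vo 2 y by move=> *; exact: voM.
have v11 : vo 2 1 = false by [].
rewrite /tors !inE => /or4P [] /eqP -> /or4P [] /eqP -> //; rewrite /t2 /t3 /=;
  by rewrite ?mulNr ?vN ?V // ?v1 ?v2 ?vo2_M ?v11; case: (vo 2 e3).
Qed.

Lemma tors_vo2_full (b c : bool) : exists2 t, t \in tors e1 e2 e3 M & vo 2 (t2 t) = b /\ vo 2 (t3 t) = c.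
Proof.
have [z1 z2 z3 zM] := base_neq0; have [v1 v2 vN] := vo2_tors.
have V (x y : int) : x != 0 -> y != 0 -> vo 2 (x * y) = vo 2 x (+) vo 2 y by move=> *; exact: voM.
have T1 : (- e3 * M, - e1 * e3, e1 * M) \in tors e1 e2 e3 M by rewrite !inE eqxx orbT.
have T2 : (- e2 * e3, e3 * M, - e2 * M) \in tors e1 e2 e3 M by rewrite !inE eqxx !orbT.
have T3 : (e2 * M, - e1 * M, - e1 * e2) \in tors e1 e2 e3 M by rewrite !inE eqxx !orbT.
have T0 : (1, 1, 1) \in tors e1 e2 e3 M by rewrite !inE eqxx.
case: c; last first.
  case: b; last by exists (1, 1, 1).
  by exists (e2 * M, - e1 * M, - e1 * e2) => //; rewrite /t2 /t3 /= !mulNr !vN !V // v1 v2 vo2_M.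
case: (boolP (vo 2 e3 == b)) => [/eqP <-|nb].
  by exists (- e2 * e3, e3 * M, - e2 * M) => //; rewrite /t2 /t3 /= !mulNr !vN !V // v2 vo2_M addbF.
exists (- e3 * M, - e1 * e3, e1 * M) => //; rewrite /t2 /t3 /= !mulNr !vN !V // v1 vo2_M.
by move: nb; case: (vo 2 e3); case: b.
Qed.

Lemma Sel2_one : Sel2 e1 e2 e3 M (1, 1, 1).
Proof.
have s1 : sqfree 1 by split=> // d; rewrite dvdn1 => /eqP; case: d => [|[|d]] //; rewrite expnS; lia.
apply/Sel2P; split=> //; first by exists 1.
by move=> q pq; exact: LS_const.
Qed.

End Selmer.

(** Otherwise s, the trivial class and classes with the three remaining parity pairs would be five
    elements with distinct images in a group of order 4. *)
Lemma Sel2_iso_trivial (e1 e2 e3 : int) s : e1 + e2 + e3 = 0 -> e1 < 0 -> e2 != 0 -> 0 < e3 ->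
  two_exact e1 -> two_exact e2 ->
  Sel2_iso_Z2sq e1 e2 e3 1 -> Sel2 e1 e2 e3 1 s ->
  vo 2 (t2 s) = false -> vo 2 (t3 s) = false -> s = (1, 1, 1).
Proof.
move=> sE e1n e20 e3p a1 a2 [f [_ [finj _]]] Ss v2 v3; apply: contrapT => s1.
have ex (b c : bool) : exists2 r, Sel2 e1 e2 e3 1 r & vo 2 (t2 r) = b /\ vo 2 (t3 r) = c.
  have [t ht [h2 h3]] := tors_vo2_full e1n e20 e3p (isT : (0 < 1)%N) (isT : odd 1) a1 a2 b c.
  have S1 := Sel2_one sE e1n e20 e3p (isT : (0 < 1)%N).
  have [r Sr [_ q2 q3]] := Sel2_translate sE e1n e20 e3p (isT : (0 < 1)%N) S1 ht.
  exists r => //; have [_ t20 t30] := tors_neq0 e1n e20 e3p (isT : (0 < 1)%N) ht.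
  have [_ [[r20 _] [[r30 _] _]]] := Sr.
  rewrite !mulr1 in q2 q3.
  have [<- _ _] := is_sq_sg (isT : prime 2) t20 r20 q2.
  by have [<- _ _] := is_sq_sg (isT : prime 2) t30 r30 q3.
have [r1 S1 [p1 o1]] := ex false true; have [r2 S2 [p2 o2]] := ex true false; have [r3 S3 [p3 o3]] := ex true true.
have S0 := Sel2_one sE e1n e20 e3p (isT : (0 < 1)%N).
have D x y : Sel2 e1 e2 e3 1 x -> Sel2 e1 e2 e3 1 y -> x <> y -> f x != f y.
  by move=> Sx Sy xy; apply/eqP => /finj h; apply: xy; exact: h.
have : uniq [seq f x | x <- [:: s; (1, 1, 1); r1; r2; r3]].
  have P x y : (vo 2 (t2 x), vo 2 (t3 x)) <> (vo 2 (t2 y), vo 2 (t3 y)) -> x <> y by move=> + h; rewrite h.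
  by rewrite /= !inE !negb_or !D //; apply: P; rewrite ?v2 ?v3 ?p1 ?o1 ?p2 ?o2 ?p3 ?o3.
move=> /card_uniqP h; have := max_card (mem [seq f x | x <- [:: s; (1, 1, 1); r1; r2; r3]]).
by rewrite h card_mx card_Fp.
Qed.

(** * Residue symbols over F_2 *)

Lemma F2_addb (b c : bool) : (b%:R + c%:R : 'F_2) = (b (+) c)%:R.
Proof. by apply/val_inj; case: b; case: c. Qed.

Lemma F2_andb (b c : bool) : (b%:R * c%:R : 'F_2) = (b && c)%:R.
Proof. by apply/val_inj; case: b; case: c. Qed.

Lemma F2_eq0 (b : bool) : (b%:R == 0 :> 'F_2) = ~~ b.
Proof. by case: b. Qed.

Lemma F2_neq0 (x : 'F_2) : x = (x != 0)%:R.
Proof. by case: x => [[|[|x]] Hx] //; apply/val_inj. Qed.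

Lemma F2_sum (I : finType) (b : I -> bool) :
  (\sum_i (b i)%:R : 'F_2) = (\big[addb/false]_i b i)%:R.
Proof. by rewrite (big_morph (fun b : bool => b%:R : 'F_2) (fun b c => esym (F2_addb b c)) (erefl : (false : nat)%:R = 0)). Qed.

Lemma nqrE (u : int) q : prime q -> odd q -> ~~ (q%:Z %| u)%Z -> nqr u q = (nr q u)%:R.
Proof.
move=> pq oq nu; rewrite /nqr.
case: ifP => [/existsP [x hx]|nE].
  suff -> : nr q u = false by [].
  have nx : ~~ (q%:Z %| x%:Z)%Z.
    apply: contra nu => hx'; have h2 : (q%:Z %| (x : nat)%:Z ^+ 2)%Z by rewrite expr2 dvdz_mulr.
    by have := rpredB h2 hx; rewrite opprB addrC subrK.
  by rewrite -(nr_eqmod pq hx) nr_sqr.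
case h : (nr q u) => //.
have [|y [_ hy]] := nr_sqr_ex pq oq nu; first by rewrite h.
case/negP: (negbT nE); apply/existsP.
have lt : (`|(y %% q%:Z)%Z| < q)%N.
  have q0 : q%:Z != 0 by rewrite eqz_nat -lt0n prime_gt0.
  by rewrite -ltz_nat gez0_abs ?modz_ge0 // ltz_mod.
have q0 : q%:Z != 0 by rewrite eqz_nat -lt0n prime_gt0.
exists (Ordinal lt) => /=; rewrite gez0_abs ?modz_ge0 //.
have : (q%:Z %| (y %% q%:Z)%Z ^+ 2 - y ^+ 2)%Z.
  by rewrite subr_sqr dvdz_mulr // -eqz_mod_dvd modz_mod.
by move=> h1; have := rpredD h1 hy; rewrite addrA subrK.
Qed.

Lemma diagq3 (a b c : int) (x : 'I_3 -> int) :
  diagq [tuple a; b; c] x = a * x (@Ordinal 3 0 isT) ^+ 2 + b * x (@Ordinal 3 1 isT) ^+ 2 + c * x (@Ordinal 3 2 isT) ^+ 2.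
Proof.
rewrite /diagq !big_ord_recl big_ord0 !(tnth_nth 0) /= addr0 !addrA !intz.
by congr (_ + _ + _); congr (_ * x _ ^+ 2); apply: val_inj.
Qed.

Lemma ord3P (i : 'I_3) : [\/ i = @Ordinal 3 0 isT, i = @Ordinal 3 1 isT | i = @Ordinal 3 2 isT].
Proof.
by case: i => [[|[|[|i]]] Hi] //; [constructor 1|constructor 2|constructor 3]; apply: val_inj.
Qed.

Lemma hilb_iff q (a b : int) (P : bool) : (Qp_solvable q [:: [tuple a; b; -1]] <-> ~~ P) -> hilb q a b = P%:R.
Proof.
rewrite /hilb => h; case: asboolP => [/h /negbTE -> //|nh].
by case: P h nh => // h nh; case: nh; apply/h.
Qed.

Lemma Qp_solvable3 q (a b : int) : prime q ->
  (forall K, exists w0 w1 w2 : int,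
     ((q ^ K)%N%:Z %| a * w0 ^+ 2 + b * w1 ^+ 2 - w2 ^+ 2)%Z /\ (w0 = 1 \/ w1 = 1)) ->
  Qp_solvable q [:: [tuple a; b; -1]].
Proof.
move=> pq H; apply: Qp_solvable_approx => // K; have [w0 [w1 [w2 [hw h1]]]] := H K.
have n1 : ~~ (q%:Z %| 1)%Z by rewrite dvdzE /= dvdn1 neq_ltn prime_gt1 ?orbT.
exists (fun i => tnth [tuple w0; w1; w2] i); split.
  by case: h1 => E; [exists (@Ordinal 3 0 isT)|exists (@Ordinal 3 1 isT)]; rewrite (tnth_nth 0) /= E.
move=> f; rewrite inE => /eqP ->; rewrite diagq3 !(tnth_nth 0) /= mulN1r.
exact: hw.
Qed.

Lemma hensel_unit q (u : int) K : prime q -> odd q -> ~~ (q%:Z %| u)%Z -> nr q u = false ->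
  exists c : int, ((q ^ K)%N%:Z %| c ^+ 2 - u)%Z /\ ~~ (q%:Z %| c)%Z.
Proof.
move=> pq oq nu hu; have [c [nc hc]] := hensel_odd K pq oq nu hu.
by exists c; split=> //; apply: dvdz_powW hc.
Qed.

Lemma nr_of_sqr_cong q (u x y : int) : prime q -> odd q -> ~~ (q%:Z %| u)%Z -> ~~ (q%:Z %| x)%Z ->
  (q%:Z %| y ^+ 2 - u * x ^+ 2)%Z -> nr q u = false.
Proof.
move=> pq oq nu nx h.
have nux : ~~ (q%:Z %| u * x ^+ 2)%Z by rewrite Euclid_dvdzM // Euclid_dvdzX // (negbTE nu) (negbTE nx).
have ny : ~~ (q%:Z %| y)%Z.
  apply: contra nux => hy; have h2 : (q%:Z %| y ^+ 2)%Z by rewrite Euclid_dvdzX // hy.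
  by have := rpredB h2 h; rewrite opprB addrC subrK.
have := nr_eqmod pq h; rewrite nr_sqr // nrM // ?Euclid_dvdzX ?(negbTE nx) // nr_sqr // addbF.
by move=> <-.
Qed.

(** Precision q^2 decides: if a is a non-residue, q divides x0 and x2, hence q^2 divides b x1^2, and
    q divides x1 because b has valuation 1, against primitivity. *)
Lemma hilb_unit q (a b : int) : prime q -> odd q -> ~~ (q%:Z %| a)%Z -> vv q b = 1%N -> b != 0 ->
  hilb q a b = (nr q a)%:R.
Proof.
move=> pq oq na vb b0; apply: hilb_iff; split.
  move=> [x [/(_ 2) [i xi] [/(_ 2 _ (mem_head _ _)) + _]]].
  rewrite diagq3 mulN1r; move: (x 2) xi => {}x xi.
  set x0 := x _; set x1 := x _; set x2 := x _ => h.
  have qb : (q%:Z %| b)%Z by have := @vv_ge q b 1 pq b0; rewrite vb expn1 => <-.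
  have h1 : (q%:Z %| a * x0 ^+ 2 + b * x1 ^+ 2 - x2 ^+ 2)%Z.
    by apply: dvdz_trans h; rewrite expnS PoszM dvdz_mulr.
  have h2 : (q%:Z %| x2 ^+ 2 - a * x0 ^+ 2)%Z.
    have h3 : (q%:Z %| b * x1 ^+ 2)%Z by rewrite dvdz_mulr.
    by have := rpredB h3 h1; rewrite (_ : _ - _ = x2 ^+ 2 - a * x0 ^+ 2) //; ring.
  case: (boolP (q%:Z %| x0)%Z) => [d0|n0]; last by rewrite (nr_of_sqr_cong pq oq na n0 h2).
  have d0' : (q%:Z %| a * x0 ^+ 2)%Z by rewrite dvdz_mull // expr2 dvdz_mulr.
  have d2 : (q%:Z %| x2)%Z.
    by have := rpredD h2 d0'; rewrite subrK Euclid_dvdzX // andbT.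
  have d1 : (q%:Z %| x1)%Z.
    have qq (y : int) : (q%:Z %| y)%Z -> ((q ^ 2)%N%:Z %| y ^+ 2)%Z.
      by move=> hy; rewrite expr2 expnS expn1 PoszM dvdz_mul.
    have : ((q ^ 2)%N%:Z %| b * x1 ^+ 2)%Z.
      have k0 : ((q ^ 2)%N%:Z %| a * x0 ^+ 2)%Z by rewrite dvdz_mull // qq.
      by have := rpredB (rpredD h (qq _ d2)) k0; rewrite subrK addrC addKr.
    apply: contraLR => n1; have x10 := ndvdzW n1.
    by rewrite -vv_ge ?mulf_neq0 ?expf_neq0 // expr2 !vvM ?mulf_neq0 // vb (vv_unit n1).
  by case/negP: xi; case: (ord3P i) => ->.
move=> /negbTE ha; apply: Qp_solvable3 => // K.
have [c [hc _]] := hensel_unit K pq oq na ha; exists 1, 0, c; split; last by left.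
rewrite (_ : a * 1 ^+ 2 + b * 0 ^+ 2 - c ^+ 2 = - (c ^+ 2 - a)); last by ring.
by rewrite rpredN.
Qed.

(** The equation forces q to divide x2; divided by q it reads x0^2 = -u x1^2 mod q, with u the unit
    part of b. *)
Lemma hilb_uniformizer q (b : int) : prime q -> odd q -> vv q b = 1%N -> b != 0 ->
  hilb q q%:Z b = (nr q (- up q b))%:R.
Proof.
move=> pq oq vb b0; have nu := up_ndvd pq b0; have nNu : ~~ (q%:Z %| - up q b)%Z by rewrite rpredN.
have q0 : q%:Z != 0 by rewrite eqz_nat -lt0n prime_gt0.
have Eb : b = q%:Z * up q b by rewrite {1}(upE q b) vb expn1.
apply: hilb_iff; split.
  move=> [x [/(_ 2) [i xi] [/(_ 2 _ (mem_head _ _)) + _]]].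
  rewrite diagq3 mulN1r; move: (x 2) xi => {}x xi.
  set x0 := x _; set x1 := x _; set x2 := x _; rewrite expnS expn1 PoszM => h.
  have d2 : (q%:Z %| x2)%Z.
    have h1 := dvdz_trans (dvdz_mulr _ (dvdzz _)) h.
    have h2 : (q%:Z %| q%:Z * x0 ^+ 2 + b * x1 ^+ 2)%Z by rewrite Eb -mulrA -mulrDr dvdz_mulr.
    by have := rpredB h2 h1; rewrite opprB addrC subrK Euclid_dvdzX // andbT.
  have h2 : (q%:Z %| x0 ^+ 2 - - up q b * x1 ^+ 2)%Z.
    have h3 : (q%:Z * q%:Z %| x2 ^+ 2)%Z by rewrite expr2 dvdz_mul.
    have := rpredD h h3; have Ebx : b * x1 ^+ 2 = q%:Z * (up q b * x1 ^+ 2) by rewrite {1}Eb mulrA.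
    rewrite subrK Ebx -mulrDr dvdz_mul2l //.
    by rewrite mulNr opprK.
  case: (boolP (q%:Z %| x1)%Z) => [d1|n1]; last by rewrite (nr_of_sqr_cong pq oq nNu n1 h2).
  have d1' : (q%:Z %| - up q b * x1 ^+ 2)%Z by rewrite dvdz_mull // expr2 dvdz_mulr.
  have d0 : (q%:Z %| x0)%Z by have := rpredD h2 d1'; rewrite subrK Euclid_dvdzX // andbT.
  by case/negP: xi; case: (ord3P i) => ->.
move=> /negbTE ha; apply: Qp_solvable3 => // K.
have [c [hc _]] := hensel_unit K pq oq nNu ha; exists c, 1, 0; split; last by right.
rewrite Eb (_ : q%:Z * c ^+ 2 + q%:Z * up q b * 1 ^+ 2 - 0 ^+ 2 = q%:Z * (c ^+ 2 - - up q b)); last by ring.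
by rewrite dvdz_mull.
Qed.

(** * Descent to the untwisted curve *)

Lemma pstar_cases g : pstar g = g%:Z \/ pstar g = - g%:Z.
Proof. by rewrite /pstar; case: ifP; [left|right]. Qed.

Lemma pstar1 : pstar 1 = 1. Proof. by []. Qed.

Lemma absz_pstar g : `|pstar g|%N = g.
Proof. by case: (pstar_cases g) => ->; rewrite ?abszN. Qed.

Lemma pstar_mod4 g : odd g -> (pstar g == 1 %[mod 4])%Z.
Proof. by rewrite /pstar; case: ifP; lia. Qed.

Lemma pstar_of_mod4 (a : int) : (a == 1 %[mod 4])%Z -> a = pstar `|a|.
Proof. by rewrite /pstar; case: ifP; lia. Qed.

Lemma pstar_neq0 g : odd g -> pstar g != 0.
Proof. by move=> og; rewrite -absz_gt0 absz_pstar; case: g og. Qed.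

Lemma pstarM a b : odd a -> odd b -> pstar (a * b) = pstar a * pstar b.
Proof.
move=> oa ob; rewrite /pstar PoszM -modnMm.
have [ha hb] : ((a %% 4 = 1 \/ a %% 4 = 3) /\ (b %% 4 = 1 \/ b %% 4 = 3))%N by lia.
by case: ha => ->; case: hb => -> /=; rewrite ?mulNr ?mulrN ?opprK.
Qed.

Lemma ep_odd (a : int) : ~~ (2 %| a)%Z -> ep a = ((a %% 4)%Z == 3).
Proof. by move=> na; rewrite /ep up_unit. Qed.

Lemma ep_pstar g : odd g -> ep (pstar g) = false.
Proof.
move=> og; have h := pstar_mod4 og; rewrite ep_odd //; first by move: h; lia.
by rewrite dvdzE /= absz_pstar dvdn2 og.
Qed.

Lemma vv_pstar q g : vv q (pstar g) = vv q g%:Z.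
Proof. by rewrite /vv absz_pstar. Qed.

Lemma odd_dvd (a b : nat) : odd b -> (a %| b)%N -> odd a.
Proof. by move=> ob /dvdnP [c E]; move: ob; rewrite E oddM => /andP []. Qed.

(** An abstract [F], multiplicative on odd numbers, so that the induction serves both for the
    inclusion of the naturals and for [pstar]. *)
Lemma sg_mult_ind r (F : nat -> int) g : prime r -> odd g ->
  F 1%N = 1 -> (forall a, odd a -> F a != 0) ->
  (forall a b, odd a -> odd b -> F (a * b)%N = F a * F b) ->
  (forall q, prime q -> (q %| g)%N -> sg r (F q) = sg r 1) -> sg r (F g) = sg r 1.
Proof.
move=> pr og F1 F0 FM; elim/ltn_ind: g og => g IH og H.
case: (ltngtP g 1) => [|g1|->]; [by case: g og {IH H}|idtac|by rewrite F1].
have E : g = (pdiv g * (g %/ pdiv g))%N by rewrite mulnC divnK // pdiv_dvd.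
have pg := pdiv_prime g1.
have [o1 o2] : odd (pdiv g) /\ odd (g %/ pdiv g).
  by move: og; rewrite {1}E oddM => /andP [].
have IHq : sg r (F (g %/ pdiv g)%N) = sg r 1.
  apply: IH => //; first by rewrite ltn_Pdiv ?prime_gt1 // ltnW.
  by move=> q pq hq; apply: H => //; apply: dvdn_trans hq _; rewrite [X in (_ %| X)%N]E dvdn_mull.
by rewrite E FM // sgM ?F0 // H ?pdiv_dvd // IHq xor3ss sg1.
Qed.

(** Multiplying X_i and t by M absorbs the twist, as e (M t)^2 = M (e M t^2), and M is a square at
    q. *)
Lemma LS_untwist q (e1 e2 e3 M d1 d2 d3 : int) : prime q -> M != 0 -> sg q M = sg q 1 ->
  LS q (e1 * M) (e2 * M) (e3 * M) d1 d2 d3 -> LS q e1 e2 e3 d1 d2 d3.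
Proof.
move=> pq M0 sM [X1 [X2 [X3 [t [[x1 x2 x3] [[k1 k2 k3] [s1 s2 s3]]]]]]].
exists (M * X1), (M * X2), (M * X3), (M * t); split; first by rewrite !mulf_neq0.
split; first by split; [rewrite k1|rewrite k2|rewrite k3]; ring.
by rewrite !sgM // sM sg1 // !(xor3C (_, _, _)) !xor3f.
Qed.

Lemma vo_sqfree q (a : int) : prime q -> sqfree a -> vo q a = (q%:Z %| a)%Z.
Proof.
move=> pq sa; have [a0 _] := sa; have := sqfree_vv pq sa.
have := @vv_ge q a 1 pq a0; rewrite expn1 => <-; rewrite /vo.
by case: (vv q a) => [|[]].
Qed.

Lemma xor3_mix a b c d : xor3 (xor3 a b) (xor3 (xor3 c a) (xor3 d b)) = xor3 c d.
Proof.
have B (x y z w : bool) : x (+) y (+) (z (+) x (+) (w (+) y)) = z (+) w.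
  by case: x; case: y; case: z; case: w.
by rewrite /xor3 /= !B.
Qed.

Section Descent.
Variables (e1 e2 e3 : int) (n : nat).
Hypotheses (sE : e1 + e2 + e3 = 0) (e1n : e1 < 0) (e20 : e2 != 0) (e3p : 0 < e3).
Hypotheses (a1 : two_exact e1) (a2 : two_exact e2) (a3 : (4 %| e3)%Z).
Hypotheses (odd_n : odd n) (n0 : (0 < n)%N) (sqn : sqfree n%:Z) (cop : coprimez n%:Z (e1 * e2 * e3)).
Hypothesis hres : forall q r : nat, prime q -> (q %| n)%N -> prime r -> odd r ->
  (r%:Z %| e1 * e2 * e3)%Z -> nqr q%:Z r = 0.
Hypothesis hstar : forall q r : nat, prime q -> (q %| n)%N -> prime r -> odd r ->
  (r%:Z %| e1 * e3)%Z -> nqr (pstar q) r = 0.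

Lemma n_e_ndvd q : prime q -> (q %| n)%N -> ~~ (q%:Z %| e1 * e2 * e3)%Z.
Proof.
move=> pq qn; apply/negP => qe; move: cop; rewrite /coprimez /gcdz eqz_nat /= => /eqP h.
have : (q %| gcdn n `|(e1 * e2 * e3)%R|)%N by rewrite dvdn_gcd qn; move: qe; rewrite dvdzE.
by rewrite h dvdn1 => /eqP q1; rewrite q1 in pq.
Qed.

Lemma n_e_ndvd3 q : prime q -> (q %| n)%N ->
  [/\ ~~ (q%:Z %| e1)%Z, ~~ (q%:Z %| e2)%Z & ~~ (q%:Z %| e3)%Z].
Proof. by move=> pq /(n_e_ndvd pq); rewrite !Euclid_dvdzM // !negb_or -andbA => /and3P. Qed.

Lemma bad_ndvd_n r g : prime r -> (r%:Z %| e1 * e2 * e3)%Z -> (g %| n)%N -> ~~ (r%:Z %| g%:Z)%Z.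
Proof.
by move=> pr re gn; apply/negP; rewrite dvdzE /= => rg; case/negP: (n_e_ndvd pr (dvdn_trans rg gn)).
Qed.

Lemma nqr0_sg (u : int) r : prime r -> odd r -> ~~ (r%:Z %| u)%Z -> nqr u r = 0 -> sg r u = sg r 1.
Proof.
move=> pr or nu; rewrite nqrE // => /eqP; rewrite F2_eq0 => /negbTE h.
by rewrite sg_int_unit // h sg1.
Qed.

Lemma sg_dvd_n r g : prime r -> odd r -> (r%:Z %| e1 * e2 * e3)%Z -> (g %| n)%N -> sg r g%:Z = sg r 1.
Proof.
move=> pr or re gn; apply: (sg_mult_ind (F := Posz)) => //.
- exact: odd_dvd gn.
- by case.
- move=> q pq qg; have qn := dvdn_trans qg gn.
  by apply: nqr0_sg => //; [exact: bad_ndvd_n re _|exact: hres].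
Qed.

Lemma sg_pstar_dvd_n r g : prime r -> odd r -> (r%:Z %| e1 * e3)%Z -> (g %| n)%N -> sg r (pstar g) = sg r 1.
Proof.
move=> pr or re gn; apply: sg_mult_ind => //.
- exact: odd_dvd gn.
- exact: pstar_neq0.
- exact: pstarM.
- move=> q pq qg; have qn := dvdn_trans qg gn.
  have re' : (r%:Z %| e1 * e2 * e3)%Z by rewrite mulrAC dvdz_mulr.
  apply: nqr0_sg => //; last exact: hstar.
  by have := bad_ndvd_n pr re' qn; rewrite !dvdzE absz_pstar.
Qed.

(** If r divides e1 e3, both factors are squares at r; otherwise r divides only e2, [pstar g3] has
    the class of 1 or -1, and [LS_twist] covers -1. It is used both to strip the n-part of a Selmer
    element and, from the trivial triple, to build one. *)
Lemma LS_mul_norm r (M c1 d1 d2 d3 : int) g2 g3 : prime r -> odd r -> (r%:Z %| e1 * e2 * e3)%Z ->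
  M != 0 -> ~~ (r%:Z %| M)%Z ->
  (g2 %| n)%N -> (g3 %| n)%N -> c1 != 0 -> d1 != 0 -> d2 != 0 -> d3 != 0 ->
  sg r c1 = xor3 (sg r g2%:Z) (sg r (pstar g3)) ->
  sg r d1 = xor3 (sg r d2) (sg r d3) ->
  LS r (e1 * M) (e2 * M) (e3 * M) d1 d2 d3 ->
  LS r (e1 * M) (e2 * M) (e3 * M) (c1 * d1) (g2%:Z * d2) (pstar g3 * d3).
Proof.
move=> pr or re M0 nM h2 h3 c10 d10 d20 d30 hc hd hL.
have g20 : g2%:Z != 0 by rewrite eqz_nat -lt0n; exact: dvdn_gt0 h2.
have og3 := odd_dvd odd_n h3; have p30 := pstar_neq0 og3.
have s2 : sg r g2%:Z = sg r 1 by exact: sg_dvd_n.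
have triv : sg r (pstar g3) = sg r 1 -> LS r (e1 * M) (e2 * M) (e3 * M) (c1 * d1) (g2%:Z * d2) (pstar g3 * d3).
  move=> s3; rewrite s2 s3 xor3ss -(sg1 pr) in hc.
  by apply: LS_sg hL; rewrite sgM // ?hc ?s2 ?s3 sg1 // xor3C xor3f.
case: (boolP (r%:Z %| e1 * e3)%Z) => [r13|n13]; first by apply: triv; exact: sg_pstar_dvd_n.
case: (pstar_cases g3) => E3; first by apply: triv; rewrite E3; exact: sg_dvd_n.
move: n13; rewrite Euclid_dvdzM // negb_or => /andP [n1 n3].
have r2 : (r%:Z %| e2)%Z by move: re; rewrite !Euclid_dvdzM // (negbTE n1) (negbTE n3) orbF.
have s3 : sg r (pstar g3) = sg r (-1).
  rewrite E3 sgN ?eqz_nat -?lt0n ?(dvdn_gt0 n0 h3) //.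
  by rewrite (sg_dvd_n pr or re h3) sg1 // xor3f.
have hc' : sg r c1 = sg r (-1) by rewrite hc s2 s3 sg1 // xor3C xor3f.
have tw : LS r (e1 * M) (e2 * M) (e3 * M) (- d1) d2 (- d3).
  apply: LS_twist => //; rewrite ?mulf_neq0 ?Euclid_dvdzM ?negb_or ?n1 ?n3 //.
  - by rewrite -!mulrDl sE mul0r.
  - by rewrite r2.
by apply: LS_sg tw; rewrite ?(sgN pr d10) ?(sgN pr d30) sgM // ?hc' ?s3 // s2 sg1 // xor3C xor3f.
Qed.

Lemma bad_or_good r : prime r ->
  (r%:Z %| e1 * e2 * e3)%Z || [&& ~~ (r%:Z %| e1)%Z, ~~ (r%:Z %| e2)%Z & ~~ (r%:Z %| e3)%Z].
Proof. by move=> pr; rewrite !Euclid_dvdzM //; do 3 case: (_ \in _). Qed.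

Lemma ndvd4_twist (e : int) : ~~ (4 %| e)%Z -> ~~ (4 %| e * n%:Z)%Z.
Proof.
have c4 : coprime (2 ^ 2) n by rewrite coprimeXl // coprime2n.
by rewrite Gauss_dvdzl // /coprimez /gcdz eqz_nat.
Qed.

Lemma descent s : Sel2_iso_Z2sq e1 e2 e3 1 -> Sel2 e1 e2 e3 n%:Z s ->
  vo 2 (t2 s) = false -> vo 2 (t3 s) = false ->
  [/\ (t1 s %| n%:Z)%Z, (t2 s %| n%:Z)%Z, (t3 s %| n%:Z)%Z & (t3 s == 1 %[mod 4])%Z].
Proof.
move=> iso /(Sel2P sE e1n e20 e3p n0) [[s1 s2] s3 sq d2p hL] v2 v3.
have [[d10 _] [d20 _] [d30 _]] := And3 s1 s2 s3.
have nz : n%:Z != 0 by rewrite eqz_nat -lt0n.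
have [[E10 E20 E30] [b1 b2 b3 _]] := (twist_neq0 e1n e20 e3p n0, base_neq0 e1n e20 e3p n0).
have hp q pq : sg q (t1 s) = xor3 (sg q (t2 s)) (sg q (t3 s)) := is_sq_sg3 pq d10 d20 d30 sq.
(* The parts supported on n; square-freeness makes the valuations of the cofactors at the primes of
   n even ([copr] below). *)
pose g2 := gcdn `|t2 s| n; pose g3 := gcdn `|t3 s| n.
have [g2n g3n] : (g2 %| n)%N /\ (g3 %| n)%N by rewrite !dvdn_gcdr.
have [og2 og3] := conj (odd_dvd odd_n g2n) (odd_dvd odd_n g3n).
have g20 : g2%:Z != 0 by rewrite eqz_nat -lt0n (dvdn_gt0 n0).
have p30 := pstar_neq0 og3.
have [c2 Ec2] : exists c2, t2 s = c2 * g2%:Z by apply/dvdzP; rewrite dvdzE /= dvdn_gcdl.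
have [c3 Ec3] : exists c3, t3 s = c3 * pstar g3 by apply/dvdzP; rewrite dvdzE absz_pstar dvdn_gcdl.
have c20 : c2 != 0 by apply: contraNneq d20 => h; rewrite Ec2 h mul0r.
have c30 : c3 != 0 by apply: contraNneq d30 => h; rewrite Ec3 h mul0r.
have sc2 : sqfree c2 by apply: (sqfree_dvd s2); rewrite Ec2 dvdz_mulr.
have sc3 : sqfree c3 by apply: (sqfree_dvd s3); rewrite Ec3 dvdz_mulr.
have c2p : 0 < c2 by move: d2p; rewrite Ec2 pmulr_lgt0 // ltz_nat (dvdn_gt0 n0).
(* [c1] is the square-free representative of c2 c3, not a quotient of d1. *)
have [c1 sc1 hc1] := sqfree_rep (mulf_neq0 c20 c30); have [c10 _] := sc1.
have hc : is_sq (c1 * c2 * c3) by rewrite -mulrA mulrC.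
have hcp q pq : sg q c1 = xor3 (sg q c2) (sg q c3) := is_sq_sg3 pq c10 c20 c30 hc.
have copr q : prime q -> (q %| n)%N -> vo q c2 = false /\ vo q c3 = false.
  move=> pq qn.
  have aux (s0 c g : int) : sqfree s0 -> s0 = c * g -> c != 0 -> g != 0 ->
      ((q%:Z %| s0)%Z -> (q%:Z %| g)%Z) -> vo q c = false.
    move=> ss Es c0 g0 h; apply/negbTE/negP => voc.
    have vc : (0 < vv q c)%N by move: voc; rewrite /vo; case: (vv q c).
    have dc : (q%:Z %| c)%Z by rewrite -[q]expn1 -vv_ge.
    have vg : (0 < vv q g)%N by rewrite vv_ge // expn1 h // Es dvdz_mulr.
    by have := sqfree_vv pq ss; rewrite Es vvM //; clear -vc vg; lia.
  split.
    by apply: (aux _ _ _ s2 Ec2) => //; rewrite !dvdzE /= => h; rewrite dvdn_gcd h.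
  by apply: (aux _ _ _ s3 Ec3) => //; rewrite !dvdzE absz_pstar /= => h; rewrite dvdn_gcd h.
have vog q : prime q -> ~~ (q %| n)%N -> vo q g2%:Z = false /\ vo q (pstar g3) = false.
  move=> pq qn; rewrite /vo vv_pstar !vv_unit //; apply: contra qn; rewrite dvdzE /= => h;
    exact: dvdn_trans h _.
have LSodd q : prime q -> odd q -> LS q e1 e2 e3 c1 c2 c3.
  move=> pq oq; have hLq := hL q pq; have hpq := hp q pq.
  have Q2 := odd_prime_neq2 oq.
  case/orP: (bad_or_good pq) => [re|/and3P [n1 n2 n3]].
    have nM : ~~ (q%:Z %| n%:Z)%Z by exact: bad_ndvd_n re _.
    have sn : sg q n%:Z = sg q 1 by exact: sg_dvd_n.
    (* Multiplying d2 = c2 g2 once more by g2 gives c2 up to a square, and likewise for c3: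
       multiplication also divides out the n-part. *)
    have [k1 [k10 _] hk1] := sqfree_rep (mulf_neq0 g20 p30).
    have hk : sg q k1 = xor3 (sg q g2%:Z) (sg q (pstar g3)).
      by apply: is_sq_sg3 => //; rewrite -mulrA mulrC.
    have := LS_mul_norm pq oq re nz nM g2n g3n k10 d10 d20 d30 hk hpq hLq.
    move=> /(LS_untwist pq nz sn); apply: LS_sg.
    - rewrite sgM // hk hpq Ec2 Ec3 (sgM pq c20 g20) (sgM pq c30 p30).
      by rewrite xor3_mix hcp.
    - by rewrite Ec2 mulrC -mulrA -expr2 sgMsqr.
    - by rewrite Ec3 mulrC -mulrA -expr2 sgMsqr.
  (* For the untwisted curve such a q has good reduction even if it divides n, so even valuations
     are all that is needed. *)
  have [v2c v3c] : vo q c2 = false /\ vo q c3 = false.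
    case: (boolP (q %| n)%N) => [qn|qn]; first exact: copr.
    have nM : ~~ (q%:Z %| n%:Z)%Z by rewrite dvdzE.
    have vE (e : int) : e != 0 -> ~~ (q%:Z %| e)%Z -> vv q (e * n%:Z) = 0%N.
      by move=> h ne; rewrite vvM // !vv_unit.
    have [w2 w3] := LS_unramified pq oq (twist_sum n sE) E10 E20 E30 (vE _ b1 n1) (vE _ b2 n2) (vE _ b3 n3) hpq hLq.
    have [u2 u3] := vog q pq qn.
    by move: w2 w3; rewrite Ec2 Ec3 (voM pq c20 g20) (voM pq c30 p30) u2 u3 !addbF.
  by apply: LS_good => //; exact: hcp.
have [n2 vo2g2 vo2g3] : [/\ ~~ (2 %| n)%N, vo 2 g2%:Z = false & vo 2 (pstar g3) = false].
  have h : ~~ (2 %| n)%N by rewrite dvdn2 odd_n.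
  by have [? ?] := vog 2 isT h.
have v2c : vo 2 c2 = false by move: v2; rewrite Ec2 voM // vo2g2 addbF.
have v3c : vo 2 c3 = false by move: v3; rewrite Ec3 voM // vo2g3 addbF.
have [[a11 a12] [a21 a22]] := (a1, a2).
(* The 2-adic condition is read off on the twisted curve; it passes to c3 because [pstar g3] is 1
   mod 4. *)
have ep3 : ep c3 = false.
  have h4 := ndvd4_twist a22.
  have := LS2_ep (twist_sum n sE) E20 E30 (dvdz_mulr _ a21) h4 (dvdz_mulr _ a3) (hp 2 isT) v2 v3 (hL 2 isT).
  by rewrite Ec3 epM // ep_pstar // addbF.
have c13 : 0 < c1 * c3.
  have := is_sq_gt0 (mulf_neq0 (mulf_neq0 c10 c20) c30) hc.
  by rewrite mulrAC pmulr_lgt0.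
have LS2 : LS 2 e1 e2 e3 c1 c2 c3.
  by apply: LS_two.
have Sc : Sel2 e1 e2 e3 1%N%:Z (c1, c2, c3).
  apply/(Sel2P sE e1n e20 e3p (isT : (0 < 1)%N)); split=> //= q pq; rewrite !mulr1 /t1 /t2 /t3 /=.
  case: (altP (q =P 2)) => [->//|q2].
  by apply: LSodd => //; exact: odd_prime2.
have [C1 C2 C3] := Sel2_iso_trivial sE e1n e20 e3p a1 a2 iso Sc v2c v3c.
rewrite C2 mul1r in Ec2; rewrite C3 mul1r in Ec3.
have h2 : (t2 s %| n%:Z)%Z by rewrite Ec2 dvdzE.
have h3 : (t3 s %| n%:Z)%Z by rewrite Ec3 dvdzE absz_pstar.
split=> //; last by rewrite Ec3 pstar_mod4.
(* By parity of valuations, a prime dividing the square-free d1 divides d2 or d3. *)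
apply: sqfree_dvd_of_primes => // q pq; have := hp q pq; rewrite /sg /xor3 => -[-> _ _] /=.
rewrite (vo_sqfree pq s2) (vo_sqfree pq s3).
by case: (boolP (q%:Z %| t2 s)%Z) => [h _|_ /= h]; [have := dvdz_trans h h2|have := dvdz_trans h h3]; rewrite dvdzE.
Qed.

(** Off n the local conditions are automatic: at odd bad primes by [LS_mul_norm] applied to (1, 1,
    1), at good ones because the valuations are even, and at 2 by [LS_two], which takes all odd
    primes as input. *)
Lemma normal_Sel2 (d1 : int) g2 g3 : sqfree d1 -> (g2 %| n)%N -> (g3 %| n)%N ->
  is_sq (d1 * g2%:Z * pstar g3) ->
  (forall q, prime q -> (q %| n)%N -> LS q (e1 * n%:Z) (e2 * n%:Z) (e3 * n%:Z) d1 g2%:Z (pstar g3)) ->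
  Sel2 e1 e2 e3 n%:Z (d1, g2%:Z, pstar g3).
Proof.
move=> s1 h2 h3 sq hLn; have [d10 _] := s1.
have nz : n%:Z != 0 by rewrite eqz_nat -lt0n.
have g2p : 0 < g2%:Z by rewrite ltz_nat (dvdn_gt0 n0).
have g20 : g2%:Z != 0 by rewrite gt_eqF.
have [og2 og3] := conj (odd_dvd odd_n h2) (odd_dvd odd_n h3); have p30 := pstar_neq0 og3.
have [[E10 E20 E30] sumE] := (twist_neq0 e1n e20 e3p n0, twist_sum n sE).
have hp q pq : sg q d1 = xor3 (sg q g2%:Z) (sg q (pstar g3)) := is_sq_sg3 pq d10 g20 p30 sq.
have vog q : prime q -> ~~ (q %| n)%N -> vo q g2%:Z = false /\ vo q (pstar g3) = false.
  move=> pq qn; rewrite /vo vv_pstar !vv_unit //; apply: contra qn; rewrite dvdzE /= => h;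
    exact: dvdn_trans h _.
have LSodd q : prime q -> odd q -> LS q (e1 * n%:Z) (e2 * n%:Z) (e3 * n%:Z) d1 g2%:Z (pstar g3).
  move=> pq oq; case: (boolP (q %| n)%N) => [|qn]; first exact: hLn.
  have nM : ~~ (q%:Z %| n%:Z)%Z by rewrite dvdzE.
  case/orP: (bad_or_good pq) => [re|/and3P [n1 n2 n3]].
    have hc : LS q (e1 * n%:Z) (e2 * n%:Z) (e3 * n%:Z) 1 1 1 by exact: LS_const.
    have h1 : sg q 1 = xor3 (sg q 1) (sg q 1) by rewrite xor3ss sg1.
    by have := LS_mul_norm pq oq re nz nM h2 h3 d10 (oner_neq0 _) (oner_neq0 _) (oner_neq0 _) (hp q pq) h1 hc; rewrite !mulr1.
  have [u2 u3] := vog q pq qn.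
  by apply: LS_good => //; rewrite ?Euclid_dvdzM ?negb_or ?nM ?n1 ?n2 ?n3 //; exact: hp.
have [[a11 a12] [a21 a22]] := (a1, a2).
apply/(Sel2P sE e1n e20 e3p n0); split=> //.
- by split=> //; apply: (sqfree_dvd sqn); rewrite dvdzE.
- by apply: (sqfree_dvd sqn); rewrite dvdzE absz_pstar.
move=> q pq; rewrite /t1 /t2 /t3 /=; case: (altP (q =P 2)) => [->|q2]; last first.
  by apply: LSodd => //; exact: odd_prime2.
have n2 : ~~ (2 %| n)%N by rewrite dvdn2 odd_n.
have [v2 v3] := vog 2 isT n2.
have d13 : 0 < d1 * pstar g3.
  have := is_sq_gt0 (mulf_neq0 (mulf_neq0 d10 g20) p30) sq.
  by rewrite mulrAC pmulr_lgt0.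
by apply: LS_two => //; first [exact: twist_e1|exact: twist_e3|exact: dvdz_mulr|exact: ndvd4_twist|exact: ep_pstar].
Qed.

End Descent.

(** * The Monsky matrix *)

Lemma lgN q (a : int) : prime q -> odd q -> a != 0 -> lg q (- a) = lg q (-1) (+) lg q a.
Proof. by move=> pq oq a0; rewrite -[- a]mulN1r lgM. Qed.

Lemma lg_unit q (a : int) : ~~ (q%:Z %| a)%Z -> lg q a = nr q a.
Proof. by move=> na; rewrite /lg up_unit. Qed.

(** Each pair of parities of (d2, d3) occurs in exactly one of the four classes of [LS_ramified].
    They form a plane in F_2^4 on which [lg q d2] and [lg q d3] are linear in the parities; these
    two equations are the rows of the matrix at q. *)
Lemma LS_ramified_rows q (e1 e2 e3 n d1 d2 d3 : int) : prime q -> odd q -> e1 + e2 + e3 = 0 ->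
  ~~ (q%:Z %| e1)%Z -> ~~ (q%:Z %| e2)%Z -> ~~ (q%:Z %| e3)%Z -> vv q n = 1%N -> n != 0 ->
  d1 != 0 -> d2 != 0 -> d3 != 0 -> sg q d1 = xor3 (sg q d2) (sg q d3) ->
  LS q (e1 * n) (e2 * n) (e3 * n) d1 d2 d3 <->
  lg q d2 (+) (vo q d2 && (lg q n (+) lg q (- e1))) (+) (vo q d3 && lg q (- e1 * e3)) = false /\
  lg q d3 (+) (vo q d3 && (lg q n (+) lg q e1)) (+) (vo q d2 && lg q (- e1 * e2)) = false.
Proof.
move=> pq oq sE n1 n2 n3 vn n0 d10 d20 d30 hp.
have [z1 z2 z3] := And3 (ndvdzW n1) (ndvdzW n2) (ndvdzW n3).
have N0 (a : int) : a != 0 -> - a != 0 by rewrite oppr_eq0.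
have vE (e : int) : ~~ (q%:Z %| e)%Z -> vv q (e * n) = 1%N.
  by move=> ne; rewrite vvM ?(ndvdzW ne) // vn (vv_unit ne).
rewrite LS_ramified ?vE ?mulf_neq0 //; last by rewrite -!mulrDl sE mul0r.
have Sg (a : int) : sg q a = (vo q a, lg q a, false) by rewrite /sg (negbTE (odd_prime_neq2 oq)).
have vN (a : int) : vo q (- a) = vo q a by rewrite /vo /vv abszN.
have von : vo q n = true by rewrite /vo vn.
have V (e : int) : ~~ (q%:Z %| e)%Z -> vo q e = false by move=> h; rewrite /vo vv_unit.
have [w1 w2 w3] := And3 (V _ n1) (V _ n2) (V _ n3).
(* The symbol of -1 becomes a free boolean, so that both directions are truth tables. *)
have [m LN] : exists m, forall a : int, a != 0 -> lg q (- a) = m (+) lg q a.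
  by exists (lg q (-1)) => a; exact: lgN.
rewrite !Sg !mulNr !vN !voM ?mulf_neq0 // !LN ?mulf_neq0 // !lgM ?mulf_neq0 // w1 w2 w3 von.
have [-> ->] : vo q 1 = false /\ lg q 1 = false by have := sg1 pq; rewrite Sg => -[-> ->].
move: (vo q d2) (lg q d2) (vo q d3) (lg q d3) (lg q e1) (lg q e2) (lg q e3) (lg q n) {LN} => y D z F a b c l.
split=> [h|[/negbT h1 /negbT h2]].
  have {h} : [|| (y, D, z, F) == (false, false, false, false),
      (y, D, z, F) == (true, c (+) l, true, m (+) (b (+) l)),
      (y, D, z, F) == (false, m (+) (a (+) l (+) (c (+) l)), true, a (+) l) |
      (y, D, z, F) == (true, m (+) (a (+) l), false, m (+) (a (+) l (+) (b (+) l)))].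
    by case: h => [[[-> ->] [-> ->]]|[[-> ->] [-> ->]]|[[-> ->] [-> ->]]|[[-> ->] [-> ->]]];
      rewrite eqxx ?orbT.
  by case: y; case: z; case: D; case: F; case: m; case: a; case: b; case: c; case: l.
have : [|| (y, D, z, F) == (false, false, false, false),
      (y, D, z, F) == (true, c (+) l, true, m (+) (b (+) l)),
      (y, D, z, F) == (false, m (+) (a (+) l (+) (c (+) l)), true, a (+) l) |
      (y, D, z, F) == (true, m (+) (a (+) l), false, m (+) (a (+) l (+) (b (+) l)))].
  by move: h1 h2; case: y; case: z; case: D; case: F; case: m; case: a; case: b; case: c; case: l.
by case/or4P => /eqP [-> -> -> ->]; [constructor 1|constructor 2|constructor 3|constructor 4].
Qed.

Section PrimeProducts.
Variables (k : nat) (p : 'I_k -> nat).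
Hypotheses (pp : forall i, prime (p i)) (pinj : injective p).

Definition bprod (b : 'I_k -> bool) : nat := (\prod_(i < k) (if b i then p i else 1))%N.

Lemma prime_dvd_bprod q (b : 'I_k -> bool) : prime q -> (q %| bprod b)%N -> exists2 i, b i & q = p i.
Proof.
move=> pq; rewrite /bprod; elim/big_ind: _ => [|x y hx hy|i _].
- by rewrite dvdn1 => /eqP q1; rewrite q1 in pq.
- by rewrite Euclid_dvdM // => /orP [/hx|/hy].
- case: ifP => bi; last by rewrite dvdn1 => /eqP q1; rewrite q1 in pq.
  by rewrite dvdn_prime2 // => /eqP ->; exists i.
Qed.

Lemma dvd_bprod i (b : 'I_k -> bool) : (p i %| bprod b)%N = b i.
Proof.
apply/idP/idP => [/(prime_dvd_bprod (pp i)) [j bj /pinj -> //]|bi].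
by rewrite /bprod (bigD1 i) //= bi dvdn_mulr.
Qed.

Lemma bprod_sub (b b' : 'I_k -> bool) : (forall i, b i -> b' i) -> (bprod b %| bprod b')%N.
Proof.
move=> h; rewrite /bprod; elim/big_rec2: _ => // i x y _ hxy.
by apply: dvdn_mul => //; have := h i; case: (b i) => // ->.
Qed.

Variable n : nat.
Hypotheses (n0 : (0 < n)%N) (nE : (n = \prod_(i < k) p i)%N) (sqn : sqfree n%:Z).

Lemma bprod_dvd b : (bprod b %| n)%N.
Proof. by rewrite nE -/(bprod (fun=> true)); exact: bprod_sub. Qed.

Lemma prime_dvd_n q : prime q -> (q %| n)%N -> exists i, q = p i.
Proof. by rewrite nE -/(bprod (fun=> true)) => pq /(prime_dvd_bprod pq) [i _ ->]; exists i. Qed.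

Lemma p_dvd_n i : (p i %| n)%N.
Proof. by rewrite nE (bigD1 i) //= dvdn_mulr. Qed.

Lemma vv_p_n i : vv (p i) n%:Z = 1%N.
Proof.
apply/eqP; rewrite eqn_leq sqfree_vv // vv_ge ?eqz_nat -?lt0n // expn1.
by rewrite dvdzE /= p_dvd_n.
Qed.

Lemma sqfree_of_dvd g : (g %| n)%N -> sqfree g%:Z.
Proof. by move=> h; apply: (sqfree_dvd sqn); rewrite dvdzE. Qed.

Lemma vo_p_dvd g i : (g %| n)%N -> vo (p i) g%:Z = (p i %| g)%N.
Proof. by move=> h; rewrite vo_sqfree ?dvdzE //; exact: sqfree_of_dvd. Qed.

Lemma bprodE g : (g %| n)%N -> g = bprod (fun i => p i %| g)%N.
Proof.
move=> gn; have bn := bprod_dvd (fun i => p i %| g)%N.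
apply: (@sqfree_vo_eq g%:Z (bprod _)%:Z); rewrite ?sqfree_of_dvd //; try exact: sqfree_of_dvd.
move=> q pq; rewrite !vo_sqfree ?dvdzE //=; try exact: sqfree_of_dvd.
apply/idP/idP => [qg|].
  by have [i E] := prime_dvd_n pq (dvdn_trans qg gn); rewrite E dvd_bprod -E.
by case/(prime_dvd_bprod pq) => i h ->.
Qed.

Hypothesis odd_n : odd n.

Lemma odd_p i : odd (p i).
Proof. exact: odd_dvd (p_dvd_n i). Qed.

Lemma lg_bprod q (F : nat -> int) b : prime q -> odd q -> F 1%N = 1 ->
  (forall a, odd a -> F a != 0) -> (forall a c, odd a -> odd c -> F (a * c)%N = F a * F c) ->
  lg q (F (bprod b)) = \big[addb/false]_(i < k) (b i && lg q (F (p i))).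
Proof.
move=> pq oq F1 F0 FM.
have l1 : lg q 1 = false.
  by have := sg1 pq; rewrite /sg (negbTE (odd_prime_neq2 oq)) => -[].
suff [] : odd (bprod b) /\ lg q (F (bprod b)) = \big[addb/false]_(i < k) (b i && lg q (F (p i))) by [].
rewrite /bprod; elim/big_rec2: _ => [|i x y _ [oy E]]; first by rewrite F1 l1.
case: (b i) => /=; last by rewrite mul1n.
by rewrite oddM odd_p oy FM ?odd_p // lgM ?F0 ?odd_p // E.
Qed.

Lemma lg_self i : lg (p i) (p i)%:Z = false.
Proof.
have n1 : ~~ ((p i)%:Z %| 1)%Z by rewrite dvdzE /= dvdn1 neq_ltn prime_gt1 ?orbT.
have [_ E] := vv_up_uniq 1 (pp i) n1.
by rewrite expn1 mulr1 in E; rewrite /lg E nr1.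
Qed.

(** -n has valuation 1 at p_i. Off the diagonal the symbol is the residue symbol of p_j mod p_i; on
    it, it is that of -(-n / p_i) = n / p_i, the unit part of n. *)
Lemma hilb_pp i j : hilb (p i) (p j)%:Z (- n%:Z) =
  (lg (p i) (p j)%:Z (+) ((i == j) && lg (p i) n%:Z))%:R.
Proof.
have oi := odd_p i; have pi := pp i.
have nz : n%:Z != 0 by rewrite eqz_nat -lt0n.
have nz' : - n%:Z != 0 by rewrite oppr_eq0.
have vn : vv (p i) (- n%:Z) = 1%N by rewrite /vv abszN; exact: vv_p_n.
case: eqP => [<-|ij] /=.
  rewrite hilb_uniformizer // lg_self /lg; congr (_%:R); congr nr.
  rewrite -[- n%:Z]mulN1r upM // up_unit ?mulN1r ?opprK //.
  by rewrite dvdzE /= dvdn1 neq_ltn prime_gt1 ?orbT.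
have pij : p i != p j by apply/eqP => /pinj.
by rewrite hilb_unit ?prime_ndvdz // addbF lg_prime.
Qed.

(* Quadratic reciprocity in the form (p/q) = (q*/p); on the diagonal it accounts for the sign of p*. *)
Lemma lg_reciprocity i j : lg (p j) (p i)%:Z =
  lg (p i) (pstar (p j)) (+) ((i == j) && lg (p i) (-1)).
Proof.
have [oi oj] := conj (odd_p i) (odd_p j); have [pi pj] := conj (pp i) (pp j).
have pj0 : (p j)%:Z != 0 by rewrite eqz_nat -lt0n prime_gt0.
have nm : lg (p i) (-1) = odd (p i)./2 by rewrite lg_N1 // nrN1.
have star : lg (p i) (pstar (p j)) = (odd (p j)./2 && odd (p i)./2) (+) lg (p i) (p j)%:Z.
  rewrite /pstar; have -> : (p j %% 4 == 1)%N = ~~ odd (p j)./2 by have := q_half oj; lia.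
  by case: (odd (p j)./2) => //=; rewrite lgN // nm.
rewrite star nm; case: eqP => [->|ij] /=; first by rewrite andbb lg_self addbF addbb.
have pij : p i != p j by apply/eqP => /pinj.
have pji : p j != p i by rewrite eq_sym.
rewrite addbF !lg_prime // andbC -(quadratic_reciprocity pi pj oi oj pij).
by case: (nr _ _); case: (nr _ _).
Qed.

Lemma big_addb_delta i (c : bool) (b : 'I_k -> bool) :
  \big[addb/false]_(j < k) (((i == j) && c) && b j) = c && b i.
Proof.
rewrite (bigD1 i) //= eqxx big1 ?addbF // => j.
by rewrite eq_sym => /negbTE ->.
Qed.

(** By multiplicativity the symbols of the p_j in the support of y add up to that of d2. In the
    transposed block, reciprocity replaces the symbol of p_i mod p_j by that of [pstar (p j)] mod
    p_i, which is why d3 is a product of such factors; its diagonal correction by -1 turns -e1 into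
    e1 in the second row. *)
Lemma Mmat_kernel (e1 e2 e3 : int) (y z : 'I_k -> bool)
    (d2 := (bprod y)%:Z) (d3 := pstar (bprod z)) :
  (forall i, [/\ ~~ ((p i)%:Z %| e1)%Z, ~~ ((p i)%:Z %| e2)%Z & ~~ ((p i)%:Z %| e3)%Z]) ->
  Mmat e1 e2 e3 p n *m col_mx (\col_i (y i)%:R) (\col_i (z i)%:R) = 0 <->
  forall i, lg (p i) d2 (+) (y i && (lg (p i) n%:Z (+) lg (p i) (- e1))) (+) (z i && lg (p i) (- e1 * e3)) = false /\
    lg (p i) d3 (+) (z i && (lg (p i) n%:Z (+) lg (p i) e1)) (+) (y i && lg (p i) (- e1 * e2)) = false.
Proof.
move=> ne.
have nq i (u : int) : ~~ ((p i)%:Z %| u)%Z -> nqr u (p i) = (lg (p i) u)%:R.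
  by move=> nu; rewrite nqrE ?odd_p // lg_unit.
have R1 i : ((Amat p n + Dmat p (- e1)) *m (\col_i (y i)%:R) + Dmat p (- e1 * e3) *m (\col_i (z i)%:R)) i 0 =
  (lg (p i) d2 (+) (y i && (lg (p i) n%:Z (+) lg (p i) (- e1))) (+) (z i && lg (p i) (- e1 * e3)))%:R.
  have [n1 n2 n3] := ne i.
  rewrite mulmxDl /Dmat !mul_diag_mx !mxE !nq ?mulNr ?rpredN ?Euclid_dvdzM ?negb_or ?n1 //.
  rewrite (eq_bigr (fun j => (((lg (p i) (p j)%:Z) && y j) (+) (((i == j) && lg (p i) n%:Z) && y j))%:R)); last first.
    by move=> j _; rewrite !mxE hilb_pp F2_andb andb_addl.
  rewrite F2_sum big_split /= big_addb_delta !F2_andb !F2_addb.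
  rewrite (lg_bprod (F := Posz) y (pp i) (odd_p i)) //; last by case.
  congr (nat_of_bool _)%:R; rewrite (eq_bigr (fun j => y j && lg (p i) (p j)%:Z)) => [|j _]; last exact: andbC.
  case: (bigop _ _ _); case: (y i); case: (z i); case: (lg _ n%:Z); case: (lg _ (- e1)); by case: (lg _ _).
have R2 i : (Dmat p (- e1 * e2) *m (\col_i (y i)%:R) + ((Amat p n)^T + Dmat p (- e1)) *m (\col_i (z i)%:R)) i 0 =
  (lg (p i) d3 (+) (z i && (lg (p i) n%:Z (+) lg (p i) e1)) (+) (y i && lg (p i) (- e1 * e2)))%:R.
  have [n1 n2 n3] := ne i.
  rewrite mulmxDl /Dmat !mul_diag_mx !mxE !nq ?mulNr ?rpredN ?Euclid_dvdzM ?negb_or ?n1 //.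
  rewrite (eq_bigr (fun j => (((lg (p i) (pstar (p j))) && z j) (+)
      (((i == j) && (lg (p i) (-1) (+) lg (p i) n%:Z)) && z j))%:R)); last first.
    move=> j _; rewrite !mxE hilb_pp F2_andb lg_reciprocity.
    have -> : (j == i) && lg (p j) n%:Z = (i == j) && lg (p i) n%:Z.
      by rewrite eq_sym; case: eqP => // ->.
    by case: (i == j); case: (lg _ (pstar _)); case: (lg _ (-1)); case: (lg _ n%:Z); case: (z j).
  rewrite F2_sum big_split /= big_addb_delta !F2_andb !F2_addb.
  rewrite (lg_bprod z (pp i) (odd_p i) pstar1 pstar_neq0 pstarM).
  congr (nat_of_bool _)%:R; rewrite (eq_bigr (fun j => z j && lg (p i) (pstar (p j)))) => [|j _]; last exact: andbC.
  rewrite (lgN (pp i) (odd_p i) (ndvdzW n1)).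
  case: (bigop _ _ _); case: (y i); case: (z i); case: (lg _ n%:Z); case: (lg _ (-1)); case: (lg _ e1); by case: (lg _ _).
rewrite /Mmat mul_block_col; split=> [/eqP|H].
  rewrite col_mx_eq0 => /andP [/eqP h1 /eqP h2] i.
  have := R1 i; have := R2 i; rewrite h1 h2 !mxE => /esym /eqP + /esym /eqP.
  by rewrite !F2_eq0 => /negbTE -> /negbTE ->.
apply/eqP; rewrite col_mx_eq0; apply/andP; split; apply/eqP/matrixP => i j; rewrite (ord1 j).
  by rewrite R1 [RHS]mxE; have [-> _] := H i.
by rewrite R2 [RHS]mxE; have [_ ->] := H i.
Qed.

End PrimeProducts.

(** * The normalised representatives and the kernel *)

(** The quotient Sel_2' is not formed as a type: the first clause makes the normalised triples a
    system of representatives, and additivity is expressed through [equivT]. *)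
Theorem theorem4p5 (e1 e2 e3 : int) (n k : nat) (p : 'I_k -> nat) :
  e1 != 0 -> e2 != 0 -> e3 != 0 -> e1 + e2 + e3 = 0 ->
  two_exact e1 -> two_exact e2 -> (4 %| e3)%Z ->
  odd n -> (0 < n)%N -> sqfree n%:Z -> coprimez n%:Z (e1 * e2 * e3) ->
  (forall i, prime (p i)) -> injective p -> (n = \prod_(i < k) p i)%N ->
  (forall q r : nat, prime q -> (q %| n)%N -> prime r -> odd r ->
     (r%:Z %| e1 * e2 * e3)%Z -> nqr q%:Z r = 0) ->
  ~ has_pt4 e1 e2 1 -> ~ has_pt4 e1 e2 n%:Z ->
  0 < e3 -> e1 < 0 ->
  (forall q r : nat, prime q -> (q %| n)%N -> prime r -> odd r ->
     (r%:Z %| e1 * e3)%Z -> nqr (pstar q) r = 0) ->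
  Sel2_iso_Z2sq e1 e2 e3 1 ->
  (* unique normalized representative in every class of Sel_2'(E^(n)) *)
  (forall s, Sel2 e1 e2 e3 n%:Z s ->
     exists r, [/\ normrep e1 e2 e3 n r, equivT e1 e2 e3 n%:Z s r &
                forall r', normrep e1 e2 e3 n r' -> equivT e1 e2 e3 n%:Z s r' -> r' = r]) /\
  (* the induced map Sel_2'(E^(n)) -> ker M is a group isomorphism *)
  (forall r r' r'', normrep e1 e2 e3 n r -> normrep e1 e2 e3 n r' -> normrep e1 e2 e3 n r'' ->
     equivT e1 e2 e3 n%:Z (mul3 r r') r'' -> yz p r'' = yz p r + yz p r') /\
  (forall r r', normrep e1 e2 e3 n r -> normrep e1 e2 e3 n r' -> yz p r = yz p r' -> r = r') /\
  (forall r, normrep e1 e2 e3 n r -> Mmat e1 e2 e3 p n *m yz p r = 0) /\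
  (forall v : 'cV['F_2]_(k + k), Mmat e1 e2 e3 p n *m v = 0 ->
     exists2 r, normrep e1 e2 e3 n r & yz p r = v).
Proof.
move=> e10 e20 e30 sE a1 a2 a3 odd_n n0 sqn cop pp pinj nE hres _ _ e3p e1n hstar iso.
have nz : n%:Z != 0 by rewrite eqz_nat -lt0n.
have SelP := Sel2P sE e1n e20 e3p n0.
have ne i := n_e_ndvd3 cop (pp i) (p_dvd_n nE i).
have Mker := Mmat_kernel pp pinj n0 nE sqn odd_n _ _ ne.
have norm0 r : normrep e1 e2 e3 n r -> [/\ t1 r != 0, t2 r != 0 & t3 r != 0].
  by move=> [[[? _] [[? _] [[? _] _]]] _].
have norm_form r : normrep e1 e2 e3 n r -> [/\ (`|t2 r| %| n)%N, (`|t3 r| %| n)%N,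
    t2 r = `|t2 r|%N%:Z & t3 r = pstar `|t3 r|].
  move=> [_ [_ h2 h3 p2 m3]]; split; [by rewrite dvdzE in h2|by rewrite dvdzE in h3| |exact: pstar_of_mod4].
  by rewrite gez0_abs // ltW.
have norm_vo2 r : normrep e1 e2 e3 n r -> vo 2 (t2 r) = false /\ vo 2 (t3 r) = false.
  move=> nr; have [h2 h3 _ _] := norm_form r nr.
  by rewrite /vo !vv_unit // dvdzE /= dvdn2 negbK; exact: odd_dvd odd_n _.
have norm_eq r r' : normrep e1 e2 e3 n r -> normrep e1 e2 e3 n r' ->
    is_sq (t2 r * t2 r') -> is_sq (t3 r * t3 r') -> r = r'.
  move=> nr nr' h2 h3; have [d10 d20 d30] := norm0 r nr; have [d10' d20' d30'] := norm0 r' nr'.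
  have [[s1 [s2 [s3 [sq _]]]] _] := nr; have [[s1' [s2' [s3' [sq' _]]]] _] := nr'.
  (* The class of d1 is determined by d2 and d3. *)
  have h1 : is_sq (t1 r * t1 r').
    apply: (@is_sq_cancel _ (t2 r * t2 r' * (t3 r * t3 r'))); first by rewrite !mulf_neq0.
      exact: is_sqM.
    have := is_sqM sq sq'.
    by rewrite (_ : t1 r * t2 r * t3 r * _ = t1 r * t1 r' * (t2 r * t2 r' * (t3 r * t3 r'))) //; ring.
  move: (sqfree_eq s1 s1' h1) (sqfree_eq s2 s2' h2) (sqfree_eq s3 s3' h3); clear.
  by case: r => [[? ?] ?]; case: r' => [[? ?] ?]; rewrite /t1 /t2 /t3 /= => -> -> ->.
have vo3 (a b c : int) : a != 0 -> b != 0 -> c != 0 -> is_sq (a * b * c) ->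
    forall q, prime q -> vo q a = vo q b (+) vo q c.
  by move=> a0 b0 c0 h q pq; have [-> _ _] := is_sq_sg3 pq a0 b0 c0 h.
have torsn := tors_neq0 e1n e20 e3p n0.
have norm_yz r : normrep e1 e2 e3 n r -> yz p r =
    col_mx (\col_i (p i %| `|t2 r|)%N%:R) (\col_i (p i %| `|t3 r|)%N%:R).
  move=> nr; have [h2 h3 _ _] := norm_form r nr; rewrite /yz.
  by congr col_mx; apply/matrixP => i j; rewrite !mxE; congr (nat_of_bool _)%:R; exact: (vo_p_dvd pp sqn).
have t0 : ((1, 1, 1) : triple) \in tors e1 e2 e3 n%:Z by rewrite !inE eqxx.
split; last split; last split; last split.
- move=> s Ss; have [[s10 _] [[s20 _] [[s30 _] _]]] := Ss.
  (* Translation by the torsion class with the same 2-adic parities as s makes both valuations even,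
     as [descent] requires. *)
  have [t ht [h2 h3]] := tors_vo2_full e1n e20 e3p n0 odd_n a1 a2 (vo 2 (t2 s)) (vo 2 (t3 s)).
  have [r Sr [q1 q2 q3]] := Sel2_translate sE e1n e20 e3p n0 Ss ht.
  have [[r10 _] [[r20 _] [[r30 _] _]]] := Sr; have [t10 t20 t30] := torsn t ht.
  have v2 : vo 2 (t2 r) = false.
    by have := vo3 _ _ _ t20 s20 r20 q2 2 isT; rewrite h2; case: (vo 2 (t2 s)); case: (vo 2 (t2 r)).
  have v3 : vo 2 (t3 r) = false.
    by have := vo3 _ _ _ t30 s30 r30 q3 2 isT; rewrite h3; case: (vo 2 (t3 s)); case: (vo 2 (t3 r)).
  have [k1 k2 k3 k4] := descent sE e1n e20 e3p a1 a2 a3 odd_n n0 cop hres hstar iso Sr v2 v3.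
  have nr : normrep e1 e2 e3 n r by split=> //; split=> //; have [] := (SelP r).1 Sr.
  exists r; split=> //.
    exists t => //; rewrite /sqeq3 /mul3 /t1 /t2 /t3 /= -!/(t1 _) -!/(t2 _) -!/(t3 _).
    by rewrite ![_ * t1 t]mulrC ![_ * t2 t]mulrC ![_ * t3 t]mulrC !mulrA.
  move=> r' nr' [t' ht' []]; rewrite /mul3 /= => _ [].
  move=> q2' q3'; have {}q2' : is_sq (t2 s * t2 r' * t2 t') by exact: q2'.
  have {}q3' : is_sq (t3 s * t3 r' * t3 t') by exact: q3'.
  have [r10' r20' r30'] := norm0 r' nr'; have [w2 w3] := norm_vo2 r' nr'; have [t10' t20' t30'] := torsn t' ht'.
  (* In r' both valuations at 2 are even, so [t'] must have the parities of s as well. *)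
  have Et : t' = t.
    apply: (tors_vo2_inj e1n e20 e3p n0 odd_n a1 a2) => //.
      by have := vo3 _ _ _ s20 r20' t20' q2' 2 isT; rewrite w2 h2 => ->.
    by have := vo3 _ _ _ s30 r30' t30' q3' 2 isT; rewrite w3 h3 => ->.
  rewrite Et in q2' q3'.
  have cancel (a b u w : int) : u != 0 -> w != 0 -> is_sq (u * a * w) -> is_sq (w * u * b) -> is_sq (a * b).
    move=> u0 w0 ha hb; apply: (@is_sq_cancel _ ((u * w) * (u * w))); first by rewrite !mulf_neq0.
      by exists (u * w).
    have := is_sqM ha hb.
    by rewrite (_ : u * a * w * _ = a * b * (u * w * (u * w))) //; ring.
  by apply: norm_eq => //; [exact: cancel q2' q2|exact: cancel q3' q3].
- move=> r r' r'' nr nr' nr'' [t ht []]; rewrite /mul3 /= => _ [].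
  move=> q2 q3; have {}q2 : is_sq (t2 r * t2 r' * t2 r'' * t2 t) by exact: q2.
  have {}q3 : is_sq (t3 r * t3 r' * t3 r'' * t3 t) by exact: q3.
  have [_ r20 r30] := norm0 r nr; have [_ r20' r30'] := norm0 r' nr'; have [_ r20'' r30''] := norm0 r'' nr''.
  have [_ t20 t30] := torsn t ht.
  have [w2 w3] := norm_vo2 r nr; have [w2' w3'] := norm_vo2 r' nr'; have [w2'' w3''] := norm_vo2 r'' nr''.
  have V2 q : prime q -> vo q (t2 r) (+) vo q (t2 r') = vo q (t2 r'') (+) vo q (t2 t).
    by move=> pq; rewrite -voM // (vo3 _ _ _ _ _ _ q2) // mulf_neq0.
  have V3 q : prime q -> vo q (t3 r) (+) vo q (t3 r') = vo q (t3 r'') (+) vo q (t3 t).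
    by move=> pq; rewrite -voM // (vo3 _ _ _ _ _ _ q3) // mulf_neq0.
  (* All three triples have even valuations at 2, hence so has the torsion class relating them,
     which is therefore trivial. *)
  have Et : t = (1, 1, 1).
    apply: (tors_vo2_inj e1n e20 e3p n0 odd_n a1 a2) => //.
      by have := V2 2 isT; rewrite w2 w2' w2'' /= => <-.
    by have := V3 2 isT; rewrite w3 w3' w3'' /= => <-.
  have v1 q : prime q -> vo q 1 = false by move=> pq; rewrite /vo /vv logn1.
  rewrite /yz add_col_mx; congr col_mx; apply/matrixP => i j; rewrite !mxE F2_addb; congr (nat_of_bool _)%:R.
    by have := V2 _ (pp i); rewrite Et v1 // addbF => /esym.
  by have := V3 _ (pp i); rewrite Et v1 // addbF => /esym.
- move=> r r' nr nr'; rewrite !norm_yz // => /eq_col_mx [/matrixP E2 /matrixP E3].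
  have [h2 h3 f2 f3] := norm_form r nr; have [h2' h3' f2' f3'] := norm_form r' nr'.
  have b_inj : injective (fun b : bool => b%:R : 'F_2) by case; case.
  have G g g' : (g %| n)%N -> (g' %| n)%N -> (forall i, (p i %| g)%N = (p i %| g')%N) -> g = g'.
    move=> gn gn' E; rewrite (bprodE pp pinj nE sqn gn) (bprodE pp pinj nE sqn gn').
    by rewrite /bprod; apply: eq_bigr => i _; rewrite E.
  have e2E : t2 r = t2 r'.
    by rewrite f2 f2'; congr Posz; apply: G => // i; have := E2 i 0; rewrite !mxE => /b_inj.
  have e3E : t3 r = t3 r'.
    by rewrite f3 f3'; congr pstar; apply: G => // i; have := E3 i 0; rewrite !mxE => /b_inj.
  by apply: norm_eq => //; rewrite ?e2E ?e3E; [exists (t2 r')|exists (t3 r')].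
- move=> r nr; rewrite norm_yz //; apply/Mker => i.
  have [h2 h3 f2 f3] := norm_form r nr; have [d10 d20 d30] := norm0 r nr.
  have [_ _ sq _ hL] := (SelP r).1 (proj1 nr); have [n1 n2 n3] := ne i.
  have := (LS_ramified_rows (pp i) (odd_p nE odd_n i) sE n1 n2 n3 (vv_p_n pp n0 nE sqn i) nz d10 d20 d30
     (is_sq_sg3 (pp i) d10 d20 d30 sq)).1 (hL _ (pp i)).
  rewrite -(bprodE pp pinj nE sqn h2) -(bprodE pp pinj nE sqn h3) -f2 -f3.
  have -> : vo (p i) (t2 r) = (p i %| `|t2 r|)%N by exact: (vo_p_dvd pp sqn).
  by have -> : vo (p i) (t3 r) = (p i %| `|t3 r|)%N by exact: (vo_p_dvd pp sqn).
- move=> v hv.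
  pose y i := usubmx v i 0 != 0; pose z i := dsubmx v i 0 != 0.
  have Ev : v = col_mx (\col_i (y i)%:R) (\col_i (z i)%:R).
    rewrite -[LHS]vsubmxK; congr col_mx; apply/matrixP => i j; rewrite (ord1 j) [RHS]mxE; exact: F2_neq0.
  rewrite Ev in hv; have {hv} rows := (Mker y z).1 hv.
  pose g2 := bprod p y; pose g3 := bprod p z.
  have g2n : (g2 %| n)%N := bprod_dvd nE y; have g3n : (g3 %| n)%N := bprod_dvd nE z.
  have og3 := odd_dvd odd_n g3n; have p30 := pstar_neq0 og3.
  have g20 : g2%:Z != 0 by rewrite eqz_nat -lt0n (dvdn_gt0 n0).
  have [d1 s1 h1] := sqfree_rep (mulf_neq0 g20 p30); have [d10 _] := s1.
  have sq : is_sq (d1 * g2%:Z * pstar g3) by rewrite -mulrA mulrC.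
  have Sr : Sel2 e1 e2 e3 n%:Z (d1, g2%:Z, pstar g3).
    apply: (normal_Sel2 sE e1n e20 e3p a1 a2 a3 odd_n n0 sqn cop hres hstar) => // q pq qn.
    have [i Ei] := prime_dvd_n pp nE pq qn; subst q; have [n1 n2 n3] := ne i.
    apply: (LS_ramified_rows pq (odd_p nE odd_n i) sE n1 n2 n3 (vv_p_n pp n0 nE sqn i) nz d10 g20 p30
     (is_sq_sg3 pq d10 g20 p30 sq)).2.
    have -> : vo (p i) g2%:Z = y i by rewrite (vo_p_dvd pp sqn) // dvd_bprod.
    have -> : vo (p i) (pstar g3) = z i by rewrite /vo vv_pstar -/(vo _ _) (vo_p_dvd pp sqn) // dvd_bprod.
    exact: rows.
  have nr : normrep e1 e2 e3 n (d1, g2%:Z, pstar g3).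
    split=> //; rewrite /t1 /t2 /t3 /=; split=> //.
    + apply: sqfree_dvd_of_primes => // q pq; rewrite (vo3 _ _ _ d10 g20 p30 sq q pq).
      rewrite vo_sqfree //; last by apply: (sqfree_dvd sqn); rewrite dvdzE.
      rewrite vo_sqfree //; last by apply: (sqfree_dvd sqn); rewrite dvdzE absz_pstar.
      rewrite !dvdzE absz_pstar /=; case: (boolP (q %| g2)%N) => [h _|_ /= h]; exact: dvdn_trans h _.
    + by rewrite dvdzE absz_pstar.
    + by rewrite ltz_nat (dvdn_gt0 n0).
    + exact: pstar_mod4.
  exists (d1, g2%:Z, pstar g3) => //; rewrite norm_yz // [RHS]Ev /t2 /t3 /= absz_pstar.
  by congr col_mx; apply/matrixP => i j; rewrite !mxE dvd_bprod.
Qed.
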